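(* Let $(A,G,\alpha)$ be a pre-ordered Banach algebra dynamical system, with $A$ having a closed cone and a positive bounded approximate left identity. Let $\mathcal{R}$ be a uniformly bounded class of non-degenerate continuous covariant representations of $(A,G,\alpha)$ on Banach spaces. Then the map $(\pi,U)\mapsto(\pi\rtimes U)^{\mathcal{R}}$ is a bijection between the positive non-degenerate $\mathcal{R}$-continuous covariant representations of $(A,G,\alpha)$ on pre-ordered Banach spaces with closed cones and the positive non-degenerate bounded representations of $(A\rtimes_\alpha G)^{\mathcal{R}}$ on such spaces. More precisely: (1) If $(\pi,U)$ is a positive non-degenerate $\mathcal{R}$-continuous covariant representation of $(A,G,\alpha)$ on a pre-ordered Banach space $X_\pi$ with a closed cone, then $(\pi\rtimes U)^{\mathcal{R}}$ is a positive non-degenerate bounded representation of $(A\rtimes_\alpha G)^{\mathcal{R}}$ on $X_\pi$, and $$\left(\overline{(\pi\rtimes U)^{\mathcal{R}}}\circ i_A^{\mathcal{R}},\ \overline{(\pi\rtimes U)^{\mathcal{R}}}\circ i_G^{\mathcal{R}}\right)=(\pi,U),$$ where $\overline{(\pi\rtimes U)^{\mathcal{R}}}$ is the canonical positive non-degenerate bounded representation of $\mathcal{M}_l((A\rtimes_\alpha G)^{\mathcal{R}})$ on $X_\pi$ associated with $(\pi\rtimes U)^{\mathcal{R}}$. (2) If $T$ is a positive non-degenerate bounded representation of $(A\rtimes_\alpha G)^{\mathcal{R}}$ on a pre-ordered Banach space $X_T$ with a closed cone, then $(\overline{T}\circ i_A^{\mathcal{R}},\overline{T}\circ i_G^{\mathcal{R}})$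 is a positive non-degenerate $\mathcal{R}$-continuous covariant representation of $(A,G,\alpha)$ on $X_T$, and $$\left(\overline{T}\circ i_A^{\mathcal{R}}\rtimes\overline{T}\circ i_G^{\mathcal{R}}\right)^{\mathcal{R}}=T,$$ where $\overline{T}$ is the canonical positive non-degenerate bounded representation of $\mathcal{M}_l((A\rtimes_\alpha G)^{\mathcal{R}})$ on $X_T$ associated with $T$.
   Context: All vector spaces are real; algebras are associative and not assumed unital; locally compact groups are Hausdorff. A cone in a vector space $V$ is a subset $C$ with $C+C\subseteq C$ and $\lambda C\subseteq C$ for all $\lambda\ge0$. A pre-ordered vector space is a vector space $V$ with a chosen cone $V_+$; $x\le y$ means $y-x\in V_+$. A pre-ordered algebra is an algebra and pre-ordered vector space with $V_+\cdot V_+\subseteq V_+$; a pre-ordered normed (Banach) algebra is a pre-ordered algebra that is also a normed (Banach) algebra. For a pre-ordered normed space $X$, $B(X)_+=\{T\in B(X):TX_+\subseteq X_+\}$. The completion of a pre-ordered normed space $V$ is its metric completion $\overline V$ with cone the closure of $V_+$ in $\overline V$. $\mathrm{Inv}(X)$ is the group of invertible elements of $B(X)$ and $\mathrm{Inv}_+(X)=\{T\in\mathrm{Inv}(X):T^{\pm1}X_+\subseteq X_+\}$. $\mathrm{Aut}_+(A)$ is the group of bounded automorphisms $\beta$ of $A$ with $\beta^{\pm1}(A_+)\subseteq A_+$. A representation of a normed algebra $A$ on a normed space $X$ is an algebra homomorphism $\pi:A\to B(X)$ (also write $X=X_\pi$); it is non-degenerate if $\mathrm{span}\{\pi(a)x\}$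 is dense in $X$, and positive if $\pi(A_+)\subseteq B(X)_+$. A representation of $G$ on $X$ is a group homomorphism $U:G\to\mathrm{Inv}(X)$, positive if it takes values in $\mathrm{Inv}_+(X)$. A pre-ordered Banach algebra dynamical system $(A,G,\alpha)$ consists of a pre-ordered Banach algebra $A$ with closed cone, a locally compact group $G$ and a strongly continuous homomorphism $\alpha:G\to\mathrm{Aut}_+(A)$. A covariant representation of $(A,G,\alpha)$ on $X$ is a pair $(\pi,U)$ of representations of $A$ and $G$ on $X$ with $\pi(\alpha_s(a))=U_s\pi(a)U_s^{-1}$; it is continuous if $\pi$ is bounded and $U$ strongly continuous, non-degenerate if $\pi$ is, and positive if $\pi$ and $U$ are. An approximate left identity $(u_i)$ is positive if all $u_i\in A_+$. $C_c(G,A)$ is an algebra under $(f*g)(s)=\int_G f(r)\alpha_r(g(r^{-1}s))\,dr$ (left Haar measure). The integrated form of a continuous covariant representation on a Banach space $X$ is $\pi\rtimes U(f)x=\int_G\pi(f(r))U_rx\,dr$ ($f\in C_c(G,A)$, $x\in X$). A (non-empty) class $\mathcal{R}$ of continuous covariant representations on Banach spaces is uniformly bounded if there are $C\ge0$ and $\nu:G\to\mathbb{R}_{\ge0}$ bounded on compact sets with $\|\pi\|\le C$, $\|U_r\|\le\nu(r)$ for all $(\pi,U)\in\mathcal{R}$, $r\in G$. Then $\sigma^{\mathcal{R}}(f)=\sup_{(\pi,U)\in\mathcal{R}}\|\pi\rtimes U(f)\|$ is a finite algebra seminorm on $C_c(G,A)$. The pre-ordered crossed product $(A\rtimes_\alpha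 G)^{\mathcal{R}}$ is the completion of $C_c(G,A)/\ker\sigma^{\mathcal{R}}$ with the induced norm and the cone $q^{\mathcal{R}}(C_c(G,A_+))$, $q^{\mathcal{R}}$ being the quotient map; it is a pre-ordered Banach algebra whose cone is the closure of $q^{\mathcal{R}}(C_c(G,A_+))$. For a linear map $T$ on $C_c(G,A)$ into a Banach space that is bounded with respect to $\sigma^{\mathcal{R}}$, $T^{\mathcal{R}}$ denotes the induced bounded linear map on $(A\rtimes_\alpha G)^{\mathcal{R}}$; similarly a $\sigma^{\mathcal{R}}$-bounded linear operator $S:C_c(G,A)\to C_c(G,A)$ induces $S^{\mathcal{R}}\in B((A\rtimes_\alpha G)^{\mathcal{R}})$. A continuous covariant representation $(\pi,U)$ on a Banach space is $\mathcal{R}$-continuous if $\pi\rtimes U$ is bounded with respect to $\sigma^{\mathcal{R}}$. For $a\in A$, $r\in G$, $f\in C_c(G,A)$ put $(i_A(a)f)(s)=af(s)$, $(i_G(r)f)(s)=\alpha_r(f(r^{-1}s))$; these operators are $\sigma^{\mathcal{R}}$-bounded, and $i_A^{\mathcal{R}}(a):=i_A(a)^{\mathcal{R}}$, $i_G^{\mathcal{R}}(r):=i_G(r)^{\mathcal{R}}$. For a normed algebra $B$, $\mathcal{M}_l(B)$ is the algebra of left centralizers: bounded linear $L:B\to B$ with $L(ab)=(La)b$, with operator norm and, if $B$ is pre-ordered, cone $\mathcal{M}_l(B)\cap B(B)_+$; $\lambda:B\to\mathcal{M}_l(B)$, $\lambda(a)b=ab$. One has $i_A^{\mathcal{R}}(A),i_G^{\mathcal{R}}(G)\subseteq\mathcal{M}_l((A\rtimes_\alpha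 G)^{\mathcal{R}})$. If $B$ has a bounded approximate left identity $(u_i)$ and $T:B\to B(X)$ is a non-degenerate bounded representation on a Banach space $X$, then $\overline T:\mathcal{M}_l(B)\to B(X)$ denotes the unique representation of $\mathcal{M}_l(B)$ on $X$ with $\overline T\circ\lambda=T$; explicitly $\overline T(L)=\text{SOT-}\lim_iT(Lu_i)$. (The crossed product has a bounded approximate left identity under the hypotheses of the theorem.) *)

(* Defs.v *)
From HB Require Import structures.
From mathcomp Require Import all_boot all_order all_algebra.
From mathcomp Require Import all_classical all_reals all_analysis.

Set Implicit Arguments.
Unset Strict Implicit.
Unset Printing Implicit Defensive.

Import Order.TTheory GRing.Theory Num.Theory.
Import numFieldNormedType.Exports.

Local Open Scope classical_set_scope.
Local Open Scope ring_scope.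

(** * Pre-ordered Banach spaces and (not necessarily unital) Banach algebras *)

HB.mixin Record hasCone (R : realType) V & GRing.Lmodule R V := {
  pcone : set V ;
  pconeD : forall x y : V, pcone x -> pcone y -> pcone (x + y) ;
  pconeZ : forall (l : R) (x : V), 0 <= l -> pcone x -> pcone (l *: x)
}.

#[short(type="preorderedBanachType")]
HB.structure Definition PreorderedBanach (R : realType) :=
  {V of CompleteNormedModule R V & hasCone R V}.

HB.mixin Record isNormedAlgebra (R : realType) A & NormedModule R A := {
  amul : A -> A -> A ;
  amulA : forall a b c : A, amul a (amul b c) = amul (amul a b) c ;
  amulDl : forall a b c : A, amul (a + b) c = amul a c + amul b c ;
  amulDr : forall a b c : A, amul a (b + c) = amul a b + amul a c ;
  amulZl : forall (l : R) (a b : A), amul (l *: a) b = l *: amul a b ;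
  amulZr : forall (l : R) (a b : A), amul a (l *: b) = l *: amul a b ;
  normaM_le : forall a b : A, `|amul a b| <= `|a| * `|b|
}.

#[short(type="banachAlgType")]
HB.structure Definition BanachAlgebra (R : realType) :=
  {A of CompleteNormedModule R A & isNormedAlgebra R A}.

HB.mixin Record hasMulClosedCone (R : realType) A
    & BanachAlgebra R A & hasCone R A := {
  pconeM : forall a b : A, pcone a -> pcone b -> pcone (amul a b)
}.

#[short(type="preorderedBanachAlgType")]
HB.structure Definition PreorderedBanachAlgebra (R : realType) :=
  {A of BanachAlgebra R A & PreorderedBanach R A & hasMulClosedCone R A}.

(** * Topological groups *)

(* The distinguished point is arbitrary; it is only there because measurable
   types are pointed. *)
HB.mixin Record isTopologicalGroup G & Group G & PointedTopological G := {
  mulg_continuous : continuous (fun x : G * G => (x.1 * x.2)%g) ;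
  invg_continuous : continuous (fun x : G => (x^-1)%g)
}.

#[short(type="topologicalGroupType")]
HB.structure Definition TopologicalGroup :=
  {G of Group G & PointedTopological G & isTopologicalGroup G}.

(** * Left Haar measures *)

Notation borelType T := (g_sigma_algebraType (@open T)).

Section haar.
Context {R : realType} {G : topologicalGroupType}.
Variable mu : {measure set (borelType G) -> \bar R}.

(* Left-invariant non-zero Radon measure. *)
Definition left_haar : Prop :=
  [/\ mu [set: borelType G] != 0%E,
      (forall (g : G) (E : set (borelType G)), measurable E ->
         mu [set (g * x)%g | x in E] = mu E),
      (forall K : set G, compact K -> (mu K < +oo)%E),
      (forall E : set (borelType G), measurable E ->
         mu E = ereal_inf [set mu U | U in [set U : set G | open U /\ E `<=` U]])
    & (forall U : set G, open U ->
         mu U = ereal_sup [set mu K | K in [set K : set G | compact K /\ K `<=` U]])].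

End haar.

(** * The Bochner integral *)

Section bochner.
Context {d : measure_display} {T : measurableType d} {R : realType}.
Variables (mu : {measure set T -> \bar R}) (X : normedModType R).

Record step_fun := StepFun {
  step_size : nat ;
  step_set : 'I_step_size -> set T ;
  step_val : 'I_step_size -> X ;
  step_measurable : forall i, measurable (step_set i) ;
  step_finite : forall i, (mu (step_set i) < +oo)%E
}.

Definition step_eval (s : step_fun) (t : T) : X :=
  \sum_(i < step_size s) \1_(step_set i) t *: step_val i.

Definition step_integral (s : step_fun) : X :=
  \sum_(i < step_size s) fine (mu (step_set i)) *: step_val i.

Definition is_bochner (f : T -> X) (v : X) : Prop :=
  exists s : nat -> step_fun,
    [/\ {ae mu, forall t, step_eval (s n) t @[n --> \oo] --> f t},
        (\int[mu]_t (`|f t - step_eval (s n) t|)%:E)%E @[n --> \oo] --> 0%E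
      & step_integral (s n) @[n --> \oo] --> v].

(* Total; equal to 0 when f is not Bochner integrable. *)
Definition bochner (f : T -> X) : X := xget 0 [set v | is_bochner f v].

End bochner.

(** * Bounded operators *)

Section operators.
Context {R : realType}.

Definition bounded_linear {V W : normedModType R} (T : V -> W) : Prop :=
  linear T /\ exists C : R, forall x, `|T x| <= C * `|x|.

Definition opnorm {V W : normedModType R} (T : V -> W) : R :=
  sup [set `|T x| | x in [set x : V | `|x| <= 1]].

Definition lin_span {V : normedModType R} (S : set V) : set V :=
  [set v | exists (n : nat) (c : 'I_n -> R) (w : 'I_n -> V),
     (forall i, S (w i)) /\ v = \sum_(i < n) c i *: w i].

Definition maps_cone {V W : preorderedBanachType R} (T : V -> W) : Prop :=
  forall x, pcone x -> pcone (T x).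

Definition invertible_op (X : normedModType R) : set (X -> X) :=
  [set T | bounded_linear T /\
     exists S : X -> X, [/\ bounded_linear S, cancel T S & cancel S T]].

Definition invertible_op_pos (X : preorderedBanachType R) : set (X -> X) :=
  [set T | bounded_linear T /\
     exists S : X -> X, [/\ bounded_linear S, cancel T S, cancel S T,
                            maps_cone T & maps_cone S]].

Definition Aut_pos (A : preorderedBanachAlgType R) : set (A -> A) :=
  [set b | [/\ bounded_linear b,
               (forall x y, b (amul x y) = amul (b x) (b y))
             & exists c : A -> A, [/\ bounded_linear c, cancel b c, cancel c b,
                                      maps_cone b & maps_cone c]]].

(* S is a bounded linear map V -> B(X). *)
Definition bounded_opmap {V X : normedModType R} (S : V -> X -> X) : Prop :=
  [/\ (forall v, bounded_linear (S v)),
      (forall x, linear (fun v => S v x))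
    & exists C : R, forall v x, `|S v x| <= C * `|v| * `|x|].

End operators.

(** * Representations of algebras *)

Section algebra_representations.
Context {R : realType}.

Definition alg_rep {A : banachAlgType R} {X : normedModType R}
    (pi : A -> X -> X) : Prop :=
  [/\ (forall a, bounded_linear (pi a)),
      (forall x, linear (fun a => pi a x))
    & forall a b x, pi (amul a b) x = pi a (pi b x)].

Definition bounded_alg_rep {A : banachAlgType R} {X : normedModType R}
    (pi : A -> X -> X) : Prop :=
  alg_rep pi /\ exists C : R, forall a x, `|pi a x| <= C * `|a| * `|x|.

Definition nondegenerate_rep {A : Type} {X : normedModType R}
    (D : set A) (pi : A -> X -> X) : Prop :=
  closure (lin_span [set y | exists a x, D a /\ y = pi a x]) = [set: X].

Definition pos_rep {A : preorderedBanachAlgType R} {X : preorderedBanachType R}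
    (pi : A -> X -> X) : Prop :=
  forall a, pcone a -> maps_cone (pi a).

Definition pos_nondeg_bounded_rep (B : preorderedBanachAlgType R)
    (X : preorderedBanachType R) : set (B -> X -> X) :=
  [set T | [/\ bounded_alg_rep T, nondegenerate_rep [set: B] T & pos_rep T]].

(* Approximate left identities are nets indexed by a directed set (I, le). *)
Definition has_pos_bounded_approx_left_id (A : preorderedBanachAlgType R)
    : Prop :=
  exists (I : Type) (le : I -> I -> Prop) (u : I -> A),
    [/\ inhabited I,
        [/\ (forall i, le i i),
            (forall i j k, le i j -> le j k -> le i k)
          & (forall i j, exists k, le i k /\ le j k)],
        (forall a (eps : R), 0 < eps -> exists i0, forall i, le i0 i ->
           `|amul (u i) a - a| < eps),
        (exists M : R, forall i, `|u i| <= M)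
      & (forall i, pcone (u i))].

End algebra_representations.

(** * Left centralizers and the extension of representations to them *)

Section left_centralizers.
Context {R : realType} {B : preorderedBanachAlgType R}.

Definition left_centralizer : set (B -> B) :=
  [set L | bounded_linear L /\ forall a b, L (amul a b) = amul (L a) b].

(* Maps on left_centralizer are total functions on B -> B; their values outside
   of left_centralizer are irrelevant. *)
Definition centralizer_rep {X : normedModType R} (S : (B -> B) -> X -> X)
    : Prop :=
  [/\ (forall L, left_centralizer L -> bounded_linear (S L)),
      (forall (c : R) L M x, left_centralizer L -> left_centralizer M ->
         S (fun b => c *: L b + M b) x = c *: S L x + S M x)
    & (forall L M x, left_centralizer L -> left_centralizer M ->
         S (L \o M) x = S L (S M x))].

Definition pos_nondeg_bounded_centralizer_rep {X : preorderedBanachType R}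
    (S : (B -> B) -> X -> X) : Prop :=
  [/\ centralizer_rep S,
      (exists C : R, forall L x, left_centralizer L ->
         `|S L x| <= C * opnorm L * `|x|),
      nondegenerate_rep left_centralizer S
    & forall L, left_centralizer L -> maps_cone L -> maps_cone (S L)].

(* S extends T along the left regular representation b |-> amul b. *)
Definition is_centralizer_ext {X : normedModType R} (T : B -> X -> X)
    (S : (B -> B) -> X -> X) : Prop :=
  centralizer_rep S /\ forall b, S (amul b) = T b.

Definition centralizer_ext {X : normedModType R} (T : B -> X -> X)
    : (B -> B) -> X -> X :=
  xget (fun _ _ => 0) [set S | is_centralizer_ext T S].

End left_centralizers.

(** * Dynamical systems and covariant representations *)

Section dynamical_systems.
Context {R : realType} {G : topologicalGroupType}.

Definition dynamical_system {A : preorderedBanachAlgType R}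
    (alpha : G -> A -> A) : Prop :=
  [/\ closed (pcone : set A),
      (forall s, Aut_pos (alpha s)),
      (forall s t a, alpha (s * t)%g a = alpha s (alpha t a))
    & forall a, continuous (fun s => alpha s a)].

Definition group_rep {X : normedModType R} (U : G -> X -> X) : Prop :=
  (forall r, invertible_op (U r)) /\ forall r s x, U (r * s)%g x = U r (U s x).

Definition pos_group_rep {X : preorderedBanachType R} (U : G -> X -> X) : Prop :=
  forall r, invertible_op_pos (U r).

Context {A : preorderedBanachAlgType R}.
Variables (mu : {measure set (borelType G) -> \bar R}) (alpha : G -> A -> A).

Definition covariant_rep {X : normedModType R}
    (p : (A -> X -> X) * (G -> X -> X)) : Prop :=
  [/\ alg_rep p.1, group_rep p.2
    & forall s a x, p.1 (alpha s a) x = p.2 s (p.1 a (p.2 (s^-1)%g x))].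

Definition continuous_covariant_rep {X : normedModType R}
    (p : (A -> X -> X) * (G -> X -> X)) : Prop :=
  [/\ covariant_rep p, bounded_alg_rep p.1
    & forall x, continuous (fun r => p.2 r x)].

Definition Cc : set (G -> A) :=
  [set f | continuous f /\ compact (closure [set s | f s != 0])].

Definition Cc_pos : set (G -> A) := Cc `&` [set f | forall s, pcone (f s)].

Definition convolution (f g : G -> A) (s : G) : A :=
  bochner mu (fun r : borelType G => amul (f r) (alpha r (g (r^-1 * s)%g))).

Definition integrated_form {X : normedModType R}
    (p : (A -> X -> X) * (G -> X -> X)) (f : G -> A) (x : X) : X :=
  bochner mu (fun r : borelType G => p.1 (f r) (p.2 r x)).

(* A class of pairs (pi, U), indexed by the Banach space on which they act. *)
Definition rep_class : Type :=
  forall X : completeNormedModType R, set ((A -> X -> X) * (G -> X -> X)).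

Definition uniformly_bounded_class (Rc : rep_class) : Prop :=
  [/\ (exists X p, Rc X p),
      (forall X p, Rc X p -> continuous_covariant_rep p)
    & exists (C : R) (nu : G -> R),
        [/\ 0 <= C,
            (forall r, 0 <= nu r),
            (forall K : set G, compact K ->
               exists M : R, forall r, K r -> nu r <= M)
          & forall X p, Rc X p ->
              (forall a x, `|p.1 a x| <= C * `|a| * `|x|) /\
              (forall r x, `|p.2 r x| <= nu r * `|x|)]].

Definition sigma (Rc : rep_class) (f : G -> A) : R :=
  sup [set y | exists X p, Rc X p /\ y = opnorm (@integrated_form X p f)].

Definition class_continuous (Rc : rep_class) {X : normedModType R}
    (p : (A -> X -> X) * (G -> X -> X)) : Prop :=
  continuous_covariant_rep p /\
  exists C : R, forall f x, Cc f ->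
    `|integrated_form p f x| <= C * sigma Rc f * `|x|.

Definition pos_nondeg_class_continuous (Rc : rep_class)
    (X : preorderedBanachType R) : set ((A -> X -> X) * (G -> X -> X)) :=
  [set p | [/\ class_continuous Rc p, nondegenerate_rep [set: A] p.1,
               pos_rep p.1 & pos_group_rep p.2]].

Definition left_mul_op (a : A) (f : G -> A) (s : G) : A := amul a (f s).

Definition translation_op (r : G) (f : G -> A) (s : G) : A :=
  alpha r (f (r^-1 * s)%g).

(** * The crossed product *)

Section crossed_product.
Variable B : preorderedBanachAlgType R.

(* The completion of the pre-ordered normed algebra C_c(G, A) / ker sigma is
   determined up to isometric order isomorphism: (B, q) is a realization of it,
   q being the composition of the quotient map with the embedding in the
   completion. Only the values of q on Cc are relevant. *)
Definition is_crossed_product (Rc : rep_class) (q : (G -> A) -> B) : Prop :=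
  [/\ (forall (c : R) f g, Cc f -> Cc g ->
         q (fun s => c *: f s + g s) = c *: q f + q g),
      (forall f g, Cc f -> Cc g -> q (convolution f g) = amul (q f) (q g)),
      (forall f, Cc f -> `|q f| = sigma Rc f),
      closure [set q f | f in Cc] = [set: B]
    & pcone = closure [set q f | f in Cc_pos]].

Variable q : (G -> A) -> B.

(* The bounded linear map B -> B(X) induced by a sigma-bounded linear map
   C_c(G, A) -> B(X). *)
Definition induced_rep {X : normedModType R} (T : (G -> A) -> X -> X)
    : B -> X -> X :=
  xget (fun _ _ => 0)
    [set S | bounded_opmap S /\ forall f, Cc f -> S (q f) = T f].

(* The bounded operator on B induced by a sigma-bounded operator on
   C_c(G, A). *)
Definition induced_op (S : (G -> A) -> (G -> A)) : B -> B :=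
  xget (fun _ => 0)
    [set L | bounded_linear L /\ forall f, Cc f -> L (q f) = q (S f)].

Definition integrated_rep {X : normedModType R}
    (p : (A -> X -> X) * (G -> X -> X)) : B -> X -> X :=
  induced_rep (integrated_form p).

Definition disintegrated {X : normedModType R} (T : B -> X -> X)
    : (A -> X -> X) * (G -> X -> X) :=
  (fun a => centralizer_ext T (induced_op (left_mul_op a)),
   fun r => centralizer_ext T (induced_op (translation_op r))).

End crossed_product.

End dynamical_systems.

Arguments rep_class : clear implicits.
Arguments pos_nondeg_bounded_rep {R} B X _.
Arguments pos_nondeg_class_continuous {R G A} mu alpha Rc X _.

(* Main.v *)
Require Import Defs.
From HB Require Import structures.
From mathcomp Require Import finmap.
From mathcomp Require Import all_boot all_order all_algebra.
From mathcomp Require Import all_classical all_reals all_analysis.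
From mathcomp Require Import measurable_realfun ring lra.

Set Implicit Arguments.
Unset Strict Implicit.
Unset Printing Implicit Defensive.

Import Order.TTheory GRing.Theory Num.Theory.
Import numFieldNormedType.Exports.

Local Open Scope classical_set_scope.
Local Open Scope ring_scope.

Local Notation "\int_( mu ) h" := (bochner mu (h : borelType _ -> _)) (at level 10).

(** Let B be the crossed product and q : C_c(G, A) -> B the canonical map. The
    operators f |-> a f and f |-> alpha_r(f(r^-1 .)) are bounded for sigma, so
    they induce left centralizers [iA a] and [iG r] of B. They multiply and
    intertwine like a covariant representation, and the whole correspondence
    comes from the single identity ([q_convolution])
      q f q g = \int q (f(r) alpha_r(g(r^-1 .))) dr
              = \int (iA (f r) \o iG r) (q g) dr    in B.

    Let (pi, U) be given. The integrated form extends by density to a bounded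
    map T on B ([integrated_repP]); applying T(.)x to the identity shows that T
    is multiplicative. Since pi a T(b) = T(iA a b) and U_r T(b) = T(iG r b), the
    extension of T to the left centralizers sends iA a to pi a and iG r to U_r.
    Let T be given. A centralizer L acts on the dense span of the T(b)x by
    T(b)x |-> T(L b)x; this is well defined and bounded because B has a bounded
    approximate left identity ([lcent_span_bound]). The images pi a and U_r of
    iA a and iG r form a covariant representation, and applying T(.)x to the
    identity shows that its integrated form at f sends T(q g)x to
    T(q f) T(q g)x; so the integrated form is T o q. The two constructions are
    therefore inverse to each other, which is the bijection.

    Positivity passes through closed cones: the cone of B is the closure of the
    image of the positive functions, integrals of cone-valued functions stay in
    the cone ([bochner_closed_cone]), and the extension of T to centralizers is
    a limit of T(L u) x with u positive ([cent_ext_pos]). The positive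
    approximate left identity of B consists of normalized products of a bump
    function near 1 and an element of the one of A ([crossed_left_approx_Cc]).

    All identities between integrals are proved by Riemann sums. For compactly
    supported continuous functions one finite family of nodes and weights
    computes the integrals of several functions at once, with values in
    different Banach spaces ([riemann_sums]), so it suffices to check each
    identity on finite sums and to pass to the limit. *)

(** * Linear maps, density and spans *)

Section linear_maps.
Context {R : realType} {V W : normedModType R}.
Variable T : V -> W.
Hypothesis lT : linear T.

Let TL : {linear V -> W} := HB.pack T (GRing.isLinear.Build _ _ _ _ _ lT).

Lemma lin0 : T 0 = 0. Proof. exact: (linear0 TL). Qed.
Lemma linD x y : T (x + y) = T x + T y. Proof. exact: (linearD TL). Qed.
Lemma linB x y : T (x - y) = T x - T y. Proof. exact: (linearB TL). Qed.
Lemma linZ c x : T (c *: x) = c *: T x. Proof. exact: (linearZ_LR TL). Qed.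
Lemma lin_sum n (x : 'I_n -> V) : T (\sum_(i < n) x i) = \sum_(i < n) T (x i).
Proof. exact: (linear_sum TL). Qed.

Lemma lin_lipschitz C : (forall x, `|T x| <= C * `|x|) ->
  forall x y, `|T x - T y| <= C * `|x - y|.
Proof. by move=> H x y; rewrite -linB. Qed.

End linear_maps.

Lemma lipschitz_continuous (R : realType) (V W : normedModType R) (F : V -> W)
  (C : R) : (forall x y, `|F x - F y| <= C * `|x - y|) -> continuous F.
Proof.
move=> H x; apply/cvgrPdist_le => e e0.
have C0 : 0 < `|C| + 1 by rewrite ltr_wpDl.
near=> y; apply: (le_trans (H _ _)); apply: (@le_trans _ _ ((`|C| + 1) * `|x - y|)).
  by rewrite ler_wpM2r// (le_trans (ler_norm _))// lerDl.
rewrite -ler_pdivlMl// mulrC.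
near: y; have /cvgrPdist_le := @cvg_id _ (nbhs x); apply.
by rewrite divr_gt0.
Unshelve. all: by end_near. Qed.

Lemma bounded_linear_continuous (R : realType) (V W : normedModType R)
  (T : V -> W) : bounded_linear T -> continuous T.
Proof. by move=> [lT [C HC]]; apply: lipschitz_continuous (lin_lipschitz lT HC). Qed.

Lemma bounded_linear_pos (R : realType) (V W : normedModType R)
  (T : V -> W) : bounded_linear T ->
  linear T /\ exists C, 0 <= C /\ forall x, `|T x| <= C * `|x|.
Proof.
move=> [lT [C HC]]; split => //; exists `|C|; split => // x.
by apply: (le_trans (HC x)); rewrite ler_wpM2r// ler_norm.
Qed.

(** Allows error terms of the form C * e to be collected without normalizing
    constants. *)
Lemma le_eps (R : realType) (x y C : R) :
  (forall e : R, 0 < e -> x <= y + C * e) -> x <= y.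
Proof.
move=> H; apply/ler_addgt0Pr => e e0.
have C0 : 0 < `|C| + 1 by rewrite ltr_wpDl.
apply: (le_trans (H (e / (`|C| + 1)) _)); first by rewrite divr_gt0.
rewrite lerD2l mulrCA ler_piMr ?(ltW e0)// ler_pdivrMr// mul1r.
by rewrite (le_trans (ler_norm _))// lerDl.
Qed.

Lemma le_eps_eq0 (R : realType) (V : normedModType R) (x : V) (C : R) :
  (forall e : R, 0 < e -> `|x| <= C * e) -> x = 0.
Proof.
move=> H; apply/eqP; rewrite -normr_le0; apply: (@le_eps _ _ _ C) => e e0.
by rewrite add0r H.
Qed.

Lemma comp_blin (R : realType) (V1 V2 V3 : normedModType R) (F : V2 -> V3) (H : V1 -> V2) :
  bounded_linear F -> bounded_linear H -> bounded_linear (F \o H).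
Proof.
move=> bF bH; have [lF [C [C0 HC]]] := bounded_linear_pos bF.
have [lH [D [D0 HD]]] := bounded_linear_pos bH; split.
  by move=> k x y; rewrite /= lH lF.
exists (C * D) => x; apply: (le_trans (HC _)); rewrite -mulrA.
by rewrite ler_wpM2l.
Qed.

Lemma opnorm_le (R : realType) (V W : normedModType R) (T : V -> W) (c : R) : 0 <= c ->
  (forall x, `|T x| <= c * `|x|) -> opnorm T <= c.
Proof.
move=> c0 HT; apply: ge_sup; first by exists `|T 0|, 0 => //=; rewrite normr0.
move=> _ [x /= x1 <-]; apply: (le_trans (HT x)).
by rewrite ler_piMr.
Qed.

Lemma opnorm_ge (R : realType) (V W : normedModType R) (T : V -> W) x : bounded_linear T ->
  `|T x| <= opnorm T * `|x|.
Proof.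
move=> /bounded_linear_pos[lT [c [c0 HT]]].
have [->|x0] := eqVneq x 0; first by rewrite (lin0 lT) !normr0 mulr0.
rewrite -ler_pdivrMr ?normr_gt0// mulrC.
have -> : `|x|^-1 * `|T x| = `|T (`|x|^-1 *: x)|.
  by rewrite linZ// normrZ normfV normr_id.
apply: sup_upper_bound.
  split; first by exists `|T 0|, 0 => //=; rewrite normr0.
  exists c => _ [y /= y1 <-]; apply: (le_trans (HT y)).
  by rewrite ler_piMr.
exists (`|x|^-1 *: x) => //=.
by rewrite normrZ normfV normr_id mulVf// normr_eq0.
Qed.

Lemma opnorm_ge0 (R : realType) (V W : normedModType R) (T : V -> W) : bounded_linear T ->
  0 <= opnorm T.
Proof.
move=> bT; have [lT [c [c0 HT]]] := bounded_linear_pos bT.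
apply: sup_upper_bound.
  split; first by exists `|T 0|, 0 => //=; rewrite normr0.
  exists c => _ [y /= y1 <-]; apply: (le_trans (HT y)).
  by rewrite ler_piMr.
by exists 0 => /=; rewrite ?(lin0 lT) normr0.
Qed.

Section dense_extension.
Context {R : realType} {V : normedModType R} {Y : completeNormedModType R}.
Variables (J : Type) (D : set J) (Q : J -> V) (phi : J -> Y) (C : R).
Hypothesis C0 : 0 <= C.
Hypothesis comb : forall (c : R) i j, D i -> D j ->
  exists2 k, D k & Q k = c *: Q i + Q j /\ phi k = c *: phi i + phi j.
Hypothesis bnd : forall i, D i -> `|phi i| <= C * `|Q i|.
Hypothesis dense_Q : forall v (e : R), 0 < e -> exists2 i, D i & `|v - Q i| < e.

Let lip i j : D i -> D j -> `|phi i - phi j| <= C * `|Q i - Q j|.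
Proof.
move=> Di Dj; have [k Dk [Qk phik]] := comb (-1) Dj Di.
by have := bnd Dk; rewrite Qk phik !scaleN1r ![- _ + _]addrC.
Qed.

Let value v : exists y, forall i, D i -> `|y - phi i| <= C * `|v - Q i|.
Proof.
have /choice[u Hu] : forall n, exists i, D i /\ `|v - Q i| < n.+1%:R^-1.
  by move=> n; have [|i Di vi] := dense_Q v (e := n.+1%:R^-1); [rewrite invr_gt0|exists i].
have inv0 : (n.+1%:R^-1 : R) @[n --> \oo] --> (0 : R) by exact: cvg_harmonic.
have near_inv e : 0 < e -> \forall n \near \oo, (n.+1%:R^-1 : R) < e.
  move=> e0; have /cvgrPdist_lt/(_ _ e0) := inv0.
  by apply: filterS => n; rewrite sub0r normrN ger0_norm ?invr_ge0.
have cu : cvgn (phi \o u).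
  apply/cauchy_cvgP/cauchy_exP => e e0.
  have C1 : 0 < C + 1 by rewrite ltr_wpDl.
  pose d := e / (C + 1) / 2; have d0 : 0 < d by rewrite !divr_gt0.
  have [N _ HN] := near_inv _ d0.
  exists (phi (u N)); exists N => // n /= Nn; rewrite -ball_normE/=.
  apply: (le_lt_trans (lip (Hu N).1 (Hu n).1)).
  have H : `|Q (u N) - Q (u n)| < e / (C + 1).
    rewrite -(subrKA v) (splitr (e / (C + 1))); apply: (le_lt_trans (ler_normD _ _)).
    rewrite distrC ltrD//.
      exact: lt_trans (Hu N).2 (HN N (leqnn N)).
    exact: lt_trans (Hu n).2 (HN n Nn).
  apply: (@le_lt_trans _ _ (C * (e / (C + 1)))); first by rewrite ler_wpM2l// ltW.
  by rewrite mulrCA gtr_pMr// ltr_pdivrMr// mul1r ltrDl.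
exists (limn (phi \o u)) => i Di.
apply: (@le_eps _ _ _ (C + 1)) => e e0.
have H1 : \forall n \near \oo, `|limn (phi \o u) - (phi \o u) n| < e.
  by move/cvgrPdist_lt : cu; exact.
have [n [{}H1 H2]] := filter_ex (filterI H1 (near_inv _ e0)).
rewrite -(subrKA (phi (u n))); apply: (le_trans (ler_normD _ _)).
rewrite mulrDl mul1r addrA addrC lerD ?(ltW H1)//.
apply: (le_trans (lip (Hu n).1 Di)); rewrite -mulrDr ler_wpM2l//.
rewrite -(subrKA v); apply: (le_trans (ler_normD _ _)).
by rewrite distrC addrC lerD2l (le_trans (ltW (Hu n).2))// ltW.
Qed.

(** The extension principle by density, in a form that covers both of its uses:
    Q may be the quotient map on compactly supported functions, or the map
    sending a finite list of pairs (b, x) to the sum of the T(b)x. In the second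
    case the bound also makes phi well defined, because Q is far from injective.
    *)
Lemma dense_extension : exists psi : V -> Y, [/\ linear psi,
  forall v, `|psi v| <= C * `|v| & forall i, D i -> psi (Q i) = phi i].
Proof.
have [psi H] := choice value.
(* The inequality defining psi, at v = Q i, forces equality. *)
have psiQ i : D i -> psi (Q i) = phi i.
  move=> Di; apply/eqP; rewrite -subr_eq0 -normr_le0.
  by have := H (Q i) i Di; rewrite subrr normr0 mulr0.
exists psi; split => //.
- move=> c v w; apply/eqP; rewrite -subr_eq0; apply/eqP.
  apply: (@le_eps_eq0 _ _ _ (2 * (C * (`|c| + 1)))) => e e0.
  have [i Di vi] := dense_Q v e0; have [j Dj wj] := dense_Q w e0.
  have [k Dk [Qk phik]] := comb c Di Dj.
  rewrite -(subrKA (phi k)); apply: (le_trans (ler_normD _ _)).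
  have -> : 2 * (C * (`|c| + 1)) * e = C * (`|c| * e + e) + (`|c| * (C * e) + C * e) by ring.
  apply: lerD.
    apply: (le_trans (H _ _ Dk)); rewrite ler_wpM2l// Qk opprD addrACA -scalerBr.
    by apply: (le_trans (ler_normD _ _)); rewrite lerD ?(ltW wj)// normrZ ler_wpM2l// ltW.
  rewrite distrC phik opprD addrACA -scalerBr; apply: (le_trans (ler_normD _ _)).
  rewrite normrZ; apply: lerD.
    by rewrite ler_wpM2l//; apply: (le_trans (H _ _ Di)); rewrite ler_wpM2l// ltW.
  by apply: (le_trans (H _ _ Dj)); rewrite ler_wpM2l// ltW.
- move=> v; apply: (@le_eps _ _ _ (C + C)) => e e0.
  have [i Di vi] := dense_Q v e0.
  rewrite -[psi v](subrK (phi i)); apply: (le_trans (ler_normD _ _)).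
  have -> : C * `|v| + (C + C) * e = C * e + C * (`|v| + e) by ring.
  apply: lerD; first by apply: (le_trans (H _ _ Di)); rewrite ler_wpM2l// ltW.
  apply: (le_trans (bnd Di)); rewrite ler_wpM2l//.
  rewrite -[Q i](subrK v) addrC; apply: (le_trans (ler_normD _ _)).
  by rewrite lerD2l distrC ltW.
Qed.

End dense_extension.

Lemma closed_eq_fun (R : realType) (V W : normedModType R) (F H : V -> W) :
  continuous F -> continuous H -> closed [set v | F v = H v].
Proof.
move=> cF cH; rewrite (_ : mkset _ = (fun v => F v - H v) @^-1` [set 0]).
  apply: preimage_closed => [x _|]; first by apply: cvgB; [exact: cF|exact: cH].
  exact/accessible_closed_set1/hausdorff_accessible/norm_hausdorff.
by apply/seteqP; split => v /=; [move=> ->; rewrite subrr|move/eqP; rewrite subr_eq0 => /eqP].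
Qed.

Lemma closure_approx (R : realType) (V : normedModType R) (S : set V) v (e : R) :
  closure S v -> 0 < e -> exists2 w, S w & `|v - w| < e.
Proof.
move=> Sv e0; have [w [Sw vw]] := Sv _ (nbhsx_ballx v e e0).
by exists w => //; move: vw; rewrite -ball_normE.
Qed.

Lemma approx_closure (R : realType) (V : normedModType R) (S : set V) v :
  (forall e : R, 0 < e -> exists2 w, S w & `|v - w| <= e) -> closure S v.
Proof.
move=> H U /nbhs_ballP[e/= e0 eU]; have e2 : 0 < e / 2 by rewrite divr_gt0.
have [w Sw vw] := H _ e2; exists w; split => //; apply: eU; rewrite -ball_normE/=.
by apply: le_lt_trans vw _; rewrite ltr_pdivrMr// ltr_pMr// ltr1n.
Qed.

Section spans.
Context {R : realType} {V : normedModType R}.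
Implicit Types S : set V.

Lemma lin_span_mem S v : S v -> lin_span S v.
Proof.
move=> Sv; exists 1%N, (fun=> 1), (fun=> v); split => //.
by rewrite big_ord1 scale1r.
Qed.

Lemma lin_span0 S : lin_span S 0.
Proof.
by exists 0%N, (fun=> 0), (fun=> 0); split; [case|rewrite big_ord0].
Qed.

Lemma lin_span_comb S c v w : lin_span S v -> lin_span S w -> lin_span S (c *: v + w).
Proof.
move=> [n [a [x [Sx ->]]]] [m [b [y [Sy ->]]]].
exists (n + m)%N, (fun i => match fintype.split i with inl j => c * a j | inr j => b j end),
  (fun i => match fintype.split i with inl j => x j | inr j => y j end).
have splitl (j : 'I_n) : fintype.split (lshift m j) = inl j.
  by have := unsplitK (inl j : 'I_n + 'I_m).
have splitr (j : 'I_m) : fintype.split (rshift n j) = inr j.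
  by have := unsplitK (inr j : 'I_n + 'I_m).
split; first by move=> i; case: fintype.split.
rewrite big_split_ord scaler_sumr /=; congr (_ + _).
  by apply: eq_bigr => i _; rewrite splitl scalerA.
by apply: eq_bigr => i _; rewrite splitr.
Qed.

Lemma closure_span_comb S c v w : closure (lin_span S) v -> closure (lin_span S) w ->
  closure (lin_span S) (c *: v + w).
Proof.
move=> Sv Sw; apply: approx_closure => e e0.
have c1 : 0 < `|c| + 1 by rewrite ltr_wpDl.
have d0 : 0 < e / (`|c| + 1) by rewrite divr_gt0.
have [v' Sv' vv'] := closure_approx Sv d0.
have [w' Sw' ww'] := closure_approx Sw d0.
exists (c *: v' + w'); first exact: lin_span_comb.
rewrite opprD addrACA -scalerBr; apply: (le_trans (ler_normD _ _)); rewrite normrZ.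
have -> : e = `|c| * (e / (`|c| + 1)) + e / (`|c| + 1) by field; rewrite gt_eqF.
by rewrite lerD ?ler_wpM2l// ltW.
Qed.

(** Non-degeneracy is transferred between representations by approximating
    generators only. *)
Lemma dense_span_trans S S' : (forall v, S v -> closure (lin_span S') v) ->
  closure (lin_span S) = [set: V] -> closure (lin_span S') = [set: V].
Proof.
move=> SS' SV; apply/seteqP; split => // v _.
have : closure (lin_span S) v by rewrite SV.
rewrite (closure_id (closure (lin_span S'))).1; last exact: closed_closure.
apply: closureS => _ [n [c [w [Sw ->]]]].
elim: n c w Sw => [|n IH] c w Sw.
  by rewrite big_ord0; exact/subset_closure/lin_span0.
rewrite big_ord_recl; apply: closure_span_comb; first exact: SS'.
by apply: IH.
Qed.

End spans.

(** The usual three-epsilon argument: local boundedness makes strong continuity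
    at a point a closed condition on the vector, so it has to be checked on a
    dense set only. *)
Lemma strong_continuity_closed (R : realType) (G : topologicalGroupType) (V : normedModType R)
    (U : G -> V -> V) (r0 : G) (M : R) : (forall r, linear (U r)) -> 0 <= M ->
  (\forall r \near r0, forall x, `|U r x| <= M * `|x|) ->
  closed [set x | U r x @[r --> r0] --> U r0 x].
Proof.
move=> lU M0 UM x Dx; apply/cvgrPdist_le => e e0.
have M1 : 0 < M + 1 by rewrite ltr_wpDl.
have d0 : 0 < e / 3 / (M + 1) by rewrite !divr_gt0.
have [y Dy xy] := closure_approx Dx d0.
have e3 : 0 < e / 3 by rewrite divr_gt0.
have My z : `|z| <= e / 3 / (M + 1) -> M * `|z| <= e / 3.
  move=> zd; apply: (@le_trans _ _ ((M + 1) * `|z|)); first by rewrite ler_wpM2r// lerDl.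
  by rewrite mulrC -ler_pdivlMr.
have UM0 := nbhs_singleton UM.
have /cvgrPdist_le/(_ _ e3) Dy' := Dy.
apply: filterS2 UM Dy' => r UMr Dyr.
have -> : U r0 x - U r x = U r0 (x - y) + (U r0 y - U r y) + U r (y - x).
  by rewrite (linB (lU _)) (linB (lU _)) subrKA addrA subrK.
have -> : e = e / 3 + e / 3 + e / 3 by field.
apply: (le_trans (ler_normD _ _)); apply: lerD; last first.
  by apply: (le_trans (UMr _)); apply: My; rewrite distrC ltW.
apply: (le_trans (ler_normD _ _)); apply: lerD => //.
by apply: (le_trans (UM0 _)); apply: My; rewrite ltW.
Qed.

(** * The Bochner integral of a Borel function *)

Lemma ereal_cvg0_near (R : realType) (u : nat -> \bar R) (e : R) :
  u n @[n --> \oo] --> 0%E -> 0 < e -> \forall n \near \oo, (u n < e%:E)%E.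
Proof.
move=> u0 e0; have : nbhs (0%E : \bar R) [set x | (x < e%:E)%E].
  by apply: open_nbhs_nbhs; split; [exact: open_ereal_lt_ereal|rewrite /= lte_fin].
exact: u0.
Qed.

Section step_functions.
Context {d : measure_display} {T : measurableType d} {R : realType}.
Variables (mu : {measure set T -> \bar R}) (X : normedModType R).
Implicit Types (s : step_fun mu X) (F : T -> X).

(** Stated by preimages of open sets, because a normed space carries no chosen
    sigma-algebra. *)
Definition borel_fun F := forall O : set X, open O -> measurable (F @^-1` O).

Lemma borel_fun_add_step F (E : set T) (x : X) :
  borel_fun F -> measurable E -> borel_fun (fun t => F t + \1_E t *: x).
Proof.
move=> mF mE O oO.
rewrite (_ : _ @^-1` _ = (E `&` F @^-1` ((fun y => y + x) @^-1` O)) `|`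
                         (~` E `&` F @^-1` O)).
  apply: measurableU; apply: measurableI => //; last 2 first.
  - exact: measurableC.
  - exact: mF.
  apply: mF; apply: open_comp => // y _.
  by apply: cvgD; [exact: cvg_id|exact: cvg_cst].
apply/seteqP; split => t /=; rewrite indicE.
  case: (boolP (t \in E)) => tE; rewrite ?scale1r ?scale0r ?addr0 => ?.
    by left; split => //; exact/set_mem.
  by right; split => //; move/negP: tE => + ?; apply; exact/mem_set.
move=> [[tE]|[tE]]; first by rewrite mem_set// scale1r.
by rewrite memNset// scale0r addr0.
Qed.

Lemma borel_fun_add_steps F (n : nat) (E : 'I_n -> set T) (x : 'I_n -> X) :
  borel_fun F -> (forall i, measurable (E i)) ->
  borel_fun (fun t => F t + \sum_(i < n) \1_(E i) t *: x i).
Proof.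
move=> mF; elim: n E x => [|n IH] E x mE.
  by under eq_fun do rewrite big_ord0 addr0.
under eq_fun do rewrite big_ord_recr addrA/=.
by apply: borel_fun_add_step => //; exact: IH.
Qed.

Lemma borel_fun_cst (x : X) : borel_fun (cst x).
Proof.
move=> O _; have [xO|xO] := pselect (O x).
  by rewrite (_ : _ @^-1` _ = setT)//; apply/seteqP; split.
by rewrite (_ : _ @^-1` _ = set0)//; apply/seteqP; split.
Qed.

Lemma borel_fun_sub_step F s :
  borel_fun F -> borel_fun (fun t => F t - step_eval s t).
Proof.
move=> mF.
rewrite (_ : (fun _ => _) =
    fun t => F t + \sum_(i < step_size s) \1_(step_set (s := s) i) t *: - step_val i).
  by apply: borel_fun_add_steps => // i; exact: step_measurable.
apply/funext => t; rewrite -sumrN; congr (_ + _).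
by apply: eq_bigr => i _; rewrite scalerN.
Qed.

Lemma borel_fun_norm F : borel_fun F ->
  measurable_fun setT ((fun t => (`|F t|)%:E)).
Proof.
move=> mF; apply/measurable_EFinP.
apply: (measurability _ (RGenOInfty.measurableE R)).
move=> _ [_ [a ->] <-]; rewrite setTI.
rewrite (_ : _ @^-1` _ = F @^-1` [set x | a < `|x|]); last first.
  by apply/seteqP; split => t /=; rewrite in_itv/= andbT.
apply: mF.
apply: (@open_comp X R (fun x => `|x|) [set y | a < y]) => [x _|].
  exact: norm_continuous.
exact: open_gt.
Qed.

(** The sets of a step function may overlap, so the triangle inequality needs a
    refinement. The induction removes the last set and splits F along it; x0
    absorbs the value of the removed set on the first piece, which is why the
    statement carries both F and x0. *)
Lemma step_norm_le (n : nat) (E : 'I_n -> set T) (x : 'I_n -> X) (F : set T)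
    (x0 : X) :
  (forall i, measurable (E i)) -> measurable F -> (mu F < +oo)%E ->
  ((`|fine (mu F) *: x0 + \sum_(i < n) fine (mu (E i `&` F)) *: x i|)%:E <=
   \int[mu]_(t in F) (`|x0 + \sum_(i < n) \1_(E i) t *: x i|)%:E)%E.
Proof.
elim: n E x F x0 => [|n IH] E x F x0 mE mF fF.
  rewrite big_ord0 addr0.
  under eq_integral do rewrite big_ord0 addr0.
  rewrite integral_cst// normrZ EFinM muleC ger0_norm ?fine_ge0//.
  by rewrite fineK// ge0_fin_numE.
set Em := E ord_max; set xm := x ord_max.
have mEm : measurable Em by exact: mE.
have mEF : measurable (F `&` Em) by exact: measurableI.
have mDF : measurable (F `\` Em) by exact: measurableD.
have fEF : (mu (F `&` Em) < +oo)%E.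
  by apply: le_lt_trans fF; apply: le_measure; rewrite ?inE//; move=> t [].
have fDF : (mu (F `\` Em) < +oo)%E.
  by apply: le_lt_trans fF; apply: le_measure; rewrite ?inE//; move=> t [].
pose E' (i : 'I_n) := E (widen_ord (leqnSn n) i).
pose x' (i : 'I_n) := x (widen_ord (leqnSn n) i).
have mE' i : measurable (E' i) by exact: mE.
have split_mu A : measurable A ->
    fine (mu (A `&` F)) = fine (mu (A `&` (F `&` Em))) + fine (mu (A `&` (F `\` Em))).
  move=> mA.
  have fA B : measurable B -> B `<=` F -> mu (A `&` B) \is a fin_num.
    move=> mB BF; rewrite ge0_fin_numE//; apply: le_lt_trans fF.
    by apply: le_measure; rewrite ?inE//; [exact: measurableI|move=> t [_ /BF]].
  rewrite -fineD ?fA// -?measureU//; [|exact: measurableI|exact: measurableI|].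
  - by congr (fine (mu _)); rewrite -setIUr setUIDK.
  - by apply/seteqP; split => // t [[_ [_ +]] [_ [_ +]]].
have splitF : fine (mu F) = fine (mu (F `&` Em)) + fine (mu (F `\` Em)).
  by have := split_mu setT measurableT; rewrite !setTI.
have mI (F' : set T) : measurable F' ->
    measurable_fun F' (fun t => (`|x0 + \sum_(i < n.+1) \1_(E i) t *: x i|)%:E).
  move=> mF'; apply: (measurable_funS measurableT) => //.
  by apply: borel_fun_norm; apply: borel_fun_add_steps => //; exact: borel_fun_cst.
rewrite -(setUIDK F Em) ge0_integral_setU//; last 2 first.
- by apply: mI; rewrite setUIDK.
- by apply/disj_set2P/seteqP; split => // t [[_ +] [_]].
rewrite setUIDK.
have H1 : ((`|fine (mu (F `&` Em)) *: (x0 + xm) +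
    \sum_(i < n) fine (mu (E' i `&` (F `&` Em))) *: x' i|)%:E <=
   \int[mu]_(t in F `&` Em) (`|x0 + \sum_(i < n.+1) \1_(E i) t *: x i|)%:E)%E.
  apply: (le_trans (IH E' x' _ (x0 + xm) mE' mEF fEF)).
  rewrite le_eqVlt; apply/orP; left; apply/eqP; apply: eq_integral => t.
  rewrite inE => -[_ tE]; congr (`|_|%:E).
  by rewrite big_ord_recr/= indicE mem_set// scale1r -addrA (addrC xm).
have H2 : ((`|fine (mu (F `\` Em)) *: x0 +
    \sum_(i < n) fine (mu (E' i `&` (F `\` Em))) *: x' i|)%:E <=
   \int[mu]_(t in F `\` Em) (`|x0 + \sum_(i < n.+1) \1_(E i) t *: x i|)%:E)%E.
  apply: (le_trans (IH E' x' _ x0 mE' mDF fDF)).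
  rewrite le_eqVlt; apply/orP; left; apply/eqP; apply: eq_integral => t.
  rewrite inE => -[_ tE]; congr (`|_|%:E).
  by rewrite big_ord_recr/= indicE memNset// scale0r addr0.
apply: le_trans (leeD H1 H2).
rewrite -EFinD lee_fin; apply: le_trans (ler_normD _ _).
rewrite le_eqVlt; apply/orP; left; apply/eqP; congr (`|_|).
rewrite splitF scalerDl scalerDr big_ord_recr/= -/Em -/xm [Em `&` F]setIC.
have -> : \sum_(i < n) fine (mu (E (widen_ord (leqnSn n) i) `&` F)) *:
     x (widen_ord (leqnSn n) i) =
   \sum_(i < n) fine (mu (E' i `&` (F `&` Em))) *: x' i +
   \sum_(i < n) fine (mu (E' i `&` (F `\` Em))) *: x' i.
  by rewrite -big_split/=; apply: eq_bigr => i _; rewrite split_mu// scalerDl.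
by rewrite (addrAC _ _ (_ *: xm)) addrACA (addrC _ (_ *: xm)) !addrA.
Qed.

Lemma step_integral_le s : ((`|step_integral s|)%:E <=
  \int[mu]_t (`|step_eval s t|)%:E)%E.
Proof.
set E := step_set (s := s).
have mE i : measurable (E i) by exact: step_measurable.
pose F := \big[setU/set0]_(i < step_size s) E i.
have mF : measurable F by exact: bigsetU_measurable.
have fF : (mu F < +oo)%E.
  suff [] : measurable F /\ (mu F < +oo)%E by [].
  rewrite /F; elim/big_ind: _ => [|A C [mA A0] [mC C0]|i _].
  - by rewrite measure0.
  - split; first exact: measurableU.
    by rewrite (le_lt_trans (measureU2 _ mA mC))// lte_add_pinfty.
  - by split => //; exact: step_finite.
have := @step_norm_le _ E (@step_val _ _ _ _ _ s) F 0 mE mF fF.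
rewrite scaler0 add0r.
have EF i : E i `&` F = E i.
  by apply/setIidPl => t Et; rewrite /F (bigD1 i)//=; left.
under eq_bigr do rewrite EF.
move/le_trans; apply.
under eq_integral do rewrite add0r.
apply: ge0_subset_integral => //.
apply: borel_fun_norm.
have := borel_fun_add_steps (@step_val _ _ _ _ _ s) (borel_fun_cst 0) mE.
by under eq_fun do rewrite add0r.
Qed.

Lemma step_integral_sub s s' : ((`|step_integral s - step_integral s'|)%:E <=
  \int[mu]_t (`|step_eval s t - step_eval s' t|)%:E)%E.
Proof.
pose E (i : 'I_(step_size s + step_size s')) :=
  match fintype.split i with
  | inl j => step_set (s := s) j | inr j => step_set (s := s') j end.
pose x (i : 'I_(step_size s + step_size s')) :=
  match fintype.split i with
  | inl j => step_val (s := s) j | inr j => - step_val (s := s') j end.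
have mE i : measurable (E i).
  by rewrite /E; case: fintype.split => j; exact: step_measurable.
have fE i : (mu (E i) < +oo)%E.
  by rewrite /E; case: fintype.split => j; exact: step_finite.
have splitl (j : 'I_(step_size s)) : fintype.split (lshift (step_size s') j) = inl j.
  by have := unsplitK (inl j : 'I_(step_size s) + 'I_(step_size s')).
have splitr (j : 'I_(step_size s')) : fintype.split (rshift (step_size s) j) = inr j.
  by have := unsplitK (inr j : 'I_(step_size s) + 'I_(step_size s')).
have := step_integral_le (StepFun x mE fE).
rewrite /step_integral/= big_split_ord/=.
rewrite (eq_bigr (fun j => fine (mu (step_set (s := s) j)) *: step_val j)); last first.
  by move=> j _; rewrite /E /x splitl.
rewrite [X in (`|_ + X|)](eq_bigr (fun j => - (fine (mu (step_set (s :=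
  s') j)) *: step_val j))); last first.
  by move=> j _; rewrite /E /x splitr scalerN.
rewrite sumrN => /le_trans; apply.
rewrite le_eqVlt; apply/orP; left; apply/eqP; apply: eq_integral => t _.
rewrite /step_eval/= big_split_ord/= -sumrN; congr (`|_ + _|%:E).
  by apply: eq_bigr => j _; rewrite /E /x splitl.
by apply: eq_bigr => j _; rewrite /E /x splitr scalerN.
Qed.

Lemma step_integral_dist F s s' : borel_fun F ->
  ((`|step_integral s - step_integral s'|)%:E <=
   \int[mu]_t (`|F t - step_eval s t|)%:E + \int[mu]_t (`|F t - step_eval s' t|)%:E)%E.
Proof.
move=> mF; apply: (le_trans (step_integral_sub _ _)).
have m1 := borel_fun_norm (borel_fun_sub_step s mF).
have m2 := borel_fun_norm (borel_fun_sub_step s' mF).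
rewrite -ge0_integralD//; apply: ge0_le_integral => //=.
- apply: borel_fun_norm; apply: borel_fun_sub_step.
  have := borel_fun_add_steps (@step_val _ _ _ _ _ s) (borel_fun_cst 0)
    (@step_measurable _ _ _ _ _ s).
  by under eq_fun do rewrite add0r.
- exact: emeasurable_funD.
- move=> t _; rewrite -EFinD lee_fin [leRHS]addrC (distrC (F t) (step_eval s t)).
  by rewrite addrC; apply: le_trans (ler_normD _ _); rewrite subrKA.
Qed.

(** The sequence in the definition of the integral is unknown, but it converges
    to F in mean like any other good approximation. All estimates of integrals
    rest on this comparison. *)
Lemma bochner_step_dist F (v : X) s (e : R) : borel_fun F -> is_bochner mu F v ->
  (\int[mu]_t (`|F t - step_eval s t|)%:E <= e%:E)%E ->
  `|v - step_integral s| <= e.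
Proof.
move=> mF [S [_ S0 Sv]] se; apply/ler_addgt0Pr => eps eps0.
have e2 : 0 < eps / 2 by rewrite divr_gt0.
have [n [H1 H2]] : exists n, `|v - step_integral (S n)| < eps / 2 /\
    (\int[mu]_t (`|F t - step_eval (S n) t|)%:E < (eps / 2)%:E)%E.
  have H1 : \forall n \near \oo, `|v - step_integral (S n)| < eps / 2.
    by move/cvgrPdist_lt : Sv; exact.
  have H2 := ereal_cvg0_near S0 e2.
  by have [n] := filter_ex (filterI H1 H2); exists n.
have H3 : `|step_integral (S n) - step_integral s| <= eps / 2 + e.
  rewrite -lee_fin EFinD; apply: le_trans (leeD (ltW H2) se).
  exact: step_integral_dist.
rewrite -(subrK (step_integral (S n)) v) -addrA.
apply: (le_trans (ler_normD _ _)).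
by apply: (le_trans (lerD (ltW H1) H3)); rewrite addrA -splitr addrC.
Qed.

End step_functions.

(** Uniform approximation on a set of finite measure makes the step integrals a
    Cauchy sequence. *)
Lemma step_approx_bochner (d : measure_display) (T : measurableType d) (R : realType)
    (mu : {measure set T -> \bar R}) (X : completeNormedModType R) (F : T -> X)
    (K : set T) :
  measurable K -> (mu K < +oo)%E -> borel_fun F ->
  (forall e : R, 0 < e -> exists s : step_fun mu X,
     forall t, `|F t - step_eval s t| <= e * \1_K t) ->
  is_bochner mu F (bochner mu F).
Proof.
move=> mK fK mF H.
have ifE (e : R) : 0 <= e -> (\int[mu]_t (e * \1_K t)%:E = (e * fine (mu K))%:E)%E.
  move=> e0; under eq_integral do rewrite EFinM.
  rewrite ge0_integralZl//.
  - by rewrite integral_indic// setIT EFinM fineK// ge0_fin_numE.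
  - by apply/measurable_EFinP; exact: measurable_indic.
have /choice[S HS] : forall n, exists s : step_fun mu X,
    forall t, `|F t - step_eval s t| <= n.+1%:R^-1 * \1_K t.
  by move=> n; apply: H; rewrite invr_gt0.
have IS n : (\int[mu]_t (`|F t - step_eval (S n) t|)%:E <=
    (n.+1%:R^-1 * fine (mu K))%:E)%E.
  rewrite -ifE ?invr_ge0//; apply: ge0_le_integral => //.
  - exact: borel_fun_norm (borel_fun_sub_step (S n) mF).
  - by apply/measurable_EFinP; apply: measurable_funM => //; exact: measurable_indic.
  - by move=> t _; rewrite lee_fin.
have inv0 : (n.+1%:R^-1 : R) @[n --> \oo] --> (0 : R).
  exact: cvg_harmonic.
have invK0 : (n.+1%:R^-1 * fine (mu K) : R) @[n --> \oo] --> (0 : R).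
  by rewrite -[X in _ --> X](mul0r (fine (mu K))); exact: cvgMl.
have cS : cvgn (fun n => step_integral (S n)).
  apply/cauchy_cvgP/cauchy_exP => e e0.
  have e2 : 0 < e / 2 by rewrite divr_gt0.
  have : \forall n \near \oo, `|0 - n.+1%:R^-1 * fine (mu K)| < e / 2.
    by move/cvgrPdist_lt : invK0; exact.
  move=> [N _ HN]; have b m : (N <= m)%N -> m.+1%:R^-1 * fine (mu K) < e / 2.
    move=> /HN; rewrite sub0r normrN; apply: le_lt_trans.
    exact: ler_norm.
  exists (step_integral (S N)); exists N => // n/= Nn.
  rewrite -ball_normE/= -lte_fin; apply: (le_lt_trans (step_integral_dist _ _ mF)).
  rewrite (splitr e) EFinD; apply: lteD.
    by apply: (le_lt_trans (IS _)); rewrite lte_fin b.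
  by apply: (le_lt_trans (IS _)); rewrite lte_fin b.
suff : exists v, is_bochner mu F v.
  by move=> [v Fv]; exact: (@xgetI _ 0 [set v | is_bochner mu F v] v Fv).
exists (limn (fun n => step_integral (S n))); exists S; split.
- apply: aeW => t.
  apply/cvgrPdist_le => e e0.
  have : \forall n \near \oo, `|0 - n.+1%:R^-1| < e.
    by move/cvgrPdist_lt : inv0; exact.
  apply: filterS => n; rewrite sub0r normrN ger0_norm ?invr_ge0// => ne.
  apply: (le_trans (HS n t)); apply: le_trans (ltW ne).
  by rewrite ler_piMr ?invr_ge0// indicE lern1 leq_b1.
- apply: (@squeeze_cvge _ _ _ _ (cst 0%E) _ (fun n => (n.+1%:R^-1 * fine (mu K))%:E)).
  + by near=> n; rewrite integral_ge0//= IS.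
  + exact: cvg_cst.
  + by apply: cvg_EFin => //; near=> n.
- exact: cS.
Unshelve. all: by end_near. Qed.

(** * Riemann sums for Haar measure *)

Section compactly_supported.
Context {R : realType} {G : topologicalGroupType}.
Variable mu : {measure set (borelType G) -> \bar R}.
Hypotheses (hG : hausdorff_space G) (lG : locally_compact [set: G])
  (haar : left_haar mu).
Implicit Types (K : set G) (X : completeNormedModType R).

(** The compact set is a parameter because the estimates below are uniform over
    all functions supported in a given compact set. *)
Definition cc_on K {X : normedModType R} (h : G -> X) : Prop :=
  [/\ compact K, continuous h & forall s, ~ K s -> h s = 0].

Lemma cc_compact K (Y : normedModType R) (h : G -> Y) : cc_on K h -> compact K.
Proof. by case. Qed.

Lemma open_borel (O : set G) : open O -> measurable (O : set (borelType G)).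
Proof. by move=> oO; exact: sub_sigma_algebra. Qed.

Lemma compact_borel K : compact K -> measurable (K : set (borelType G)).
Proof.
move=> cK; rewrite -[K]setCK; apply: measurableC; apply: open_borel.
by rewrite openC; exact: compact_closed.
Qed.

Lemma continuous_borel {X : normedModType R} (h : G -> X) : continuous h ->
  borel_fun (h : borelType G -> X).
Proof.
by move=> ch O oO; apply: open_borel; apply: open_comp => // x _; exact: ch.
Qed.

Lemma haar_compact K : compact K -> (mu K < +oo)%E.
Proof. by case: haar => _ _ + _ _; exact. Qed.

Lemma mu_le (E F : set (borelType G)) : measurable E -> measurable F ->
  E `<=` F -> (mu E <= mu F)%E.
Proof. by move=> mE mF EF; apply: le_measure => //; exact: mem_set. Qed.

Lemma mu_le_sum n (E : 'I_n -> set (borelType G)) (F : set (borelType G)) :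
  (forall i, measurable (E i)) -> measurable F -> F `<=` \bigcup_i E i ->
  (mu F <= \sum_(i < n) mu (E i))%E.
Proof.
move=> mE mF FE.
pose A k := if insub k is Some i then E i else set0.
have AE (i : 'I_n) : A i = E i by rewrite /A valK.
have -> : (\sum_(i < n) mu (E i) = \sum_(i < n) mu (A i))%E.
  by apply: eq_bigr => i _; rewrite AE.
apply: content_subadditive => //.
  by move=> k kn; rewrite -[k]/(val (Ordinal kn)) AE.
move=> r Fr; have [i _ Ei] := FE _ Fr.
by rewrite -bigcup_mkord; exists i => /=; rewrite ?AE.
Qed.

(** A finite subcover by the V t, made disjoint by removing from each set the
    earlier ones. The node t i need not lie in E i. *)
Lemma fine_partition K (V : G -> set G) : compact K ->
  (forall t, K t -> nbhs t (V t)) ->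
  exists (n : nat) (E : 'I_n -> set (borelType G)) (t : 'I_n -> G),
    [/\ forall i, measurable (E i),
        forall i, E i `<=` K `&` V (t i),
        forall i, K (t i)
      & forall r, K r -> exists i, E i r /\ forall j, j != i -> ~ E j r].
Proof.
move=> cK Vn.
have : cover_compact K by rewrite -compact_cover.
move=> /(_ _ K (fun t => interior (V t))) [t _|t Kt|D DK KD].
- exact: open_interior.
- by exists t => //; exact: Vn.
pose s : seq G := finmap.enum_fset D.
pose t (i : 'I_(size s)) := tnth (in_tuple s) i.
(* The V t need not be measurable, but their interiors are. *)
pose W i := interior (V (t i)).
pose E (i : 'I_(size s)) : set (borelType G) :=
  (K `&` W i) `\` \bigcup_(j in [set j : 'I_(size s) | (j < i)%N]) W j.
have tD i : t i \in D by exact: mem_tnth.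
have mW i : measurable (W i : set (borelType G)).
  by apply: open_borel; exact: open_interior.
exists (size s), E, t; split.
- move=> i; apply: measurableD; last exact: fin_bigcup_measurable.
  by apply: measurableI => //; exact: compact_borel.
- by move=> i r [[Kr /interior_subset Wr] _].
- by move=> i; exact/set_mem/DK.
move=> r Kr; have [x /= xD xr] := KD _ Kr.
(* The first index whose open set contains r gives the unique piece containing
   r. *)
have [i Wi imin] : exists2 i, W i r & forall j : 'I_(size s), (j < i)%N -> ~ W j r.
  have /tnthP[i0 xi0] : x \in in_tuple s by [].
  have Wi0 : W i0 r by rewrite /W /t -xi0.
  have exW : exists n, `[< exists2 i, W i r & val i = n >].
    by exists i0; apply/asboolP; exists i0.
  have [_ /asboolP[i Wi <-] imin] := ex_minnP exW.
  exists i => // j ji Wj; have := imin j; rewrite leqNgt ji => H.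
  by have : false by apply: H; apply/asboolP; exists j.
exists i; split => [|j ji].
  by split; [split|move=> [j ij Wj]; exact: imin ij Wj].
move=> [[_ Wj] nW]; move: ji; rewrite neq_ltn => /orP[ji|ij].
  exact: imin ji Wj.
by apply: nW; exists i.
Qed.

Lemma bochner_step K {X : completeNormedModType R} (h : G -> X) (e : R)
    (s : step_fun mu X) : cc_on K h ->
  (forall r, `|h r - step_eval s r| <= e * \1_K r) ->
  is_bochner mu (h : borelType G -> X) (bochner mu (h : borelType G -> X)) ->
  `|bochner mu (h : borelType G -> X) - step_integral s| <= e * fine (mu K).
Proof.
move=> [cK ch h0] H bh; apply: (bochner_step_dist _ bh); first exact: continuous_borel.
have mK := compact_borel cK.
apply: (@le_trans _ _ (\int[mu]_(t in K) (e%:E))%E).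
  rewrite [leRHS]integral_mkcond; apply: ge0_le_integral => //=.
  - exact: borel_fun_norm (borel_fun_sub_step s (continuous_borel ch)).
  - by apply/(measurable_restrictT _ mK) => //; exact: measurable_cst.
  - move=> t _; rewrite patchE; have := H t; rewrite indicE; case: ifP => tK.
      by rewrite mulr1 lee_fin.
    by rewrite mulr0 lee_fin.
rewrite integral_cst// EFinM fineK// ge0_fin_numE//.
exact: haar_compact.
Qed.

Definition riemann_step n (E : 'I_n -> set (borelType G)) (t : 'I_n -> G)
  (X : normedModType R) (h : G -> X) (mE : forall i, measurable (E i))
  (fE : forall i, (mu (E i) < +oo)%E) : step_fun mu X :=
  StepFun (fun i => h (t i)) mE fE.

Lemma fine_step K (V : G -> set G) : compact K ->
  (forall t, K t -> nbhs t (V t)) ->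
  exists (n : nat) (E : 'I_n -> set (borelType G)) (t : 'I_n -> G)
    (mE : forall i, measurable (E i)) (fE : forall i, (mu (E i) < +oo)%E),
    [/\ forall i, K (t i), forall i, E i `<=` K `&` V (t i),
       K `<=` \bigcup_i E i
     & forall (X : normedModType R) (h : G -> X) e, (forall s, ~ K s -> h s = 0) ->
       (forall t r, K t -> K r -> V t r -> `|h r - h t| <= e) ->
       forall r, `|h r - step_eval (riemann_step t h mE fE) r| <= e * \1_K r].
Proof.
move=> cK Vn; have [n [E [t [mE EV Kt cov]]]] := fine_partition cK Vn.
have fE i : (mu (E i) < +oo)%E.
  apply: le_lt_trans (haar_compact cK).
  have mK := compact_borel cK.
  by apply: mu_le => // x /EV[].
exists n, E, t, mE, fE; split => //.
  by move=> r /cov[i [Ei _]]; exists i.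
move=> X h e h0 he r; rewrite /step_eval/=.
have [Kr|nKr] := pselect (K r); last first.
  rewrite h0// big1 ?subr0 ?normr0 ?indicE ?memNset ?mulr0// => i _.
  by rewrite indicE memNset ?scale0r// => /EV[].
have [i [Ei Ej]] := cov _ Kr.
rewrite (bigD1 i)//= big1 ?addr0; last first.
  by move=> j ji; rewrite indicE memNset ?scale0r//; exact: Ej.
rewrite indicE mem_set// scale1r indicE mem_set// mulr1.
by apply: he => //; have [] := EV _ _ Ei.
Qed.

Lemma cc_bochner K {X : completeNormedModType R} (h : G -> X) : cc_on K h ->
  is_bochner mu (h : borelType G -> X) (bochner mu (h : borelType G -> X)).
Proof.
move=> [cK ch h0]; apply: (step_approx_bochner (compact_borel cK)).
- exact: haar_compact.
- exact: continuous_borel.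
move=> e e0.
have [|n [E [t [mE [fE [_ _ _ H]]]]]] := @fine_step K (fun t => [set r | `|h r - h t| <= e]) cK.
  by move=> t _; have /cvgrPdistC_le := ch t; exact.
by exists (riemann_step t h mE fE); apply: H.
Qed.

(** The nodes and weights depend on K and V only, so that finitely many
    functions, possibly with values in different spaces, are integrated by the
    same sums: it suffices to choose V so that all of them oscillate little on
    every V t. Interchanging two integrals thus reduces to interchanging an
    integral with a finite sum. The last clause is the lower bound by which
    integrals of bump functions are seen to be positive. *)
Lemma riemann_sums K (V : G -> set G) : compact K ->
  (forall t, K t -> nbhs t (V t)) ->
  exists (n : nat) (w : 'I_n -> R) (t : 'I_n -> G),
    [/\ forall i, 0 <= w i, forall i, K (t i),
     forall (X : completeNormedModType R) (h : G -> X) e, cc_on K h ->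
       (forall t r, K t -> K r -> V t r -> `|h r - h t| <= e) ->
       `|bochner mu (h : borelType G -> X) - \sum_(i < n) w i *: h (t i)|
           <= e * fine (mu K)
     & forall (F : set (borelType G)) (g : G -> R) (c : R), measurable F ->
       F `<=` K -> (forall i, 0 <= g (t i)) -> 0 <= c ->
       (forall t r, K t -> F r -> V t r -> c <= g t) ->
       c * fine (mu F) <= \sum_(i < n) w i * g (t i)].
Proof.
move=> cK Vn; have [n [E [t [mE [fE [Kt EV cov H]]]]]] := fine_step cK Vn.
exists n, (fun i => fine (mu (E i))), t; split => //.
- move=> X h e ch he; have [_ _ h0] := ch.
  exact: (bochner_step ch (H _ _ _ h0 he) (cc_bochner ch)).
move=> F g c mF FK g0 c0 Fc.
have fF : mu F \is a fin_num.
  rewrite ge0_fin_numE//; apply: le_lt_trans (haar_compact cK).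
  have mK := compact_borel cK.
  exact: mu_le.
have mEF i : measurable (F `&` E i) by exact: measurableI.
have fEF i : mu (F `&` E i) \is a fin_num.
  rewrite ge0_fin_numE//; apply: le_lt_trans (fE i).
  exact: mu_le.
have FE : (mu F <= \sum_(i < n) mu (F `&` E i))%E.
  by apply: mu_le_sum => // r Fr; have [i _ Ei] := cov _ (FK _ Fr); exists i.
apply: (@le_trans _ _ (\sum_(i < n) c * fine (mu (F `&` E i)))).
  rewrite -mulr_sumr ler_wpM2l//.
  by rewrite -lee_fin fineK// -sumEFin (le_trans FE)//; apply: lee_sum => i _; rewrite fineK.
apply: ler_sum => i _.
have [[r [Fr Er]]|] := pselect (exists r, F r /\ E i r).
  rewrite mulrC ler_pM ?fine_ge0//.
    by rewrite -lee_fin !fineK//; [exact: mu_le|rewrite ge0_fin_numE].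
  by apply: (Fc (t i) r) => //; have [] := EV _ _ Er.
move=> nFE; rewrite (_ : F `&` E i = set0) ?measure0 ?mulr0 ?mulr_ge0 ?fine_ge0//.
by rewrite -subset0 => r [Fr Er]; apply: nFE; exists r.
Qed.

Implicit Types (Y : completeNormedModType R).

Lemma bochner_norm K X (h : G -> X) (c : R) : cc_on K h ->
  (forall r, K r -> `|h r| <= c) -> `|\int_(mu) h| <= c * fine (mu K).
Proof.
move=> ch hc.
have h0 (i : 'I_0) : False by case: i.
(* The empty step function, whose integral is 0. *)
pose s : step_fun mu X := @StepFun _ _ _ mu X 0 (fun=> set0) (fun=> 0)
  (fun i => False_ind _ (h0 i)) (fun i => False_ind _ (h0 i)).
have := bochner_step (e := c) (s := s) ch _ (cc_bochner ch).
rewrite /step_integral big_ord0 subr0; apply => r.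
rewrite /step_eval big_ord0 subr0 indicE; case: (boolP (r \in K)).
  by rewrite mulr1 => /set_mem; exact: hc.
by rewrite notin_setE mulr0; case: ch => _ _ h00 /h00 ->; rewrite normr0.
Qed.

Lemma cc_near K X (h : G -> X) e t : cc_on K h -> 0 < e ->
  \forall r \near t, `|h r - h t| <= e.
Proof. by move=> [_ ch _] e0; have /cvgrPdistC_le := ch t; exact. Qed.

Lemma cc_linear K X (Y : normedModType R) (T : X -> Y) (h : G -> X) :
  bounded_linear T -> cc_on K h -> cc_on K (T \o h).
Proof.
move=> bT [cK ch h0]; split => //.
  by move=> x; apply: continuous_comp; [exact: ch|exact: bounded_linear_continuous].
by move=> s Ks; rewrite /= h0// (lin0 bT.1).
Qed.

Lemma bochner_linear K X (Y : completeNormedModType R) (T : X -> Y) (h : G -> X) :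
  bounded_linear T -> cc_on K h -> T (\int_(mu) h) = \int_(mu) (T \o h).
Proof.
move=> bT ch; have cTh := cc_linear bT ch.
have [lT [C [C0 HC]]] := bounded_linear_pos bT; have cK := cc_compact ch.
apply/eqP; rewrite -subr_eq0; apply/eqP.
apply: (@le_eps_eq0 _ _ _ (2 * C * fine (mu K))) => e e0.
have [t _|n [w [t [w0 Kt H _]]]] := riemann_sums (V := fun t => [set r | `|h r - h t| <= e]) cK.
  exact: cc_near ch _.
have H1 := H _ _ e ch (fun t r _ _ H => H).
have : `|\int_(mu) (T \o h) - \sum_(i < n) w i *: (T \o h) (t i)| <= C * e * fine (mu K).
  apply: H => // u r _ _ /= ur; apply: (le_trans (lin_lipschitz lT HC _ _)).
  by rewrite ler_wpM2l.
have -> : \sum_(i < n) w i *: (T \o h) (t i) = T (\sum_(i < n) w i *: h (t i)).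
  by rewrite lin_sum//; apply: eq_bigr => i _; rewrite linZ.
move=> H2; rewrite -(subrKA (T (\sum_(i < n) w i *: h (t i)))).
apply: (le_trans (ler_normD _ _)).
rewrite (_ : 2 * C * _ * e = C * (e * fine (mu K)) + C * e * fine (mu K)); last first.
  by ring.
apply: lerD; last by rewrite -normrN opprB.
by apply: (le_trans (lin_lipschitz lT HC _ _)); rewrite ler_wpM2l.
Qed.

Lemma cc_comb K (Y : normedModType R) (c : R) (h1 h2 : G -> Y) :
  cc_on K h1 -> cc_on K h2 -> cc_on K (fun r => c *: h1 r + h2 r).
Proof.
move=> [cK c1 h10] [_ c2 h20]; split => //.
  by move=> x; apply: cvgD; [apply: cvgZr; exact: c1|exact: c2].
by move=> s Ks; rewrite h10// h20// scaler0 addr0.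
Qed.

Lemma bochner_comb K X (c : R) (h1 h2 : G -> X) :
  cc_on K h1 -> cc_on K h2 ->
  \int_(mu) (fun r => c *: h1 r + h2 r) = c *: \int_(mu) h1 + \int_(mu) h2.
Proof.
move=> ch1 ch2; have ch := cc_comb c ch1 ch2; have cK := cc_compact ch.
apply/eqP; rewrite -subr_eq0; apply/eqP.
apply: (@le_eps_eq0 _ _ _ (2 * (`|c| + 1) * fine (mu K))) => e e0.
have [t _|n [w [t [w0 Kt H _]]]] := riemann_sums (V := fun t => [set r | `|h1 r - h1 t| <= e]
    `&` [set r | `|h2 r - h2 t| <= e]) cK.
  by apply: filterI; [exact: cc_near ch1 _|exact: cc_near ch2 _].
have H1 := H _ _ e ch1 (fun t r _ _ H => H.1).
have H2 := H _ _ e ch2 (fun t r _ _ H => H.2).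
have : `|\int_(mu) (fun r => c *: h1 r + h2 r) - \sum_(i < n) w i *: (c *: h1 (t i) +
  h2 (t i))| <= ((`|c| + 1) * e) * fine (mu K).
  apply: (H _ _ _ ch) => u r _ _ [/= u1 u2]; rewrite opprD addrACA -scalerBr.
  apply: (le_trans (ler_normD _ _)); rewrite mulrDl mul1r lerD// normrZ.
  by rewrite ler_wpM2l.
have -> : \sum_(i < n) w i *: (c *: h1 (t i) + h2 (t i)) =
    c *: (\sum_(i < n) w i *: h1 (t i)) + \sum_(i < n) w i *: h2 (t i).
  rewrite scaler_sumr -big_split/=; apply: eq_bigr => i _.
  by rewrite scalerDr !scalerA mulrC.
set S1 := \sum_(i < n) _; set S2 := \sum_(i < n) _ => H3.
rewrite -(subrKA (c *: S1 + S2)); apply: (le_trans (ler_normD _ _)).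
rewrite (_ : 2 * _ * _ * e = (`|c| + 1) * e * fine (mu K) + (`|c| * (e * fine (mu K)) +
  e * fine (mu K))); last first.
  by ring.
apply: lerD => //.
rewrite distrC opprD addrACA -scalerBr.
apply: (le_trans (ler_normD _ _)); rewrite lerD// normrZ.
by rewrite ler_wpM2l.
Qed.

(** The Riemann sums are combinations of values with nonnegative weights, and
    the cone is closed. *)
Lemma bochner_closed_cone K X (h : G -> X) (C : set X) : cc_on K h -> closed C ->
  C 0 -> (forall x y, C x -> C y -> C (x + y)) ->
  (forall (l : R) x, 0 <= l -> C x -> C (l *: x)) ->
  (forall r, C (h r)) -> C (\int_(mu) h).
Proof.
move=> ch clC C0 CD CZ Ch; have cK := cc_compact ch.
rewrite (closure_id C).1//; move=> U /nbhs_ballP[e/= e0 eU].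
have k0 : 0 < fine (mu K) + 1 by rewrite ltr_wpDl// fine_ge0.
set d := e / (fine (mu K) + 1) / 2.
have d0 : 0 < d by rewrite !divr_gt0.
have [t _|n [w [t [w0 Kt H _]]]] := riemann_sums (V := fun t => [set r | `|h r - h t| <= d]) cK.
  exact: cc_near ch _.
have H1 := H _ _ d ch (fun t r _ _ H => H).
exists (\sum_(i < n) w i *: h (t i)); split.
  by elim/big_ind: _ => // i _; exact: CZ.
apply: eU; rewrite -ball_normE/=; apply: (le_lt_trans H1).
rewrite /d mulrAC ltr_pdivrMr// mulrAC -mulrA ltr_pM2l//.
rewrite ltr_pdivrMr//.
by rewrite mulrDr mulr1 ltr_pwDr// ler_peMl ?fine_ge0// ler1n.
Qed.

Lemma compact_mul K L : compact K -> compact L ->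
  compact [set (x * y)%g | x in K & y in L].
Proof.
move=> cK cL; rewrite (_ : [set _ | _ in _ & _ in _] =
  (fun x : G * G => (x.1 * x.2)%g) @` (K `*` L)).
  apply: continuous_compact; last exact: compact_setX.
  exact/continuous_subspaceT/mulg_continuous.
apply/seteqP; split => [_ [x Kx [y Ly <-]]|_ [[x y] [Kx Ly] <-]].
  by exists (x, y).
by exists x => //; exists y.
Qed.

Lemma lmul_continuous (g : G) : continuous (fun x : G => (g * x)%g).
Proof.
move=> x; apply: (@continuous_comp _ _ _ (fun x : G => (g, x)) (fun x : G * G => (x.1 * x.2)%g)).
  by apply: cvg_pair; [exact: cvg_cst|exact: cvg_id].
exact: mulg_continuous.
Qed.

Lemma compact_lmul K (g : G) : compact K -> compact [set (g * x)%g | x in K].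
Proof.
move=> cK; apply: continuous_compact => //.
exact/continuous_subspaceT/lmul_continuous.
Qed.

Lemma cc_lmul K (Y : normedModType R) (h : G -> Y) (g : G) : cc_on K h ->
  cc_on [set (g^-1 * x)%g | x in K] (fun x => h (g * x)%g).
Proof.
move=> [cK ch h0]; split.
- exact: compact_lmul.
- by move=> x; apply: continuous_comp; [exact: lmul_continuous|exact: ch].
- move=> s Ks; apply: h0 => Kgs; apply: Ks; exists (g * s)%g => //.
  by rewrite mulKg.
Qed.

Lemma measurable_lmul (g : G) (E : set (borelType G)) : measurable E ->
  measurable ((fun x : borelType G => (g * x)%g : borelType G) @^-1` E).
Proof.
move=> mE; rewrite -[X in measurable X]setTI.
apply: (@measurability _ _ (borelType G) (borelType G) setT _ (@open G) erefl) => //.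
move=> _ [D oD <-]; rewrite setTI; apply: open_borel.
by apply: open_comp => // x _; exact: lmul_continuous.
Qed.

(** Translating the sets of a step function leaves their measures, hence the
    step integral, unchanged. *)
Lemma bochner_left_invariant K X (h : G -> X) (g : G) : cc_on K h ->
  \int_(mu) (fun x => h (g * x)%g) = \int_(mu) h.
Proof.
move=> ch; have ch' := cc_lmul g ch; have [cK _ h0] := ch.
apply/eqP; rewrite -subr_eq0; apply/eqP.
apply: (@le_eps_eq0 _ _ _ (2 * fine (mu K))) => e e0.
have [t _|n [E [t [mE [fE [Kt EV cov H]]]]]] := fine_step (V :=
  fun t => [set r | `|h r - h t| <= e]) cK.
  exact: cc_near ch _.
have {}H := H _ h e h0 (fun t r _ _ H => H).
have muE (D : set (borelType G)) : measurable D -> mu [set (g^-1 * x)%g | x in D] = mu D.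
  by move=> mD; case: haar => _ + _ _ _; exact.
pose E' i : set (borelType G) := [set (g^-1 * x)%g | x in E i].
have gE i (x : G) : E' i x <-> E i (g * x)%g.
  split => [[y Ey <-]|Ex]; first by rewrite mulVKg.
  by exists (g * x)%g => //; rewrite mulKg.
have mE' i : measurable (E' i).
  rewrite (_ : E' i = (fun x : borelType G => (g * x)%g : borelType G) @^-1` E i); last first.
    by apply/seteqP; split => x /gE.
  exact: measurable_lmul.
have fE' i : (mu (E' i) < +oo)%E by rewrite muE.
pose s' := StepFun (fun i => h (t i)) mE' fE'.
have II : step_integral s' = step_integral (riemann_step t h mE fE).
  by rewrite /step_integral/=; apply: eq_bigr => i _; rewrite muE.
have se (r : G) : step_eval s' r = step_eval (riemann_step t h mE fE) (g * r)%g.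
  rewrite /step_eval/=; apply: eq_bigr => i _; congr (_ *: _); rewrite !indicE.
  have [Er|nEr] := pselect (E i (g * r)%g).
    by rewrite !mem_set//; exact/gE.
  by rewrite !memNset// => /gE.
have H1 := bochner_step ch H (cc_bochner ch).
have H2 := bochner_step (e := e) (s := s') ch' _ (cc_bochner ch').
have {}H2 := H2 _.
rewrite -(subrKA (step_integral s')); apply: (le_trans (ler_normD _ _)).
rewrite (_ : 2 * _ * _ = e * fine (mu K) + e * fine (mu K)); last by ring.
apply: lerD; last by rewrite II -normrN opprB.
rewrite -(muE K (compact_borel cK)); apply: H2 => r; rewrite se.
apply: (le_trans (H _)); rewrite !indicE; apply: ler_wpM2l; first exact: ltW.
rewrite ler_nat; case: (boolP (_ \in K)) => // /set_mem Kr.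
rewrite mem_set//; exists (g * r)%g => //; exact: mulKg.
Qed.

(** If U were null, then so would be each compact set, as finitely many
    translates of U cover it, and inner regularity would make the whole group
    null. *)
Lemma haar_open_gt0 (U : set G) : open U -> U !=set0 -> (0 < mu U)%E.
Proof.
move=> oU [u Uu]; rewrite lt0e measure_ge0 andbT; apply/eqP => U0.
have [muG inv cpt_fin outer inner] := haar.
have mUK (K : set G) : compact K -> mu K = 0%E.
  move=> cK.
  have [t _|n [E [t [mE [fE [Kt EV cov _]]]]]] :=
     fine_step (V := fun t => [set (t * u^-1 * x)%g | x in U]) cK.
    apply: open_nbhs_nbhs; split; last by exists u => //; rewrite mulgVK.
    rewrite (_ : [set _ | _ in _] = (fun x : G => ((t * u^-1)^-1 * x)%g) @^-1` U).
      by apply: open_comp => // x _; exact: lmul_continuous.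
    apply/seteqP; split => [_ [x Ux <-]|x Ux]; first by rewrite /= mulKg.
    by exists ((t * u^-1)^-1 * x)%g => //; rewrite mulVKg.
  apply/eqP; rewrite eq_le measure_ge0 andbT.
  have mK := compact_borel cK.
  apply: (le_trans (mu_le_sum mE mK cov)); rewrite big1// => i _.
  apply/eqP; rewrite eq_le measure_ge0 andbT.
  have mU := open_borel oU.
  rewrite -U0 -(inv (t i * u^-1)%g U mU); apply: mu_le => //.
    rewrite (_ : [set _ | _ in _] =
      (fun x : borelType G => ((t i * u^-1)^-1 * x)%g : borelType G) @^-1` U).
      exact: measurable_lmul.
    apply/seteqP; split => [_ [x Ux <-]|x Ux]; first by rewrite /= mulKg.
    by exists ((t i * u^-1)^-1 * x)%g => //; rewrite mulVKg.
  by move=> x /EV[].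
move/eqP : muG; apply; rewrite (inner setT openT).
apply/eqP; rewrite eq_le; apply/andP; split.
  by apply: ge_ereal_sup => _ [K [cK _] <-]; rewrite mUK.
by apply: ereal_sup_ubound; exists set0; [split => //; exact: compact0|rewrite measure0].
Qed.

Lemma compact_nbhs (x : G) : exists C : set G, [/\ nbhs x C, compact C & closed C].
Proof.
have [C xC [cC clC]] := lG (x := x) I.
by exists C; split => //; apply: (@filterS _ (nbhs x) _ [set y | setT y -> C y] C) => // y; exact.
Qed.

Lemma bochner_pos_lower K (phi : G -> R^o) (F : set G) (c : R) : cc_on K phi ->
  (forall r, 0 <= phi r) -> open F -> F `<=` K -> 0 < c -> (forall r, F r -> 2 * c <= phi r) ->
  c * fine (mu F) <= \int_(mu) phi.
Proof.
move=> cphi phi0 oF FK c0 Fc; have cK := cc_compact cphi.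
apply: (@le_eps _ _ _ (fine (mu K))) => e e0.
(* The oscillation is at most c as well, so that phi >= 2 * c on F leaves phi >=
   c at the nodes. *)
pose d := Num.min e c.
have d0 : 0 < d by rewrite lt_min e0.
have [t _|n [w [t [w0 Kt H H']]]] := riemann_sums (V :=
  fun t => [set r | `|phi r - phi t| <= d]) cK.
  exact: cc_near cphi _.
have H1 := H _ _ d cphi (fun t r _ _ H => H).
apply: (@le_trans _ _ (\sum_(i < n) w i * phi (t i))).
  apply: H' => //; [exact: open_borel|exact: ltW|].
  move=> u r Ku Fr /= ur; have := Fc _ Fr; have dc : d <= c by rewrite ge_min lexx orbT.
  move: ur; rewrite ler_distl => /andP[_ ur] cr.
  rewrite -(lerD2r d); apply: le_trans ur; apply: le_trans cr.
  by rewrite mulr_natl mulr2n lerD2l.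
rewrite -lerBlDl; apply: le_trans (ler_norm _) _; rewrite distrC.
apply: (le_trans H1); rewrite mulrC ler_wpM2l ?fine_ge0// ge_min lexx//.
Qed.

(** A Urysohn function f that vanishes at 1 and is 1 outside a relatively
    compact neighbourhood is turned into (1/2 - f)^+; cutting at the level 1/2
    puts the support into the closed set where f <= 1/2, which lies inside the
    neighbourhood. *)
Lemma bump (V : set G) : nbhs 1%g V ->
  exists (K : set G) (phi : G -> R^o), [/\ K `<=` V, cc_on K phi, forall r, 0 <= phi r
   & 0 < \int_(mu) phi].
Proof.
move=> nV; have [C [nC cC clC]] := compact_nbhs 1%g.
pose W := interior (V `&` C).
have oW : open W by exact: open_interior.
have W1 : W 1%g by apply: filterI.
have /uniform_separatorP-/(_ R)[f [cf f01 f0 f1]] : uniform_separator [set 1%g : G] (~` W).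
  apply: (locally_compact_completely_regular (R := R) lG hG) => //.
  exact: open_closedC.
(* The support is where f <= 1/2; on F, where f < 1/4, one has phi >= 1/4 = 2 *
   8^-1. *)
pose phi (x : G) : R^o := Num.max (2^-1 - f x) 0.
pose K := [set x | f x <= 2^-1].
have KW : K `<=` W.
  move=> x /= fx; apply: contrapT => nW; have /= fx1 : f x = 1 by apply: f1; exists x.
  by move: fx; rewrite /K/= fx1 leNgt invf_lt1// ltr1n.
have clK : closed K by apply: (@preimage_closed _ _ f [set y | y <= 2^-1]) => [x _|];
  [exact: cf|exact: closed_le].
have cK : compact K.
  apply: (subclosed_compact clK cC) => x /KW /interior_subset[].
  by [].
have cphi : cc_on K phi.
  split => //.
    move=> x; apply: (@continuous_max _ _ (fun x => 2^-1 - f x) (cst 0)).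
      by apply: cvgB; [exact: cvg_cst|exact: cf].
    exact: cvg_cst.
  by move=> x /negP; rewrite -ltNge /phi => fx; apply/max_idPr; rewrite subr_le0 ltW.
have phi0 r : 0 <= phi r by rewrite /phi le_max lexx orbT.
exists K, phi; split => //.
  by move=> x /KW/interior_subset[].
pose F := [set x | f x < 4^-1].
have oF : open F by apply: (@open_comp _ _ f [set y | y < 4^-1]) => [x _|];
  [exact: cf|exact: open_lt].
have F1 : F 1%g.
  by rewrite /F/= (_ : f 1%g = 0) ?invr_gt0//; apply: f0; exists 1%g.
have FK : F `<=` K by move=> x /= /ltW/le_trans; apply; rewrite lef_pV2 ?posrE// ler_nat.
apply: lt_le_trans (bochner_pos_lower cphi phi0 oF FK (c := 8^-1) _ _).
- rewrite mulr_gt0// fine_gt0// haar_open_gt0//=; last by exists 1%g.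
  by apply: le_lt_trans (haar_compact cK); apply: mu_le => //;
    [exact: open_borel|exact: (compact_borel cK)].
- by rewrite invr_gt0.
- by move=> r; rewrite /F/= => Fr; rewrite /phi le_max; apply/orP; left; lra.
Qed.

(** Up to normalization, phi is a probability density, and k differs from k0 by
    at most e on its support. *)
Lemma bochner_weighted K (phi : G -> R^o) X (k : G -> X) (k0 : X) (e : R) :
  cc_on K phi -> cc_on K (fun r => phi r *: k r) -> (forall r, 0 <= phi r) ->
  0 <= e -> (forall r, K r -> `|k r - k0| <= e) ->
  `|\int_(mu) (fun r => phi r *: k r) - (\int_(mu) phi) *: k0| <= (\int_(mu) phi) * e.
Proof.
move=> cphi ck phi0 e0 He; have cK := cc_compact cphi.
apply: (@le_eps _ _ _ (fine (mu K) * (1 + `|k0| + e))) => d d0.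
have [t _|n [w [t [w0 Kt H _]]]] := riemann_sums (V := fun t =>
    [set r | `|phi r - phi t| <= d] `&` [set r | `|phi r *: k r - phi t *: k t| <= d]) cK.
  by apply: filterI; [exact: cc_near cphi _|exact: cc_near ck _].
have H1 := H _ _ d cphi (fun t r _ _ H => H.1).
have H2 := H _ _ d ck (fun t r _ _ H => H.2).
set c := \int_(mu) phi in H1 *; set v := bochner _ _ in H2 *.
set S := \sum_(i < n) _ in H1; set T := \sum_(i < n) _ in H2.
have H3 : `|T - S *: k0| <= S * e.
  rewrite /T /S scaler_suml -sumrB mulr_suml.
  apply: le_trans (ler_norm_sum _ _ _) _; apply: ler_sum => i _.
  rewrite scalerA -scalerBr normrZ ger0_norm ?mulr_ge0// ler_wpM2l//; [exact: mulr_ge0|exact: He].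
have H4 : S <= c + d * fine (mu K).
  by rewrite -lerBlDl; apply: le_trans (ler_norm _) _; rewrite distrC.
(* Compare v with its Riemann sum T, then T with S k0, then S with c. *)
have -> : v - c *: k0 = (v - T) + (T - S *: k0) + (S - c) *: k0.
  by rewrite subrKA scalerBl addrA subrK.
apply: (le_trans (ler_normD _ _)); rewrite normrZ (distrC S c).
apply: (@le_trans _ _ (d * fine (mu K) + (c + d * fine (mu K)) * e + d * fine (mu K) * `|k0|)).
  rewrite lerD ?ler_wpM2r//; apply: (le_trans (ler_normD _ _)); rewrite lerD//.
  by apply: (le_trans H3); rewrite ler_wpM2r.
by rewrite le_eqVlt; apply/orP; left; apply/eqP; ring.
Qed.

End compactly_supported.

(** * Dynamical systems and convolution *)

(** Strong convergence of locally bounded operators gives joint convergence. *)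
Lemma cvg_action (R : realType) (V W : normedModType R) (I : Type) (F : set_system I)
    (FF : Filter F) (S : I -> V -> W) (v : I -> V) (v0 : V) (w0 : W) (M : R) :
  (forall i, linear (S i)) -> (\forall i \near F, forall x, `|S i x| <= M * `|x|) ->
  v i @[i --> F] --> v0 -> S i v0 @[i --> F] --> w0 -> S i (v i) @[i --> F] --> w0.
Proof.
move=> lS bS cv cS; apply/cvgrPdist_le => e e0.
have M0 : 0 < `|M| + 1 by rewrite ltr_wpDl.
near=> i.
rewrite -(subrKA (S i v0)) -linB//; apply: (le_trans (ler_normD _ _)).
rewrite (splitr e) lerD//.
  near: i; move/cvgrPdist_le : cS; apply; exact: divr_gt0.
have H : `|v0 - v i| <= e / 2 / (`|M| + 1).
  by near: i; move/cvgrPdist_le : cv; apply; rewrite !divr_gt0.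
have : `|S i (v0 - v i)| <= M * `|v0 - v i| by near: i; apply: filterS bS.
move/le_trans; apply; apply: (@le_trans _ _ ((`|M| + 1) * `|v0 - v i|)).
  by rewrite ler_wpM2r// (le_trans (ler_norm M))// lerDl.
by rewrite mulrC -ler_pdivlMr.
Unshelve. all: by end_near. Qed.

Section algebra_facts.
Context {R : realType} {A : banachAlgType R}.

Lemma amul_linr (a : A) : linear (amul a).
Proof. by move=> c x y; rewrite amulDr amulZr. Qed.

Lemma amul_linl (b : A) : linear (fun a : A => amul a b).
Proof. by move=> c x y; rewrite amulDl amulZl. Qed.

Lemma amul_blinr (a : A) : bounded_linear (amul a).
Proof. by split; [exact: amul_linr|exists `|a| => x; exact: normaM_le]. Qed.

Lemma amul_blinl (b : A) : bounded_linear (fun a : A => amul a b).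
Proof.
by split; [exact: amul_linl|exists `|b| => x; rewrite mulrC; exact: normaM_le].
Qed.

Lemma cvg_amul (I : Type) (F : set_system I) (FF : Filter F) (u v : I -> A) (a b : A) :
  u i @[i --> F] --> a -> v i @[i --> F] --> b -> amul (u i) (v i) @[i --> F] --> amul a b.
Proof.
move=> ua vb; apply: (@cvg_action _ _ _ _ F FF (fun i => amul (u i)) v b _ (`|a| + 1)) => //.
- by move=> i; exact: amul_linr.
- have : \forall i \near F, `|a - u i| <= 1 by move/cvgrPdist_le : ua; exact.
  apply: filterS => i ai x; apply: (le_trans (normaM_le _ _)); rewrite ler_wpM2r//.
  rewrite -[u i](subrK a) addrC; apply: (le_trans (ler_normD _ _)).
  by rewrite lerD2l distrC.
- have := bounded_linear_continuous (amul_blinl b) (x := a).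
  exact: cvg_comp ua.
Qed.
End algebra_facts.

Section dynamics.
Context {R : realType} {G : topologicalGroupType} {A : preorderedBanachAlgType R}.
Variable mu : {measure set (borelType G) -> \bar R}.
Hypotheses (hG : hausdorff_space G) (lG : locally_compact [set: G])
  (haar : left_haar mu).
Variable alpha : G -> A -> A.
Hypothesis dyn : dynamical_system alpha.
Implicit Types (K L : set G) (f g : G -> A).

Lemma alpha_blin s : bounded_linear (alpha s).
Proof. by have [_ /(_ s) []] := dyn. Qed.

Lemma alphaA s t a : alpha (s * t)%g a = alpha s (alpha t a).
Proof. by have [_ _ ->] := dyn. Qed.

Lemma alphaM s a b : alpha s (amul a b) = amul (alpha s a) (alpha s b).
Proof. by have [_ /(_ s) []] := dyn. Qed.

Lemma alpha1 a : alpha 1%g a = a.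
Proof.
have [_ /(_ 1%g) [_ _ [c [_ cK _ _ _]]] _ _] := dyn.
by apply: (can_inj cK); rewrite -alphaA mulg1.
Qed.

Lemma alpha_pos s a : pcone a -> pcone (alpha s a).
Proof. by have [_ /(_ s) [_ _ [c [_ _ _ + _]]] _ _] := dyn; exact. Qed.

(** The uniform boundedness principle: over a compact neighbourhood every orbit
    is compact, hence bounded. *)
Lemma alpha_locally_bounded (r0 : G) :
  exists M, 0 <= M /\ \forall r \near r0, forall a, `|alpha r a| <= M * `|a|.
Proof.
have [C [nC cC clC]] := compact_nbhs lG r0.
have [|x|M HM] := @Banach_Steinhauss R A A [set alpha r | r in C] _ _ 1.
- move=> _ [r _ <-]; have [lr [c [c0 Hc]]] := bounded_linear_pos (alpha_blin r).
  split => // d; exists (c * d) => x xd.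
  by apply: (le_trans (Hc x)); rewrite ler_wpM2l.
- have [_ _ _ /(_ x) ca] := dyn.
  have : compact [set alpha r x | r in C].
    by apply: continuous_compact => //; exact: continuous_subspaceT.
  move=> /compact_bounded [M [Mr HM]]; exists (M + 1) => _ [r Cr <-].
  by apply: (HM (M + 1)); [rewrite ltrDl|exists r].
have HM' r : C r -> forall a, `|alpha r a| <= `|M| * `|a|.
  move=> Cr a; have [->|a0] := eqVneq a 0.
    by rewrite (lin0 (alpha_blin r).1) normr0 mulr0.
  have : `|alpha r (`|a|^-1 *: a)| <= M.
    apply: (HM (alpha r)); first by exists r.
    by rewrite normrZ normfV normr_id mulVf// normr_eq0.
  rewrite (linZ (alpha_blin r).1) normrZ normfV normr_id mulrC ler_pdivrMr ?normr_gt0//.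
  by move/le_trans; apply; rewrite ler_wpM2r// ler_norm.
exists `|M|; split => //; exact: filterS nC.
Qed.

Lemma cvg_alpha (I : Type) (F : set_system I) (FF : Filter F) (u : I -> G) (v : I -> A) r a :
  u i @[i --> F] --> r -> v i @[i --> F] --> a ->
  alpha (u i) (v i) @[i --> F] --> alpha r a.
Proof.
move=> ur va; have [M [M0 HM]] := alpha_locally_bounded r.
apply: (@cvg_action _ _ _ _ F FF (fun i => alpha (u i)) v a _ M) => //.
- by move=> i; have [] := alpha_blin (u i).
- exact: (ur _ HM).
- have [_ _ _ /(_ a r) ca] := dyn.
  exact: cvg_comp ur ca.
Qed.

(** The tube lemma: joint continuity along a compact slice is uniform continuity
    at that slice. *)
Lemma unif_near (Y : normedModType R) (J : G -> G -> Y) r0 K e : compact K ->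
  (forall s, K s -> {for (r0, s), continuous (fun x : G * G => J x.1 x.2)}) -> 0 < e ->
  \forall r \near r0, forall s, K s -> `|J r s - J r0 s| <= e.
Proof.
move=> /compact_near_coveringP cK cJ e0.
have := cK G (nbhs r0) (fun r s => `|J r s - J r0 s| <= e) _; apply => s Ks.
have e2 : 0 < e / 2 by rewrite divr_gt0.
have /cvgrPdist_le/(_ _ e2)[[P Q]/= [Pr Qs] PQ] := cJ s Ks.
exists (Q, P) => //= -[s' r] /= [Qs' Pr'].
rewrite -(subrKA (J r0 s)); apply: (le_trans (ler_normD _ _)); rewrite (splitr e) lerD//.
  by rewrite distrC; exact: (PQ (r, s')).
by apply: (PQ (r0, s')); split => //=; exact: nbhs_singleton.
Qed.

Lemma Cc_cc f : Cc f -> cc_on (closure [set s | f s != 0]) f.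
Proof.
move=> [cf cK]; split => // s Ks; apply/eqP; apply: contrapT => /negP fs; apply: Ks.
exact: subset_closure.
Qed.

Lemma cc_Cc K f : cc_on K f -> Cc f.
Proof.
move=> [cK cf f0]; split => //; apply: (subclosed_compact _ cK); first exact: closed_closure.
rewrite [X in _ `<=` X](closure_id K).1; last exact: compact_closed.
by apply: closureS => s /= /eqP fs; apply: contrapT => /f0.
Qed.

Lemma cc_widen K L (Y : normedModType R) (h : G -> Y) : cc_on K h -> compact L ->
  K `<=` L -> cc_on L h.
Proof. by move=> [_ ch h0] cL KL; split => // s Ls; apply: h0 => /KL. Qed.

Lemma cc_left_mul K a f : cc_on K f -> cc_on K (left_mul_op a f).
Proof. by move=> cf; exact: (cc_linear (amul_blinr a) cf). Qed.

Lemma cc_translation K r f : cc_on K f ->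
  cc_on [set (r * x)%g | x in K] (translation_op alpha r f).
Proof.
move=> cf; have := cc_linear (alpha_blin r) (cc_lmul r^-1%g cf).
by rewrite invgK.
Qed.

Lemma ldiv_joint : continuous (fun x : G * G => (x.1^-1 * x.2)%g).
Proof.
move=> x; apply: (@continuous_comp _ _ _ (fun x : G * G => (x.1^-1%g, x.2))
  (fun x : G * G => (x.1 * x.2)%g)); last exact: mulg_continuous.
apply: cvg_pair; last exact: cvg_snd.
apply: (@continuous_comp _ _ _ fst (fun x : G => x^-1%g));
  [exact: cvg_fst|exact: invg_continuous].
Qed.

Lemma translation_joint f : continuous f ->
  continuous (fun x : G * G => translation_op alpha x.1 f x.2).
Proof.
move=> cf x; rewrite /translation_op; apply: cvg_alpha; first exact: cvg_fst.
apply: (@continuous_comp _ _ _ (fun x : G * G => (x.1^-1 * x.2)%g) f); last exact: cf.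
exact: ldiv_joint.
Qed.

Lemma kernel_joint f g : continuous f -> continuous g ->
  continuous (fun x : G * G => left_mul_op (f x.1) (translation_op alpha x.1 g) x.2).
Proof.
move=> cf cg x; rewrite /left_mul_op; apply: cvg_amul; last exact: translation_joint.
by apply: (@continuous_comp _ _ _ fst f); [exact: cvg_fst|exact: cf].
Qed.

(** Outside the product of a compact neighbourhood of r0 and K all the
    translates vanish, so the estimate on a compact set is global. *)
Lemma translation_near K f r0 e : cc_on K f -> 0 < e ->
  \forall r \near r0, forall s,
    `|translation_op alpha r f s - translation_op alpha r0 f s| <= e.
Proof.
move=> cf e0; have [cK cont_f f0] := cf; have [C [nC cC _]] := compact_nbhs lG r0.
have tf0 r s : C r -> ~ [set (x * y)%g | x in C & y in K] s -> translation_op alpha r f s = 0.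
  move=> Cr sCK; rewrite /translation_op f0 ?(lin0 (alpha_blin _).1)// => Krs.
  by apply: sCK; exists r => //; exists (r^-1 * s)%g => //; rewrite mulVKg.
have Cr0 := nbhs_singleton nC.
have := unif_near (J := fun r => translation_op alpha r f) (r0 := r0)
  (compact_mul cC cK) (fun s _ => translation_joint cont_f (x := (r0, s))) e0.
move=> H; apply: filterS2 nC H => r Cr H s.
have [/H//|sCK] := pselect ([set (x * y)%g | x in C & y in K] s).
by rewrite !tf0// subrr normr0 ltW.
Qed.

(** The convolution of f and g is the integral over r of these compactly
    supported functions. *)
Definition conv_kernel f g r : G -> A := left_mul_op (f r) (translation_op alpha r g).

Lemma conv_kernel_supp K L f g : cc_on K f -> cc_on L g ->
  (forall r s, ~ [set (x * y)%g | x in K & y in L] s -> conv_kernel f g r s = 0) /\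
  (forall r s, ~ K r -> conv_kernel f g r s = 0).
Proof.
move=> [_ _ f0] [_ _ g0].
have H r s : ~ K r -> conv_kernel f g r s = 0.
  by move=> Kr; rewrite /conv_kernel /left_mul_op f0// (lin0 (amul_linl _)).
split=> // r s KLs; have [Kr|] := pselect (K r); last exact: H.
rewrite /conv_kernel /left_mul_op /translation_op g0.
  by rewrite (lin0 (alpha_blin _).1) (lin0 (amul_linr _)).
by move=> Lrs; apply: KLs; exists r => //; exists (r^-1 * s)%g => //; rewrite mulVKg.
Qed.

Lemma conv_kernel_near K L f g r0 e : cc_on K f -> cc_on L g -> 0 < e ->
  \forall r \near r0, forall s, `|conv_kernel f g r s - conv_kernel f g r0 s| <= e.
Proof.
move=> cf cg e0; have [k0 _] := conv_kernel_supp cf cg.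
have [cK cont_f _] := cf; have [cL cont_g _] := cg.
have := unif_near (J := conv_kernel f g) (r0 := r0)
  (compact_mul cK cL) (fun s _ => kernel_joint cont_f cont_g (x := (r0, s))) e0.
move=> H; apply: filterS H => r H s.
have [/H//|sCK] := pselect ([set (x * y)%g | x in K & y in L] s).
by rewrite !k0 ?subrr ?normr0 ?ltW//.
Qed.

Lemma cc_conv_kernel K L f g s : cc_on K f -> cc_on L g ->
  cc_on K (fun r => conv_kernel f g r s).
Proof.
move=> cf cg; have [cK cont_f f0] := cf; have [cL cont_g _] := cg; split => //.
  move=> r; apply: (@continuous_comp _ _ _ (fun r : G => (r, s))
    (fun x : G * G => conv_kernel f g x.1 x.2)); last exact: kernel_joint.
  by apply: cvg_pair; [exact: cvg_id|exact: cvg_cst].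
by move=> r Kr; rewrite (conv_kernel_supp cf cg).2.
Qed.

Lemma convolutionE f g s : convolution mu alpha f g s =
  \int_(mu) (fun r => conv_kernel f g r s).
Proof. by []. Qed.

(** Continuity comes from the uniform continuity of the kernel in s over the
    compact support in r. *)
Lemma cc_convolution K L f g : cc_on K f -> cc_on L g ->
  cc_on [set (x * y)%g | x in K & y in L] (convolution mu alpha f g).
Proof.
move=> cf cg; have [k0 _] := conv_kernel_supp cf cg.
have [cK cont_f f0] := cf; have [cL cont_g _] := cg; split.
- exact: compact_mul.
- move=> s0; apply/cvgrPdist_le => e e0.
  have k1 : 0 < fine (mu K) + 1 by rewrite ltr_wpDl// fine_ge0.
  set d := e / (fine (mu K) + 1); have d0 : 0 < d by rewrite divr_gt0.
  have J r : K r -> {for (s0, r), continuous (fun x : G * G => conv_kernel f g x.2 x.1)}.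
    move=> _; apply: (@continuous_comp _ _ _ (fun x : G * G => (x.2, x.1))
      (fun x : G * G => conv_kernel f g x.1 x.2)); last exact: kernel_joint.
    by apply: cvg_pair; [exact: cvg_snd|exact: cvg_fst].
  have := unif_near (J := fun s r => conv_kernel f g r s) cK J d0.
  apply: filterS => s Hs; rewrite !convolutionE.
  have := bochner_comb hG haar (-1) (cc_conv_kernel s cf cg) (cc_conv_kernel s0 cf cg).
  rewrite scaleN1r addrC => <-.
  have := bochner_norm hG haar (c :=
    d) (cc_comb (-1) (cc_conv_kernel s cf cg) (cc_conv_kernel s0 cf cg)).
  move/(_ _)/le_trans; apply.
    by move=> r Kr; rewrite scaleN1r addrC distrC; exact: Hs.
  by rewrite /d mulrAC ler_pdivrMr// ler_pM2l// lerDl.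
- move=> s KLs; rewrite convolutionE (_ : (fun _ => _) = (fun=> 0 : A)); last first.
    by apply/funext => r; exact: k0.
  have c0 : cc_on K (fun=> 0 : A) by split => // x; exact: cvg_cst.
  have := bochner_norm hG haar (c := 0) c0.
  rewrite mul0r => H; apply/eqP; rewrite -normr_le0; apply: H => r _.
  by rewrite normr0.
Qed.

Lemma convolution_left_mul K L a f g : cc_on K f -> cc_on L g ->
  convolution mu alpha (left_mul_op a f) g = left_mul_op a (convolution mu alpha f g).
Proof.
move=> cf cg; apply/funext => s; rewrite /left_mul_op !convolutionE.
rewrite (bochner_linear hG haar (amul_blinr a) (cc_conv_kernel s cf cg)).
by congr bochner; apply/funext => r; rewrite /= /conv_kernel /left_mul_op amulA.
Qed.

(** Left invariance, for the substitution of t^-1 r for r. *)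
Lemma convolution_translation K L t f g : cc_on K f -> cc_on L g ->
  convolution mu alpha (translation_op alpha t f) g =
  translation_op alpha t (convolution mu alpha f g).
Proof.
move=> cf cg; apply/funext => s; rewrite /translation_op !convolutionE.
have ck := cc_conv_kernel (t^-1 * s)%g cf cg.
rewrite (bochner_linear hG haar (alpha_blin t) ck).
rewrite -(bochner_left_invariant hG haar t^-1%g (cc_linear (alpha_blin t) ck)).
congr bochner; apply/funext => r.
rewrite /= /conv_kernel /left_mul_op /translation_op alphaM -alphaA mulVKg.
by rewrite invgM invgK mulgA -(mulgA _ t) mulgV mulg1.
Qed.

Lemma cc_tensor K (phi : G -> R^o) (a : A) : cc_on K phi ->
  cc_on K (fun r => phi r *: a).
Proof.
move=> cphi; apply: (cc_linear (T := fun c : R^o => c *: a) _ cphi).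
split; first by move=> c x y; rewrite scalerDl scalerA.
by exists `|a| => c; rewrite normrZ mulrC.
Qed.

(** * Integrated forms and the seminorm sigma *)

Section representations.
Variables (X : completeNormedModType R) (p : (A -> X -> X) * (G -> X -> X)).
Hypothesis cp : continuous_covariant_rep alpha p.

Lemma rep_blin a : bounded_linear (p.1 a).
Proof. by have [[[]]] := cp. Qed.

Lemma rep_linl x : linear (fun a => p.1 a x).
Proof. by have [[[]]] := cp. Qed.

Lemma rep_blinl x : bounded_linear (fun a => p.1 a x).
Proof.
split; first exact: rep_linl.
have [_ [_ [C HC]] _] := cp; exists (C * `|x|) => a.
by rewrite mulrAC.
Qed.

Lemma rep_blin2 r : bounded_linear (p.2 r).
Proof. by have [[_ [/(_ r) []]]] := cp. Qed.

Lemma rep2M r s x : p.2 (r * s)%g x = p.2 r (p.2 s x).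
Proof. by have [[_ []]] := cp. Qed.

Lemma rep2_1 x : p.2 1%g x = x.
Proof.
have [[_ [/(_ 1%g) [_ [S [_ SK _]]] _] _] _ _] := cp.
by apply: (can_inj SK); rewrite -rep2M mulg1.
Qed.

Definition form_integrand f x r := p.1 (f r) (p.2 r x).

Lemma cc_form K f x : cc_on K f -> cc_on K (form_integrand f x).
Proof.
move=> [cK cf f0]; split => //.
  move=> r0; have [_ [_ [C HC]] cU] := cp.
  apply: (@cvg_action _ _ _ _ (nbhs r0) _ (fun r => p.1 (f r))
    (fun r => p.2 r x) (p.2 r0 x) _ (`|C| * (`|f r0| + 1))).
  - by move=> r; have [] := rep_blin (f r).
  - have : \forall r \near r0, `|f r0 - f r| <= 1.
      by have /cvgrPdist_le := cf r0; apply.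
    apply: filterS => r fr y; apply: (le_trans (HC _ _)); rewrite ler_wpM2r//.
    apply: (@le_trans _ _ (`|C| * `|f r|)); first by rewrite ler_wpM2r// ler_norm.
    rewrite ler_wpM2l// -[f r](subrK (f r0)) addrC; apply: (le_trans (ler_normD _ _)).
    by rewrite lerD2l distrC.
  - exact: cU.
  - have := bounded_linear_continuous (rep_blinl (p.2 r0 x)) (x := f r0).
    exact: cvg_comp (cf r0).
by move=> s Ks; rewrite /form_integrand f0// (lin0 (rep_linl _)).
Qed.

Lemma integrated_formE f x : integrated_form mu p f x = \int_(mu) (form_integrand f x).
Proof. by []. Qed.

Lemma form_comb c K f g x : cc_on K f -> cc_on K g ->
  integrated_form mu p (fun s => c *: f s + g s) x =
  c *: integrated_form mu p f x + integrated_form mu p g x.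
Proof.
move=> cf cg; rewrite !integrated_formE.
rewrite -(bochner_comb hG haar c (cc_form x cf) (cc_form x cg)).
by congr bochner; apply/funext => r; rewrite /form_integrand rep_linl.
Qed.

Lemma form_linear K f : cc_on K f -> linear (integrated_form mu p f).
Proof.
move=> cf c x y; rewrite !integrated_formE.
rewrite -(bochner_comb hG haar c (cc_form x cf) (cc_form y cf)).
congr bochner; apply/funext => r; rewrite /form_integrand.
by rewrite (rep_blin2 r).1 (rep_blin (f r)).1.
Qed.

Lemma form_left_mul K a f x : cc_on K f ->
  integrated_form mu p (left_mul_op a f) x = p.1 a (integrated_form mu p f x).
Proof.
move=> cf; rewrite !integrated_formE (bochner_linear hG haar (rep_blin a) (cc_form x cf)).
congr bochner; apply/funext => r; rewrite /form_integrand /left_mul_op /=.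
by have [[[_ _ ->]]] := cp.
Qed.

(** Covariance moves U_r across pi, and left invariance undoes the translation
    of the argument. *)
Lemma form_translation K r f x : cc_on K f ->
  integrated_form mu p (translation_op alpha r f) x = p.2 r (integrated_form mu p f x).
Proof.
move=> cf; rewrite !integrated_formE (bochner_linear hG haar (rep_blin2 r) (cc_form x cf)).
rewrite -(bochner_left_invariant hG haar r^-1%g (cc_linear (rep_blin2 r) (cc_form x cf))).
congr bochner; apply/funext => s; rewrite /form_integrand /translation_op /=.
by have [[_ _ ->]] := cp; rewrite -!rep2M.
Qed.

End representations.

Lemma cc_bounded K (Y : normedModType R) (f : G -> Y) : cc_on K f ->
  exists M, 0 <= M /\ forall s, `|f s| <= M.
Proof.
move=> [cK cf f0].
have : compact [set f r | r in K].
  by apply: continuous_compact => //; exact: continuous_subspaceT.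
move=> /compact_bounded [M [Mr HM]]; exists (`|M| + 1); split; first by rewrite addr_ge0.
move=> s; have [Ks|/f0 ->] := pselect (K s); last by rewrite normr0 addr_ge0.
apply: (HM (`|M| + 1)); last by exists s.
by rewrite (le_lt_trans (ler_norm M))// ltrDl.
Qed.

Section sigma.
Variable Rc : rep_class R G A.
Arguments Rc : clear implicits.
Hypothesis ubR : uniformly_bounded_class alpha Rc.

Lemma uniform_bounds : exists (C : R) (nu : G -> R),
  [/\ 0 <= C, forall r, 0 <= nu r,
    forall K, compact K -> exists M : R, forall r, K r -> nu r <= M,
    forall X p, Rc X p -> forall a x, `|p.1 a x| <= C * `|a| * `|x|
  & forall X p, Rc X p -> forall r x, `|p.2 r x| <= nu r * `|x|].
Proof.
have [_ _ [C [nu [C0 nu0 nuK H]]]] := ubR; exists C, nu; split => //.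
- by move=> X p /H[].
- by move=> X p /H[].
Qed.

Lemma Rc_cont X p : Rc X p -> continuous_covariant_rep alpha p.
Proof. by have [_ + _] := ubR; exact. Qed.

(** One constant for the whole class: this is where uniform boundedness, on the
    compact support, is used. *)
Lemma form_bound K : compact K -> exists M, 0 <= M /\
  forall X p, Rc X p -> forall f e x, cc_on K f -> (forall s, K s -> `|f s| <= e) -> 0 <= e ->
  `|integrated_form mu p f x| <= M * e * `|x|.
Proof.
move=> cK; have [C [nu [C0 nu0 nuK Hp HU]]] := uniform_bounds.
have [M0 HM] := nuK _ cK; exists (C * `|M0| * fine (mu K)).
split; first by rewrite !mulr_ge0// fine_ge0.
move=> X p Rp f e x cf fe e0; rewrite integrated_formE.
apply: (le_trans (bochner_norm hG haar (c :=
  C * e * (`|M0| * `|x|)) (cc_form (Rc_cont Rp) x cf) _)).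
  move=> r Kr; apply: (le_trans (Hp _ _ Rp _ _)); rewrite ler_pM// ?mulr_ge0//.
    by rewrite ler_wpM2l// fe.
  apply: (le_trans (HU _ _ Rp _ _)); rewrite ler_wpM2r//.
  by rewrite (le_trans (HM _ Kr))// ler_norm.
by rewrite le_eqVlt; apply/orP; left; apply/eqP; ring.
Qed.

Lemma form_blin K f X p : Rc X p -> cc_on K f -> bounded_linear (integrated_form mu p f).
Proof.
move=> Rp cf; split; first exact: form_linear (Rc_cont Rp) _ _ cf.
have [M [M0 HM]] := form_bound (cc_compact cf).
have [e [e0 fe]] := cc_bounded cf.
by exists (M * e) => x; apply: (HM _ _ Rp) => // s _.
Qed.

Lemma sigma_ge K f X p x : Rc X p -> cc_on K f ->
  `|integrated_form mu p f x| <= sigma mu Rc f * `|x|.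
Proof.
move=> Rp cf; apply: (le_trans (opnorm_ge _ (form_blin Rp cf))).
rewrite ler_wpM2r//; apply: sup_upper_bound; last by exists X, p.
split; first by exists (opnorm (integrated_form mu p f)), X, p.
have [M [M0 HM]] := form_bound (cc_compact cf).
have [e [e0 fe]] := cc_bounded cf.
exists (M * e) => _ [X' [p' [Rp' ->]]]; apply: opnorm_le; first by rewrite mulr_ge0.
by move=> y; apply: (HM _ _ Rp') => // s _.
Qed.

Lemma sigma_le f c : 0 <= c ->
  (forall X p x, Rc X p -> `|integrated_form mu p f x| <= c * `|x|) ->
  sigma mu Rc f <= c.
Proof.
move=> c0 H; apply: ge_sup.
  have [[X [p Rp]] _ _] := ubR.
  by exists (opnorm (integrated_form mu p f)), X, p.
by move=> _ [X [p [Rp ->]]]; apply: opnorm_le => // x; exact: H.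
Qed.

Lemma sigma_ge0 K f : cc_on K f -> 0 <= sigma mu Rc f.
Proof.
move=> cf; have [[X [p Rp]] _ _] := ubR.
have H := opnorm_ge0 (form_blin Rp cf).
apply: (le_trans H); apply: sup_upper_bound; last by exists X, p.
split; first by exists (opnorm (integrated_form mu p f)), X, p.
have [M [M0 HM]] := form_bound (cc_compact cf).
have [e [e0 fe]] := cc_bounded cf.
exists (M * e) => _ [X' [p' [Rp' ->]]]; apply: opnorm_le; first by rewrite mulr_ge0.
by move=> y; apply: (HM _ _ Rp') => // s _.
Qed.

Lemma sigma_sup_bound K : compact K -> exists M, 0 <= M /\
  forall f e, cc_on K f -> 0 <= e -> (forall s, `|f s| <= e) -> sigma mu Rc f <= M * e.
Proof.
move=> /form_bound[M [M0 HM]]; exists M; split => // f e cf e0 fe.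
by apply: sigma_le; rewrite ?mulr_ge0// => X p x Rp; apply: (HM _ _ Rp).
Qed.

Lemma sigma_left_mul : exists C, 0 <= C /\ forall K a f, cc_on K f ->
  sigma mu Rc (left_mul_op a f) <= C * `|a| * sigma mu Rc f.
Proof.
have [C [nu [C0 nu0 nuK Hp HU]]] := uniform_bounds.
exists C; split => // K a f cf; apply: sigma_le.
  by rewrite !mulr_ge0//; exact: sigma_ge0 cf.
move=> X p x Rp; rewrite (form_left_mul (Rc_cont Rp) a x cf).
apply: (le_trans (Hp _ _ Rp _ _)); rewrite -[leRHS]mulrA ler_wpM2l ?mulr_ge0//.
exact: sigma_ge Rp cf.
Qed.

Lemma sigma_translation : exists nu : G -> R,
  [/\ forall r, 0 <= nu r,
    forall K, compact K -> exists M : R, forall r, K r -> nu r <= M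
  & forall K r f, cc_on K f ->
    sigma mu Rc (translation_op alpha r f) <= nu r * sigma mu Rc f].
Proof.
have [C [nu [C0 nu0 nuK Hp HU]]] := uniform_bounds.
exists nu; split => // K r f cf; apply: sigma_le.
  by rewrite !mulr_ge0//; exact: sigma_ge0 cf.
move=> X p x Rp; rewrite (form_translation (Rc_cont Rp) r x cf).
apply: (le_trans (HU _ _ Rp _ _)); rewrite -[leRHS]mulrA ler_wpM2l//.
exact: sigma_ge Rp cf.
Qed.

(** Unlike the bound by the supremum of phi, this one is stable when phi shrinks
    to a point mass, since only its integral enters; L stays fixed while the
    support K shrinks. *)
Lemma sigma_tensor L : compact L -> exists M, 0 <= M /\
  forall K (phi : G -> R^o) a, cc_on K phi -> K `<=` L -> (forall r, 0 <= phi r) ->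
    0 <= \int_(mu) phi ->
    sigma mu Rc (fun r => phi r *: a) <= M * `|a| * \int_(mu) phi.
Proof.
move=> cL; have [C [nu [C0 nu0 nuK Hp HU]]] := uniform_bounds.
have [M0 HM] := nuK _ cL; exists (C * `|M0|); split; first exact: mulr_ge0.
move=> K phi a cphi KL phi0 I0; apply: sigma_le; first by rewrite !mulr_ge0.
move=> X p x Rp; rewrite integrated_formE.
have E : form_integrand p (fun r => phi r *: a) x = fun r => phi r *: p.1 a (p.2 r x).
  apply/funext => r; rewrite /form_integrand.
  by rewrite (linZ (rep_linl (Rc_cont Rp) _)).
have := cc_form (Rc_cont Rp) x (cc_tensor a cphi); rewrite E => ck.
have := bochner_weighted hG haar (k0 := 0) (e := C * `|a| * (`|M0| * `|x|)) cphi ck phi0.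
rewrite scaler0 subr0 => H; apply: (le_trans (H _ _)).
- by rewrite !mulr_ge0.
- move=> r Kr; rewrite subr0; apply: (le_trans (Hp _ _ Rp _ _)); rewrite ler_wpM2l ?mulr_ge0//.
  apply: (le_trans (HU _ _ Rp _ _)); rewrite ler_wpM2r//.
  by rewrite (le_trans (HM _ (KL _ Kr)))// ler_norm.
- by rewrite le_eqVlt; apply/orP; left; apply/eqP; ring.
Qed.

End sigma.
End dynamics.

(** * Extension of representations to left centralizers *)

(** A positive approximate left identity bounded by M, in finite form: as a net
    it would be indexed by the pairs of a finite set and a tolerance. *)
Definition pos_left_approx {R : realType} {B : preorderedBanachAlgType R} (M : R) :=
  forall (s : seq B) (e : R), 0 < e ->
  exists u : B, [/\ pcone u, `|u| <= M & forall b, b \in s -> `|amul u b - b| <= e].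

Section centralizers.
Context {R : realType} {B : preorderedBanachAlgType R} {X : completeNormedModType R}.
Variables (M : R) (T : B -> X -> X).
Hypotheses (M0 : 0 <= M) (ali : @pos_left_approx R B M)
  (bT : bounded_alg_rep T) (ndT : nondegenerate_rep [set: B] T).

Let TM b c x : T (amul b c) x = T b (T c x). Proof. by have [[]] := bT. Qed.
Let Tlin b : linear (T b). Proof. by have [[/(_ b) []]] := bT. Qed.
Let Tlinl x : linear (T^~ x). Proof. by have [[_ /(_ x)]] := bT. Qed.

Lemma rep_bound : exists C, 0 <= C /\ forall b x, `|T b x| <= C * `|b| * `|x|.
Proof.
have [_ [C HC]] := bT; exists `|C|; split => // b x.
by apply: (le_trans (HC b x)); rewrite -!mulrA ler_wpM2r ?mulr_ge0// ler_norm.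
Qed.

Lemma lcent_linear (L : B -> B) : left_centralizer L -> linear L.
Proof. by move=> [[]]. Qed.

Let Q (j : seq (B * X)) := \sum_(p <- j) T p.1 p.2.

Lemma span_dense v (e : R) : 0 < e -> exists j, `|v - Q j| < e.
Proof.
move=> e0; have : closure (lin_span [set y | exists a x, [set: B] a /\ y = T a x]) v.
  by rewrite [X in X v]ndT.
move=> /closure_approx/(_ e0)[w [n [c [f [Hf ->]]]] vw].
have /choice[g Hg] : forall i, exists g : B * X, f i = T g.1 g.2.
  by move=> i; have [a [x [_ ->]]] := Hf i; exists (a, x).
exists [seq (c i *: (g i).1, (g i).2) | i <- index_enum 'I_n].
rewrite /Q big_map; move: vw; rewrite (eq_bigr (fun i => T (c i *: (g i).1) (g i).2))//.
by move=> i _; rewrite Hg (linZ (Tlinl _)).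
Qed.

Lemma span_eq (F H : X -> X) : bounded_linear F -> bounded_linear H ->
  (forall b x, F (T b x) = H (T b x)) -> forall v, F v = H v.
Proof.
move=> bF bH FH v; have [lF _] := bF; have [lH _] := bH.
have := closed_eq_fun (bounded_linear_continuous bF) (bounded_linear_continuous bH).
move=> /closure_id E; suff : [set v | F v = H v] v by [].
rewrite E; apply: approx_closure => e e0.
have [j vj] := span_dense v e0; exists (Q j); last exact: ltW.
rewrite /= /Q; elim: j {vj} => [|p j IH]; first by rewrite !big_nil (lin0 lF) (lin0 lH).
by rewrite !big_cons (linD lF) (linD lH) IH FH.
Qed.

Section one_centralizer.
Variables (L : B -> B) (l : R).
Hypotheses (cL : left_centralizer L) (l0 : 0 <= l) (Ll : forall b, `|L b| <= l * `|b|).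

Let QL (j : seq (B * X)) := \sum_(p <- j) T (L p.1) p.2.

(** T(L u) nearly acts on the span of the T(b)x as T(b)x |-> T(L b)x, because
    T(L u) T(b) = T(L (u b)). *)
Lemma lcent_near C u j (e : R) : 0 <= C -> (forall b x, `|T b x| <= C * `|b| * `|x|) ->
  (forall b, b \in [seq p.1 | p <- j] -> `|amul u b - b| <= e) ->
  `|QL j - T (L u) (Q j)| <= C * l * (\sum_(p <- j) `|p.2|) * e.
Proof.
move=> C0 HC; elim: j => [|p j IH] ue.
  by rewrite /QL /Q !big_nil (lin0 (Tlin _)) subrr normr0 mulr0 mul0r.
rewrite /QL /Q !big_cons (linD (Tlin _)) opprD addrACA.
apply: (le_trans (ler_normD _ _)).
rewrite mulrDr mulrDl; apply: lerD; last first.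
  by apply: IH => b bj; apply: ue; rewrite inE bj orbT.
rewrite -TM -cL.2 -(linB (Tlinl _)) -(linB (lcent_linear cL)).
apply: (le_trans (HC _ _)); rewrite -!mulrA ler_wpM2l// mulrA mulrC -[leRHS]mulrA mulrCA.
rewrite ler_wpM2l//; apply: (le_trans (Ll _)); rewrite ler_wpM2l// distrC.
by apply: ue; rewrite inE eqxx.
Qed.

(** The map T(b)x |-> T(L b)x is a limit of the operators T(L u), whose norms
    are bounded by that of L. *)
Lemma lcent_span_bound C j : 0 <= C -> (forall b x, `|T b x| <= C * `|b| * `|x|) ->
  `|QL j| <= C * l * M * `|Q j|.
Proof.
move=> C0 HC; apply: (@le_eps _ _ _ (C * l * (\sum_(p <- j) `|p.2|))) => e e0.
have [u [_ uM ue]] := ali [seq p.1 | p <- j] e0.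
rewrite -[QL j](subrK (T (L u) (Q j))) addrC; apply: (le_trans (ler_normD _ _)).
apply: lerD; last exact: lcent_near.
apply: (le_trans (HC _ _)); rewrite ler_wpM2r// -!mulrA ler_wpM2l//.
by apply: (le_trans (Ll _)); rewrite ler_wpM2l.
Qed.

Lemma lcent_extension C : 0 <= C -> (forall b x, `|T b x| <= C * `|b| * `|x|) ->
  exists S : X -> X, [/\ linear S,
    forall x, `|S x| <= C * l * M * `|x| & forall b x, S (T b x) = T (L b) x].
Proof.
move=> C0 HC.
have [||||S [lS bS SQ]] := @dense_extension _ X X _ setT Q QL (C * l * M).
- by rewrite !mulr_ge0.
- move=> c i j _ _; exists ([seq (c *: p.1, p.2) | p <- i] ++ j) => //.
  rewrite /Q /QL !big_cat !big_map /= !scaler_sumr; split; congr (_ + _).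
    by apply: eq_bigr => p _; rewrite (linZ (Tlinl _)).
  by apply: eq_bigr => p _; rewrite (linZ (lcent_linear cL)) (linZ (Tlinl _)).
- by move=> i _; exact: lcent_span_bound.
- by move=> v e /(span_dense v)[j vj]; exists j.
exists S; split => // b x; have := SQ [:: (b, x)] I.
by rewrite /Q /QL !big_seq1.
Qed.

End one_centralizer.

Lemma lambda_centralizer (b : B) : left_centralizer (amul b).
Proof. by split; [exact: amul_blinr|move=> a c; rewrite amulA]. Qed.

Lemma comb_centralizer (c : R) (L N : B -> B) : left_centralizer L ->
  left_centralizer N -> left_centralizer (fun b => c *: L b + N b).
Proof.
move=> [bL LM] [bN NM]; have [lL [C [C0 HC]]] := bounded_linear_pos bL.
have [lN [D [D0 HD]]] := bounded_linear_pos bN; split.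
  split.
    by move=> k x y; rewrite lL lN !scalerDr !scalerA (mulrC c) -!scalerA addrACA.
  exists (`|c| * C + D) => x; apply: (le_trans (ler_normD _ _)).
  by rewrite mulrDl lerD// normrZ -mulrA ler_wpM2l.
by move=> a b; rewrite LM NM amulDl amulZl.
Qed.

Lemma comp_centralizer (L N : B -> B) : left_centralizer L ->
  left_centralizer N -> left_centralizer (L \o N).
Proof.
move=> [bL LM] [bN NM]; split; first exact: comp_blin.
by move=> a b; rewrite /= NM LM.
Qed.

(** As L is a left centralizer, L composed with the left multiplication by b is
    the left multiplication by L b. *)
Lemma cent_ext_rep S L b x : is_centralizer_ext T S -> left_centralizer L ->
  S L (T b x) = T (L b) x.
Proof.
move=> [[bS SD SM] ST] cL; have cb := lambda_centralizer b.
rewrite -ST -SM// (_ : L \o amul b = amul (L b)) ?ST//.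
by apply/funext => c; rewrite /= cL.2.
Qed.

Lemma cent_ext_unique S L (S' : X -> X) : is_centralizer_ext T S -> left_centralizer L ->
  bounded_linear S' -> (forall b x, S' (T b x) = T (L b) x) -> S L = S'.
Proof.
move=> eS cL bS' H; apply/funext; apply: span_eq => //.
  by have [[+ _ _] _] := eS; exact.
by move=> b x; rewrite H cent_ext_rep.
Qed.

(** All extensions of T agree on left centralizers, so each inherits the bound
    of the one obtained from the dense span. *)
Lemma cent_ext_bound : exists C, 0 <= C /\ forall S L l x, is_centralizer_ext T S ->
  left_centralizer L -> 0 <= l -> (forall b, `|L b| <= l * `|b|) ->
  `|S L x| <= C * l * `|x|.
Proof.
have [C [C0 HC]] := rep_bound; exists (C * M); split; first exact: mulr_ge0.
move=> S L l x eS cL l0 Ll; have [S' [lS' bS' S'T]] := lcent_extension cL l0 Ll C0 HC.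
rewrite (cent_ext_unique eS cL (S' := S'))//; last by split => //; exists (C * l * M).
by rewrite (mulrAC C).
Qed.

Lemma centralizer_extP : is_centralizer_ext T (centralizer_ext T).
Proof.
have [C [C0 HC]] := rep_bound.
have H L : exists S : X -> X, left_centralizer L ->
    bounded_linear S /\ forall b x, S (T b x) = T (L b) x.
  have [cL|nL] := pselect (left_centralizer L); last by exists (fun=> 0).
  have [lL [l [l0 Ll]]] := bounded_linear_pos cL.1.
  have [S [lS bS ST]] := lcent_extension cL l0 Ll C0 HC.
  by exists S => _; split => //; split => //; exists (C * l * M).
have [S HS] := choice H.
suff eS : is_centralizer_ext T S by exact: (@xgetI _ _ [set S | is_centralizer_ext T S] S eS).
split; first split.
- by move=> L /HS[].
- move=> c L N x cL cN; have cLN := comb_centralizer c cL cN.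
  have [bL LT] := HS _ cL; have [bN NT] := HS _ cN; have [bLN LNT] := HS _ cLN.
  move: x; apply: span_eq => //.
    have [lL [D [D0 HD]]] := bounded_linear_pos bL.
    have [lN [E [E0 HE]]] := bounded_linear_pos bN; split.
      by move=> k x y; rewrite lL lN !scalerDr !scalerA (mulrC c) -!scalerA addrACA.
    exists (`|c| * D + E) => x; apply: (le_trans (ler_normD _ _)).
    by rewrite mulrDl lerD// normrZ -mulrA ler_wpM2l.
  by move=> b x; rewrite LNT LT NT (Tlinl x).
- move=> L N x cL cN; have cLN := comp_centralizer cL cN.
  have [bL LT] := HS _ cL; have [bN NT] := HS _ cN; have [bLN LNT] := HS _ cLN.
  move: x; apply: span_eq => //; first exact: comp_blin bL bN.
  by move=> b x; rewrite LNT /= NT LT.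
- move=> b; have [bS ST] := HS _ (lambda_centralizer b).
  apply/funext; apply: span_eq => //.
    by have [[]] := bT.
  by move=> c x; rewrite ST TM.
Qed.

End centralizers.

Section positive_centralizers.
Context {R : realType} {B : preorderedBanachAlgType R} {X : preorderedBanachType R}.
Variables (M : R) (T : B -> X -> X).
Hypotheses (M0 : 0 <= M) (ali : @pos_left_approx R B M)
  (clX : closed (pcone : set X)) (hT : pos_nondeg_bounded_rep B X T).

Let bT : bounded_alg_rep T. Proof. by case: hT. Qed.
Let ndT : nondegenerate_rep [set: B] T. Proof. by case: hT. Qed.

(** S L x is a limit of the vectors T(L u)x, which lie in the cone when u, L and
    T are positive. The element u is chosen after the finite combination that
    approximates x, because the error of T(L u) depends on it. *)
Lemma cent_ext_pos S L : is_centralizer_ext T S -> left_centralizer L ->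
  maps_cone L -> maps_cone (S L).
Proof.
move=> eS cL pL x px; have [_ _ pT] := hT.
have [C [C0 HC]] := rep_bound bT.
have [lL [l [l0 Ll]]] := bounded_linear_pos cL.1.
have [D [D0 HD]] := cent_ext_bound M0 ali bT ndT.
rewrite (closure_id pcone).1//; apply: approx_closure => e e0.
have bSL : bounded_linear (S L) by have [[+ _ _] _] := eS; exact.
have lS := bSL.1.
(* Norm bounds of S L and of T (L u), together. *)
set k := D * l + C * l * M + 1.
have k0 : 0 < k by rewrite ltr_wpDl// addr_ge0// !mulr_ge0.
have [|j xj] := span_dense bT ndT x (e := e / 2 / k); first by rewrite !divr_gt0.
(* The error of u is divided by the size of the combination j, which is known by
   now. *)
set n := C * l * (\sum_(p <- j) `|p.2|) + 1.
have n0 : 0 < n.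
  by rewrite ltr_wpDl// !mulr_ge0// sumr_ge0.
have [|u [pu uM ue]] := ali [seq p.1 | p <- j] (e := e / 2 / n); first by rewrite !divr_gt0.
exists (T (L u) x); first by apply: pT => //; exact: pL.
set y := \sum_(p <- j) T p.1 p.2 in xj.
have Sy : S L y = \sum_(p <- j) T (L p.1) p.2.
  rewrite /y; elim: (j) => [|p j' IH]; first by rewrite !big_nil (lin0 lS).
  by rewrite !big_cons (linD lS) IH (cent_ext_rep _ _ eS cL).
have -> : S L x - T (L u) x = S L (x - y) + (S L y - T (L u) y) + T (L u) (y - x).
  have [[/(_ (L u))[lTu _] _ _] _] := bT.
  by rewrite (linB lS) (linB lTu) subrKA addrA subrK.
have H1 : `|S L (x - y)| + `|T (L u) (y - x)| <= e / 2.
  apply: (@le_trans _ _ ((D * l + C * l * M) * `|x - y|)).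
    rewrite mulrDl; apply: lerD; first exact: HD.
    apply: (le_trans (HC _ _)); rewrite distrC ler_wpM2r// -mulrA ler_wpM2l//.
    by apply: (le_trans (Ll _)); rewrite ler_wpM2l.
  apply: (@le_trans _ _ (k * `|x - y|)); first by rewrite ler_wpM2r// lerDl.
  by rewrite mulrC -ler_pdivlMr// ltW.
have H2 : `|S L y - T (L u) y| <= e / 2.
  rewrite Sy; apply: (le_trans (lcent_near bT cL l0 Ll C0 HC ue)).
  apply: (@le_trans _ _ (n * (e / 2 / n))).
    by rewrite ler_wpM2r ?lerDl// !divr_ge0// ltW.
  by rewrite mulrC divfK// gt_eqF.
apply: (le_trans (ler_normD _ _)); apply: (le_trans (lerD (ler_normD _ _) (lexx _))).
by rewrite (splitr e) addrAC lerD.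
Qed.

Lemma centralizer_ext_pos_nondeg_bounded :
  pos_nondeg_bounded_centralizer_rep (centralizer_ext T).
Proof.
have eS := centralizer_extP M0 ali bT ndT.
have [D [D0 HD]] := cent_ext_bound M0 ali bT ndT.
split; first by case: eS.
- exists D => L x cL; apply: HD => //; first exact: opnorm_ge0 cL.1.
  by move=> b; exact: opnorm_ge cL.1.
- apply/seteqP; split => // x _;
  have : closure (lin_span [set y | exists a x, [set: B] a /\ y = T a x]) x.
    by rewrite [X in X x]ndT.
  apply: closureS => _ [n [c [w [Hw ->]]]]; exists n, c, w; split => // i.
  have [a [z [_ ->]]] := Hw i; exists (amul a), z; split; first exact: lambda_centralizer.
  by rewrite eS.2.
- by move=> L cL pL; exact: cent_ext_pos.
Qed.

End positive_centralizers.

(** * The crossed product and its canonical centralizers *)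

Section crossed_product.
Context {R : realType} {G : topologicalGroupType} {A : preorderedBanachAlgType R}.
Variable mu : {measure set (borelType G) -> \bar R}.
Hypotheses (hG : hausdorff_space G) (lG : locally_compact [set: G])
  (haar : left_haar mu).
Variable alpha : G -> A -> A.
Hypothesis dyn : dynamical_system alpha.
Variable Rc : rep_class R G A.
Arguments Rc : clear implicits.
Hypothesis ubR : uniformly_bounded_class alpha Rc.
Variables (B : preorderedBanachAlgType R) (q : (G -> A) -> B).
Hypothesis hq : is_crossed_product mu alpha Rc q.
Implicit Types (K L : set G) (f g : G -> A).

Lemma qlin c f g : Cc f -> Cc g -> q (fun s => c *: f s + g s) = c *: q f + q g.
Proof. by case: hq => + _ _ _ _; exact. Qed.

Lemma q_mul f g : Cc f -> Cc g -> q (convolution mu alpha f g) = amul (q f) (q g).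
Proof. by case: hq => _ + _ _ _; exact. Qed.

Lemma q_sigma K f : cc_on K f -> `|q f| = sigma mu Rc f.
Proof. by move=> /(cc_Cc hG) ?; case: hq => _ _ + _ _; exact. Qed.

Lemma Cc_comb c f g : Cc f -> Cc g -> Cc (fun s => c *: f s + g s).
Proof.
move=> /Cc_cc cf /Cc_cc cg; have [cK _ _] := cf; have [cL _ _] := cg.
have cKL := compactU cK cL.
apply: (cc_Cc hG (K := _ `|` _)); apply: cc_comb.
  by apply: (cc_widen cf cKL); left.
by apply: (cc_widen cg cKL); right.
Qed.

Lemma q0 : q (fun=> 0) = 0.
Proof.
have c0 : Cc (fun _ : G => 0 : A).
  by apply: (cc_Cc hG (K := set0)); split => // [|x]; [exact: compact0|exact: cvg_cst].
transitivity (-1 *: q (fun=> 0) + q (fun=> 0)); last by rewrite scaleN1r addNr.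
by rewrite -qlin//; congr q; apply/funext => s; rewrite scaler0 addr0.
Qed.

Lemma q_sub f g : Cc f -> Cc g -> q f - q g = q (fun s => (-1) *: g s + f s).
Proof. by move=> cf cg; rewrite qlin// scaleN1r addrC. Qed.

Lemma q_scale c f : Cc f -> q (fun s => c *: f s) = c *: q f.
Proof.
move=> cf; have c0 : Cc (fun _ : G => 0 : A).
  by apply: (cc_Cc hG (K := set0)); split => // [|x]; [exact: compact0|exact: cvg_cst].
have := qlin c cf c0; rewrite q0 addr0 => <-.
by congr q; apply/funext => s; rewrite addr0.
Qed.

(** Uniform convergence with supports in a fixed compact set implies convergence
    in the crossed product. *)
Lemma q_dist K : compact K -> exists M, 0 <= M /\ forall f g e, cc_on K f -> cc_on K g ->
  0 <= e -> (forall s, `|f s - g s| <= e) -> `|q f - q g| <= M * e.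
Proof.
move=> /(sigma_sup_bound hG haar ubR)[M [M0 HM]]; exists M; split => // f g e cf cg e0 fg.
rewrite q_sub; [|exact: cc_Cc cf|exact: cc_Cc cg].
have cfg := cc_comb (-1) cg cf.
rewrite (q_sigma cfg); apply: HM => // s; by rewrite scaleN1r addrC.
Qed.

Lemma q_left_mul_bound : exists C, 0 <= C /\ forall a f, Cc f ->
  `|q (left_mul_op a f)| <= C * `|a| * `|q f|.
Proof.
have [C [C0 HC]] := sigma_left_mul hG haar ubR; exists C; split => // a f /Cc_cc cf.
by rewrite (q_sigma (cc_left_mul a cf)) (q_sigma cf); exact: (HC _ _ _ cf).
Qed.

Lemma q_translation_bound : exists nu : G -> R,
  [/\ forall r, 0 <= nu r,
    forall K, compact K -> exists M : R, forall r, K r -> nu r <= M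
  & forall r f, Cc f -> `|q (translation_op alpha r f)| <= nu r * `|q f|].
Proof.
have [nu [nu0 nuK H]] := sigma_translation hG haar ubR; exists nu; split => // r f /Cc_cc cf.
by rewrite (q_sigma (cc_translation dyn r cf)) (q_sigma cf); exact: (H _ _ _ cf).
Qed.

Lemma q_dense b : closure [set q f | f in Cc] b.
Proof. by case: hq => _ _ _ -> _. Qed.

Lemma q_dense_eq (W : normedModType R) (F H : B -> W) : continuous F -> continuous H ->
  (forall f, Cc f -> F (q f) = H (q f)) -> F =1 H.
Proof.
move=> cF cH FH b; suff : [set b | F b = H b] b by [].
rewrite (closure_id [set b | F b = H b]).1; last exact: closed_eq_fun.
by apply: closureS (@q_dense b) => _ [f cf <-]; exact: FH.
Qed.

Lemma left_mul_Cc a f : Cc f -> Cc (left_mul_op a f).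
Proof. by move=> /Cc_cc/(cc_left_mul a)/(cc_Cc hG). Qed.

Lemma translation_Cc r f : Cc f -> Cc (translation_op alpha r f).
Proof. by move=> /Cc_cc/(cc_translation dyn r)/(cc_Cc hG). Qed.

Lemma convolution_Cc f g : Cc f -> Cc g -> Cc (convolution mu alpha f g).
Proof. by move=> /Cc_cc cf /Cc_cc cg;
  exact: (cc_Cc hG (cc_convolution hG lG haar dyn cf cg)). Qed.

Lemma q_translation_continuous f : Cc f -> continuous (fun r => q (translation_op alpha r f)).
Proof.
move=> /Cc_cc cf r0; have [cK _ _] := cf; have [C [nC cC _]] := compact_nbhs lG r0.
have cCK := compact_mul cC cK.
have [M [M0 HM]] := q_dist cCK.
have M1 : 0 < M + 1 by rewrite ltr_wpDl.
have H r : C r -> cc_on [set (x * y)%g | x in C & y in closure [set s | f s != 0]]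
  (translation_op alpha r f).
  move=> Cr; apply: (cc_widen (cc_translation dyn r cf) cCK) => _ [y Ky <-].
  by exists r => //; exists y.
apply/cvgrPdist_le => e e0.
have d0 : 0 < e / (M + 1) by rewrite divr_gt0.
have Cr0 := nbhs_singleton nC.
apply: filterS2 nC (translation_near lG dyn r0 cf d0) => r Cr fr.
apply: (le_trans (HM _ _ _ (H _ Cr0) (H _ Cr) (ltW d0) _)).
  by move=> s; rewrite distrC.
by rewrite mulrCA ler_piMr ?(ltW e0)// ler_pdivrMr// mul1r lerDl.
Qed.

Lemma q_sum K n (w : 'I_n -> R) (h : 'I_n -> G -> A) : compact K ->
  (forall i, cc_on K (h i)) ->
  cc_on K (fun s => \sum_(i < n) w i *: h i s) /\
  q (fun s => \sum_(i < n) w i *: h i s) = \sum_(i < n) w i *: q (h i).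
Proof.
move=> cK; elim: n w h => [|n IH] w h ch.
  under eq_fun do rewrite big_ord0.
  by rewrite big_ord0 q0; split => //; split => // x; exact: cvg_cst.
under eq_fun do rewrite big_ord_recl.
have [c1 q1] := IH (fun i => w (lift ord0 i)) (fun i => h (lift ord0 i)) (fun i => ch _).
split; first exact: cc_comb.
by rewrite qlin; [rewrite q1 big_ord_recl|exact: cc_Cc (ch _)|exact: cc_Cc c1].
Qed.

Lemma cc_q_kernel K L f g : cc_on K f -> cc_on L g ->
  cc_on K (fun r => q (conv_kernel alpha f g r)).
Proof.
move=> cf cg; have [k0 k1] := conv_kernel_supp dyn cf cg.
have [cK cont_f f0] := cf; have [cL cont_g g0] := cg.
have cKL := compact_mul cK cL.
have ck r : cc_on [set (x * y)%g | x in K & y in L] (conv_kernel alpha f g r).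
  split => // [s|s]; last exact: k0.
  by have [_ + _] := cc_left_mul (f r) (cc_translation dyn r cg); exact.
split => //; last first.
  by move=> r Kr; rewrite (_ : conv_kernel _ _ _ _ = fun=> 0) ?q0//; apply/funext => s; exact: k1.
have [M [M0 HM]] := q_dist cKL.
have M1 : 0 < M + 1 by rewrite ltr_wpDl.
move=> r0; apply/cvgrPdist_le => e e0.
have d0 : 0 < e / (M + 1) by rewrite divr_gt0.
have := conv_kernel_near lG dyn r0 cf cg d0; apply: filterS => r fr.
apply: (le_trans (HM _ _ _ (ck _) (ck _) (ltW d0) _)).
  by move=> s; rewrite distrC.
by rewrite mulrCA ler_piMr ?(ltW e0)// ler_pdivrMr// mul1r lerDl.
Qed.

(** The product of B as an integral in B. Both sides are compared with the same
    Riemann sum: the convolution uniformly on a fixed compact set, hence after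
    applying q, and the right hand side directly. *)
Lemma q_convolution K L f g : cc_on K f -> cc_on L g ->
  amul (q f) (q g) = \int_(mu) (fun r => q (conv_kernel alpha f g r)).
Proof.
move=> cf cg; have [cK cont_f f0] := cf; have [cL cont_g g0] := cg.
rewrite -q_mul; [|exact: (cc_Cc hG cf)|exact: (cc_Cc hG cg)].
have [k0 k1] := conv_kernel_supp dyn cf cg.
have cKL := compact_mul cK cL.
have ck r : cc_on [set (x * y)%g | x in K & y in L] (conv_kernel alpha f g r).
  split => // [s|s]; last exact: k0.
  by have [_ + _] := cc_left_mul (f r) (cc_translation dyn r cg); exact.
have [M [M0 HM]] := q_dist cKL.
apply/eqP; rewrite -subr_eq0; apply/eqP.
apply: (@le_eps_eq0 _ _ _ (2 * (M * fine (mu K)))) => e e0.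
have [t _|n [w [t [w0 Kt H _]]]] := riemann_sums hG haar
  (V := fun t => [set r | forall s, `|conv_kernel alpha f g r s - conv_kernel alpha f g t s| <=
    e]) cK.
  by have := conv_kernel_near lG dyn t cf cg e0; apply: filterS => r; exact.
have H1 s : `|convolution mu alpha f g s - \sum_(i < n) w i *: conv_kernel alpha f g (t i) s|
  <= e * fine (mu K).
  rewrite convolutionE; apply: (H _ _ _ (cc_conv_kernel lG dyn s cf cg)) => u r _ _; exact.
have H2 : `|\int_(mu) (fun r => q (conv_kernel alpha f g r)) - \sum_(i < n) w i *: q
  (conv_kernel alpha f g (t i))| <= M * e * fine (mu K).
  apply: (H _ _ _ (cc_q_kernel cf cg)) => u r _ _ ur.
  by apply: HM => //; exact: ltW.
have [cs qs] := q_sum w cKL (fun i => ck (t i)).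
rewrite -(subrKA (q (fun s => \sum_(i < n) w i *: conv_kernel alpha f g (t i) s))).
apply: (le_trans (ler_normD _ _)).
have -> : 2 * (M * fine (mu K)) * e = M * (e * fine (mu K)) + M * e * fine (mu K) by ring.
apply: lerD; last by rewrite distrC qs.
apply: HM => //; first exact: (cc_convolution hG lG haar dyn cf cg).
by rewrite mulr_ge0 ?fine_ge0// ltW.
Qed.

Lemma q_extend (Y : completeNormedModType R) (phi : (G -> A) -> Y) C : 0 <= C ->
  (forall c f g, Cc f -> Cc g -> phi (fun s => c *: f s + g s) = c *: phi f + phi g) ->
  (forall f, Cc f -> `|phi f| <= C * `|q f|) ->
  exists psi : B -> Y, [/\ linear psi,
    forall b, `|psi b| <= C * `|b| & forall f, Cc f -> psi (q f) = phi f].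
Proof.
move=> C0 lphi bphi; apply: (@dense_extension _ B Y (G -> A) Cc q phi C) => //.
- move=> c f g cf cg; exists (fun s => c *: f s + g s); first exact: Cc_comb.
  by rewrite qlin// lphi.
- move=> b e e0; have [_ [f cf <-] bf] := closure_approx (@q_dense b) e0.
  by exists f.
Qed.

(** By density there is one bounded operator induced by S, so the choice in the
    definition is harmless. *)
Lemma induced_opP (S : (G -> A) -> (G -> A)) C : 0 <= C ->
  (forall f, Cc f -> Cc (S f)) ->
  (forall c f g, S (fun s => c *: f s + g s) = fun s => c *: S f s + S g s) ->
  (forall f, Cc f -> `|q (S f)| <= C * `|q f|) ->
  [/\ bounded_linear (induced_op q S), forall b, `|induced_op q S b| <= C * `|b|
   & forall f, Cc f -> induced_op q S (q f) = q (S f)].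
Proof.
move=> C0 SC Sl Sb; have [|L [lL bL Lq]] := q_extend (phi := q \o S) C0 _ Sb.
  by move=> c f g cf cg; rewrite /= Sl qlin//; exact: SC.
have blL : bounded_linear L by split => //; exists C.
have [bI Iq] := @xgetI _ (fun=> 0) [set L : B -> B | bounded_linear L /\ forall f, Cc f ->
  L (q f) = q (S f)] L (conj blL Lq).
have -> : induced_op q S = L.
  apply/funext; apply: q_dense_eq;
    [exact: bounded_linear_continuous|exact: bounded_linear_continuous|].
  by move=> f cf; rewrite Lq//; exact: Iq.
by split.
Qed.

(** The canonical image of a in the left centralizers of the crossed product. *)
Definition iA a := induced_op q (left_mul_op a).
(** The canonical image of r in the left centralizers of the crossed product. *)
Definition iG r := induced_op q (translation_op alpha r).

Lemma iAP : exists C, 0 <= C /\ forall a, [/\ bounded_linear (iA a),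
  forall b, `|iA a b| <= C * `|a| * `|b| & forall f, Cc f -> iA a (q f) = q (left_mul_op a f)].
Proof.
have [C [C0 HC]] := q_left_mul_bound; exists C; split => // a.
apply: induced_opP; first by rewrite mulr_ge0.
- exact: left_mul_Cc.
- by move=> c f g; apply/funext => s; rewrite /left_mul_op amul_linr.
- by move=> f cf; exact: HC.
Qed.

Lemma iGP : exists nu : G -> R,
  [/\ forall r, 0 <= nu r, forall K, compact K -> exists M : R, forall r, K r -> nu r <= M
  & forall r, [/\ bounded_linear (iG r),
  forall b, `|iG r b| <= nu r * `|b| & forall f, Cc f ->
    iG r (q f) = q (translation_op alpha r f)]].
Proof.
have [nu [nu0 nuK H]] := q_translation_bound; exists nu; split => // r.
apply: induced_opP => //.
- exact: translation_Cc.
- by move=> c f g; apply/funext => s; rewrite /translation_op (alpha_blin dyn r).1.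
- by move=> f cf; exact: H.
Qed.

Lemma iA_q a f : Cc f -> iA a (q f) = q (left_mul_op a f).
Proof. by have [C [_ /(_ a)[_ _ H]]] := iAP; exact: H. Qed.

Lemma iG_q r f : Cc f -> iG r (q f) = q (translation_op alpha r f).
Proof. by have [nu [_ _ /(_ r)[_ _ H]]] := iGP; exact: H. Qed.

Lemma iA_blin a : bounded_linear (iA a).
Proof. by have [C [_ /(_ a)[]]] := iAP. Qed.

Lemma iG_blin r : bounded_linear (iG r).
Proof. by have [nu [_ _ /(_ r)[]]] := iGP. Qed.

(** The identity of a centralizer is continuous in each variable, hence only has
    to hold on the image of q. *)
Lemma centralizer_dense (L : B -> B) : bounded_linear L ->
  (forall f g, Cc f -> Cc g -> L (amul (q f) (q g)) = amul (L (q f)) (q g)) ->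
  left_centralizer L.
Proof.
move=> bL H; split => // a b; move: b.
apply: q_dense_eq.
- exact: bounded_linear_continuous (comp_blin bL (amul_blinr a)).
- exact: bounded_linear_continuous (amul_blinr _).
move=> g cg; move: a; apply: q_dense_eq.
- exact: bounded_linear_continuous (comp_blin bL (amul_blinl _)).
- exact: bounded_linear_continuous (comp_blin (amul_blinl _) bL).
by move=> f cf; exact: H.
Qed.

Lemma iA_centralizer a : left_centralizer (iA a).
Proof.
apply: centralizer_dense; first exact: iA_blin.
move=> f g cf cg; rewrite -q_mul// iA_q; last exact: convolution_Cc.
rewrite iA_q// -q_mul//; last exact: left_mul_Cc.
by rewrite (convolution_left_mul hG lG haar dyn a (Cc_cc cf) (Cc_cc cg)).
Qed.

Lemma iG_centralizer r : left_centralizer (iG r).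
Proof.
apply: centralizer_dense; first exact: iG_blin.
move=> f g cf cg; rewrite -q_mul// iG_q; last exact: convolution_Cc.
rewrite iG_q// -q_mul//; last exact: translation_Cc.
by rewrite (convolution_translation hG lG haar dyn r (Cc_cc cf) (Cc_cc cg)).
Qed.

Lemma blin_dense_eq (F H : B -> B) : bounded_linear F -> bounded_linear H ->
  (forall f, Cc f -> F (q f) = H (q f)) -> F = H.
Proof.
by move=> bF bH FH; apply/funext; apply: q_dense_eq => //; exact: bounded_linear_continuous.
Qed.

Lemma iA_comb c a a' : iA (c *: a + a') = fun b => c *: iA a b + iA a' b.
Proof.
apply: blin_dense_eq; first exact: iA_blin.
  by have [] := comb_centralizer c (iA_centralizer a) (iA_centralizer a').
move=> f cf; rewrite !iA_q// -qlin; [|exact: left_mul_Cc|exact: left_mul_Cc].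
by congr q; apply/funext => s; rewrite /left_mul_op amul_linl.
Qed.

Lemma iA_mul a a' : iA (amul a a') = iA a \o iA a'.
Proof.
apply: blin_dense_eq; first exact: iA_blin.
  exact: comp_blin (iA_blin _) (iA_blin _).
move=> f cf; rewrite /= !iA_q//; last exact: left_mul_Cc.
by congr q; apply/funext => s; rewrite /left_mul_op amulA.
Qed.

Lemma iG_mul r s : iG (r * s)%g = iG r \o iG s.
Proof.
apply: blin_dense_eq; first exact: iG_blin.
  exact: comp_blin (iG_blin _) (iG_blin _).
move=> f cf; rewrite /= !iG_q//; last exact: translation_Cc.
by congr q; apply/funext => t; rewrite /translation_op (alphaA dyn) invgM mulgA.
Qed.

Lemma iG_1 : iG 1%g = id.
Proof.
apply: blin_dense_eq; first exact: iG_blin.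
  by split => //; exists 1 => x; rewrite mul1r.
move=> f cf; rewrite iG_q//; congr q; apply/funext => t.
by rewrite /translation_op (alpha1 dyn) invg1 mul1g.
Qed.

Lemma iA_covariant s a : iA (alpha s a) = iG s \o iA a \o iG s^-1%g.
Proof.
apply: blin_dense_eq; first exact: iA_blin.
  exact: comp_blin (comp_blin (iG_blin _) (iA_blin _)) (iG_blin _).
move=> f cf; have cf' := translation_Cc s^-1%g cf.
rewrite /= [in RHS]iG_q// !iA_q// iG_q; last exact: left_mul_Cc.
congr q; apply/funext => t; rewrite /translation_op /left_mul_op (alphaM dyn).
by rewrite -(alphaA dyn) mulgV (alpha1 dyn) invgK mulVKg.
Qed.

Lemma q_cone : (pcone : set B) = closure [set q f | f in Cc_pos].
Proof. by case: hq. Qed.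

(** The cone of B is the closure of the image of the positive functions. *)
Lemma blin_pos (L : B -> B) : bounded_linear L ->
  (forall f, Cc_pos f -> pcone (L (q f))) -> maps_cone L.
Proof.
move=> bL H; have cL := bounded_linear_continuous bL.
have clB : closed (pcone : set B) by rewrite q_cone; exact: closed_closure.
have clL : closed (L @^-1` pcone) by apply: preimage_closed => // x _; exact: cL.
move=> b; rewrite {1}q_cone => Hb; suff : (L @^-1` pcone) b by [].
rewrite (closure_id (L @^-1` pcone)).1//; apply: closureS Hb => _ [f cf <-].
exact: H.
Qed.

Lemma q_pos f : Cc_pos f -> pcone (q f).
Proof. by move=> cf; rewrite q_cone; apply: subset_closure; exists f. Qed.

Lemma iA_pos a : pcone a -> maps_cone (iA a).
Proof.
move=> pa; apply: blin_pos; first exact: iA_blin.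
move=> f [cf pf]; rewrite iA_q//; apply: q_pos; split; first exact: left_mul_Cc.
by move=> s; exact: pconeM.
Qed.

Lemma iG_pos r : maps_cone (iG r).
Proof.
apply: blin_pos; first exact: iG_blin.
move=> f [cf pf]; rewrite iG_q//; apply: q_pos; split; first exact: translation_Cc.
by move=> s; exact: (alpha_pos dyn).
Qed.

(** * A positive bounded approximate left identity *)

Section approximate_identity.
Variables (I : Type) (le : I -> I -> Prop) (u : I -> A) (MA : R).
Hypotheses (le_refl : forall i, le i i) (le_trans' : forall i j k, le i j -> le j k -> le i k)
  (le_dir : forall i j, exists k, le i k /\ le j k) (i00 : inhabited I)
  (uid : forall a (eps : R), 0 < eps -> exists i0, forall i, le i0 i -> `|amul (u i) a - a| < eps)
  (uM : forall i, `|u i| <= MA) (upos : forall i, pcone (u i)).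

Lemma directed_seq (T : eqType) (s : seq T) (P : T -> I -> Prop) :
  (forall t, t \in s -> exists i0, forall i, le i0 i -> P t i) ->
  exists i0, forall i, le i0 i -> forall t, t \in s -> P t i.
Proof.
elim: s => [|t s IH] H; first by case: i00 => i; exists i => j _ t; rewrite in_nil.
have [i1 H1] := H t (mem_head _ _).
have [|i2 H2] := IH; first by move=> t' t's; apply: H; rewrite inE t's orbT.
have [k [k1 k2]] := le_dir i1 i2; exists k => i ki t'; rewrite inE => /orP[/eqP ->|t's].
  by apply: H1; exact: le_trans' ki.
by apply: H2 => //; exact: le_trans' ki.
Qed.

Lemma MA_ge0 : 0 <= MA.
Proof. by case: i00 => i; exact: le_trans (uM i). Qed.

(** The range of g is covered by finitely many small balls, and the approximate
    identity is bounded, so its convergence on the centres is convergence on the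
    range. *)
Lemma unif_approx_id K g (e : R) : cc_on K g -> 0 < e ->
  exists i0, forall i, le i0 i -> forall s, `|left_mul_op (u i) g s - g s| <= e.
Proof.
move=> cg e0; have [cK _ g0] := cg.
set d := e / (MA + 2).
have M2 : 0 < MA + 2 by rewrite ltr_wpDl// MA_ge0.
have d0 : 0 < d by rewrite divr_gt0.
have [t _|n [E [t [_ EV _ cov]]]] := fine_partition hG (V :=
  fun t => [set r | `|g r - g t| <= d]) cK.
  exact: cc_near cg d0.
have [|i0 Hi0] := @directed_seq 'I_n (enum 'I_n)
  (fun k i => `|amul (u i) (g (t k)) - g (t k)| <= d).
  by move=> k _; have [i0 Hi0] := uid (g (t k)) d0; exists i0 => i /Hi0/ltW.
exists i0 => i ii s; rewrite /left_mul_op.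
have [Ks|nK] := pselect (K s); last first.
  by rewrite g0// (lin0 (amul_linr _)) subrr normr0 ltW.
have [k [Ek _]] := cov _ Ks; have [_ /= gs] := EV _ _ Ek.
have -> : amul (u i) (g s) - g s =
  amul (u i) (g s - g (t k)) + (amul (u i) (g (t k)) - g (t k)) + (g (t k) - g s).
  by rewrite (linB (amul_linr _)) subrKA addrA subrK.
have -> : e = MA * d + d + d.
  by rewrite /d; field; rewrite gt_eqF.
apply: (le_trans (ler_normD _ _)); rewrite (distrC (g (t k))) lerD//.
apply: (le_trans (ler_normD _ _)); rewrite lerD//; last by apply: Hi0 => //; rewrite mem_enum.
by apply: (le_trans (normaM_le _ _)); rewrite ler_pM.
Qed.

(** Used twice: for the approximate identity of B, and for the non-degeneracy of
    the disintegrated pi, as T(q f) is then a limit of pi(u_i) T(q f). *)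
Lemma q_left_mul_approx g (e : R) : Cc g -> 0 < e ->
  exists i0, forall i, le i0 i -> `|q (left_mul_op (u i) g) - q g| <= e.
Proof.
move=> /Cc_cc cg e0; have [cK _ _] := cg; have [M [M0 HM]] := q_dist cK.
have M1 : 0 < M + 1 by rewrite ltr_wpDl.
have d0 : 0 < e / (M + 1) by rewrite divr_gt0.
have [i0 Hi0] := unif_approx_id cg d0; exists i0 => i /Hi0 H.
apply: (le_trans (HM _ _ _ (cc_left_mul _ cg) cg (ltW d0) H)).
by rewrite mulrCA ler_piMr ?(ltW e0)// ler_pdivrMr// mul1r lerDl.
Qed.

Lemma near_seq (T : eqType) (U : Type) (F : set_system U) (FF : Filter F) (s : seq T)
    (P : T -> U -> Prop) : (forall t, t \in s -> \forall r \near F, P t r) ->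
  \forall r \near F, forall t, t \in s -> P t r.
Proof.
elim: s => [|t s IH] H; first by apply: filterE => r t; rewrite in_nil.
have H1 := H t (mem_head _ _).
have H2 := IH (fun t' t's => H t' (@mem_behead _ (t :: s) t' t's)).
apply: filterS2 H1 H2 => r H1 H2 t'; rewrite inE => /orP[/eqP ->//|]; exact: H2.
Qed.

(** The element v is phi(.) a / (integral of phi), where a belongs to the
    approximate identity of A and phi is a bump near 1. By the convolution
    formula v (q g) is a weighted mean of the q (a alpha_r(g(r^-1 .))) over r
    near 1: this is close to q (a g) by continuity of translation, and then to q
    g. *)
Lemma crossed_left_approx_Cc : exists M, 0 <= M /\ forall (s : seq (G -> A)) (e : R),
  (forall g, g \in s -> Cc g) -> 0 < e ->
  exists v : B, [/\ pcone v, `|v| <= M & forall g, g \in s -> `|amul v (q g) - q g| <= e].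
Proof.
have [L [nL cL _]] := compact_nbhs lG 1%g.
have [M [M0 HM]] := sigma_tensor hG haar ubR cL.
have MA0 := MA_ge0.
exists (M * MA); split; first exact: mulr_ge0.
move=> s e sC e0.
have [C [C0 HC]] := q_left_mul_bound.
set d := e / (C * MA + 1).
have C1 : 0 < C * MA + 1 by rewrite ltr_wpDl// mulr_ge0.
have d0 : 0 < d by rewrite divr_gt0.
have [i0 /(_ i0 (le_refl i0)) Hi0] :=
  @directed_seq (G -> A) s (fun g i => `|q (left_mul_op (u i) g) - q g| <= d)
  (fun g gs => q_left_mul_approx (sC g gs) d0).
set a := u i0 in Hi0.
have nV : \forall r \near (1%g : G), forall g, g \in s ->
  `|q (translation_op alpha r g) - q g| <= d.
  apply: near_seq => g gs; have := q_translation_continuous (sC _ gs) (x := 1%g).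
  have E : translation_op alpha 1%g g = g.
    by apply/funext => t; rewrite /translation_op (alpha1 dyn) invg1 mul1g.
  by move=> /cvgrPdistC_le/(_ _ d0); apply: filterS => r; rewrite E.
have [K [phi [KV cphi phi0 Iphi]]] := bump hG lG haar (filterI nL nV).
set c := \int_(mu) phi in Iphi.
have cT := cc_tensor a cphi; have CT := cc_Cc hG cT.
exists (c^-1 *: q (fun r => phi r *: a)); split.
- apply: pconeZ; first by rewrite invr_ge0 ltW.
  by apply: q_pos; split => // r; apply: pconeZ; [exact: phi0|exact: upos].
- rewrite normrZ ger0_norm ?invr_ge0 ?(ltW Iphi)// mulrC ler_pdivrMr//.
  rewrite (q_sigma cT); apply: (le_trans (HM _ _ a cphi _ phi0 (ltW Iphi))).
    by move=> r /KV[].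
  by rewrite ler_wpM2r ?(ltW Iphi)// ler_wpM2l// uM.
- move=> g gs; have cg := Cc_cc (sC _ gs).
  rewrite amulZl (q_convolution cT cg).
  have E r : q (conv_kernel alpha
    (fun r => phi r *: a) g r) = phi r *: q (left_mul_op a (translation_op alpha r g)).
    rewrite -q_scale; last by apply: left_mul_Cc; exact/translation_Cc/sC.
    by congr q; apply/funext => t; rewrite /conv_kernel /left_mul_op amulZl.
  have ck := cc_q_kernel cT cg.
  have EE : (fun r => q (conv_kernel alpha (fun r => phi r *: a) g r)) =
     fun r => phi r *: q (left_mul_op a (translation_op alpha r g)).
    by apply/funext.
  rewrite EE in ck; rewrite EE.
  have -> : q g = c^-1 *: (c *: q g) by rewrite scalerA mulVf ?scale1r// gt_eqF.
  rewrite -scalerBr normrZ ger0_norm ?invr_ge0 ?(ltW Iphi)// ler_pdivrMl//.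
  apply: (bochner_weighted hG haar cphi ck phi0 (ltW e0)) => r Kr.
  have -> : e = C * MA * d + d by rewrite /d; field; rewrite gt_eqF.
  rewrite -(subrKA (q (left_mul_op a g))); apply: (le_trans (ler_normD _ _)).
  apply: lerD; last exact: Hi0.
  have Ctr := translation_Cc r (sC _ gs).
  rewrite -!(iA_q a)//; last exact: sC.
  rewrite -(linB (iA_blin a).1) q_sub//; last exact: sC.
  rewrite iA_q; last by apply: Cc_comb => //; exact: sC.
  apply: (le_trans (HC _ _ _)); first by apply: Cc_comb => //; exact: sC.
  rewrite -q_sub//; last exact: sC.
  rewrite ler_pM ?mulr_ge0//; first by rewrite ler_wpM2l// uM.
  by have [_] := KV _ Kr; exact.
Qed.

(** Boundedness carries the approximation over from the dense image of q. *)
Lemma crossed_left_approx : exists M, 0 <= M /\ @pos_left_approx R B M.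
Proof.
have [M [M0 HM]] := crossed_left_approx_Cc; exists M; split => // s e e0.
set d := e / (M + 2).
have M2 : 0 < M + 2 by rewrite ltr_wpDl.
have d0 : 0 < d by rewrite divr_gt0.
have /choice[g Hg] : forall b, exists g, Cc g /\ `|b - q g| < d.
  by move=> b; have [_ [g cg <-] bg] := closure_approx (@q_dense b) d0; exists g.
have [|v [pv vM Hv]] := HM [seq g b | b <- s] d _ d0.
  by move=> _ /mapP[b _ ->]; exact: (Hg b).1.
exists v; split => // b bs.
have -> : amul v b - b = amul v (b - q (g b)) + (amul v (q (g b)) - q (g b)) + (q (g b) - b).
  by rewrite (linB (amul_linr _)) subrKA addrA subrK.
have -> : e = M * d + d + d by rewrite /d; field; rewrite gt_eqF.
apply: (le_trans (ler_normD _ _)); rewrite (distrC (q (g b))) lerD ?(ltW (Hg b).2)//.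
apply: (le_trans (ler_normD _ _)); rewrite lerD//; last by apply: Hv; exact: map_f.
apply: (le_trans (normaM_le _ _)); rewrite ler_pM//; exact: ltW (Hg b).2.
Qed.

End approximate_identity.
End crossed_product.

(** * From representations of the crossed product and back *)

Section correspondence.
Context {R : realType} {G : topologicalGroupType} {A : preorderedBanachAlgType R}.
Variable mu : {measure set (borelType G) -> \bar R}.
Hypotheses (hG : hausdorff_space G) (lG : locally_compact [set: G])
  (haar : left_haar mu).
Variable alpha : G -> A -> A.
Hypothesis dyn : dynamical_system alpha.
Variable Rc : rep_class R G A.
Arguments Rc : clear implicits.
Hypothesis ubR : uniformly_bounded_class alpha Rc.
Variables (B : preorderedBanachAlgType R) (q : (G -> A) -> B).
Hypothesis hq : is_crossed_product mu alpha Rc q.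
Implicit Types (K L : set G) (f g : G -> A).
Variable X : preorderedBanachType R.
Hypothesis clX : closed (pcone : set X).

Let dense_eq (W : normedModType R) (F H : B -> W) : continuous F -> continuous H ->
  (forall f, Cc f -> F (q f) = H (q f)) -> F =1 H := q_dense_eq hq (F := F) (H := H).

Lemma opmap_blinl (S : B -> X -> X) x : bounded_opmap S -> bounded_linear (fun b => S b x).
Proof.
move=> [_ lS [C HC]]; split => //; exists (C * `|x|) => b.
by rewrite mulrAC; exact: HC.
Qed.

(** Bounded maps on B are determined on the image of q, so the chosen extension
    is any extension. *)
Lemma induced_rep_unique (T : (G -> A) -> X -> X) (S : B -> X -> X) : bounded_opmap S ->
  (forall f, Cc f -> S (q f) = T f) -> induced_rep q T = S.
Proof.
move=> bS ST.
have [bI IT] := @xgetI _ (fun _ _ => 0) [set S : B -> X ->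
  X | bounded_opmap S /\ forall f, Cc f -> S (q f) = T f] S (conj bS ST).
apply/funext => b; apply/funext => x; move: b; apply: dense_eq.
- exact: (bounded_linear_continuous (opmap_blinl x bI)).
- exact: (bounded_linear_continuous (opmap_blinl x bS)).
- by move=> f cf; rewrite ST// -IT.
Qed.

Lemma integrated_repP p : class_continuous mu alpha Rc (X := X) p ->
  bounded_opmap (integrated_rep mu q p) /\
  forall f, Cc f -> integrated_rep mu q p (q f) = integrated_form mu p f.
Proof.
move=> [cp [C HC]].
have HC' f x : Cc f -> `|integrated_form mu p f x| <= `|C| * `|x| * `|q f|.
  move=> cf; apply: (le_trans (HC _ _ cf)); rewrite -(q_sigma hG hq (Cc_cc cf)).
  by rewrite mulrAC ler_wpM2r// ler_wpM2r// ler_norm.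
have /choice[psi Hpsi] : forall x, exists psi : B -> X, [/\ linear psi,
    forall b, `|psi b| <= `|C| * `|x| * `|b|
    & forall f, Cc f -> psi (q f) = integrated_form mu p f x].
  move=> x; apply: (q_extend hG hq (phi := fun f => integrated_form mu p f x)).
  - by rewrite mulr_ge0.
  - move=> c f g cf cg; have [cK _ _] := Cc_cc cf; have [cL _ _] := Cc_cc cg.
    have cKL := compactU cK cL.
    apply: (form_comb hG haar cp c x (K := _ `|` _)).
      by apply: (cc_widen (Cc_cc cf) cKL); left.
    by apply: (cc_widen (Cc_cc cg) cKL); right.
  - by move=> f cf; exact: HC'.
pose S b x := psi x b.
have bpsi x : bounded_linear (psi x).
  by have [lp bp _] := Hpsi x; split => //; exists (`|C| * `|x|).
have bS : bounded_opmap S.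
  split.
  - move=> b; split.
      move=> c x y; rewrite /S; move: b; apply: dense_eq.
      + exact: (bounded_linear_continuous (bpsi _)).
      + move=> b; apply: cvgD; first apply: cvgZr.
          exact: (bounded_linear_continuous (bpsi x)).
        exact: (bounded_linear_continuous (bpsi y)).
      move=> f cf; have [_ _ ->//] := Hpsi (c *: x + y).
      have [_ _ ->//] := Hpsi x; have [_ _ ->//] := Hpsi y.
      exact: (form_linear hG haar cp (Cc_cc cf)).
    by exists (`|C| * `|b|) => x; rewrite mulrAC; have [_ + _] := Hpsi x; exact.
  - by move=> x; have [] := Hpsi x.
  - by exists `|C| => b x; rewrite mulrAC; have [_ + _] := Hpsi x; exact.
have Sq f : Cc f -> S (q f) = integrated_form mu p f.
  by move=> cf; apply/funext => x; have [_ _ H] := Hpsi x; exact: H.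
by rewrite /integrated_rep (induced_rep_unique bS Sq).
Qed.

Section integration.
Variable p : (A -> X -> X) * (G -> X -> X).
Hypothesis hp : pos_nondeg_class_continuous mu alpha Rc X p.
Let cc : class_continuous mu alpha Rc p. Proof. by case: hp. Qed.
Let cp : continuous_covariant_rep alpha p. Proof. by case: cc. Qed.
Let T := integrated_rep mu q p.

Let bT : bounded_opmap T. Proof. exact: (integrated_repP cc).1. Qed.
Let Tq f : Cc f -> T (q f) = integrated_form mu p f. Proof. exact: (integrated_repP cc).2. Qed.
Let Tblin b : bounded_linear (T b). Proof. by case: bT. Qed.

(** T(.)x is applied to the integral formula for the product, where the
    integrand becomes pi(f r) U_r applied to the integrated form of g. *)
Lemma integrated_form_convolution f g x : Cc f -> Cc g ->
  T (amul (q f) (q g)) x = T (q f) (T (q g) x).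
Proof.
move=> cf cg; rewrite (q_convolution hG lG haar dyn ubR hq (Cc_cc cf) (Cc_cc cg)).
rewrite (bochner_linear hG haar (opmap_blinl x bT)
  (cc_q_kernel hG lG haar dyn ubR hq (Cc_cc cf) (Cc_cc cg))).
rewrite (Tq cf) integrated_formE.
congr (bochner mu _).
apply/funext => r.
rewrite /= Tq; last by apply: left_mul_Cc => //; exact: translation_Cc.
rewrite (form_left_mul hG haar cp _ _ (cc_translation dyn r (Cc_cc cg))).
by rewrite (form_translation hG haar cp _ _ (Cc_cc cg)) Tq.
Qed.

Lemma integrated_rep_bounded : bounded_alg_rep T.
Proof.
have [_ lT [C HC]] := bT; split; last by exists C.
split => // b c x.
have cont_l y := bounded_linear_continuous (opmap_blinl y bT).
move: c; apply: dense_eq.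
- exact: (bounded_linear_continuous (comp_blin (opmap_blinl x bT) (amul_blinr b))).
- exact: (bounded_linear_continuous (comp_blin (Tblin b) (opmap_blinl x bT))).
move=> g cg; move: b; apply: dense_eq.
- exact: (bounded_linear_continuous (comp_blin (opmap_blinl x bT) (amul_blinl _))).
- exact: cont_l.
by move=> f cf; exact: integrated_form_convolution.
Qed.

(** Integrating phi(r) a, with phi a bump near 1, gives an average of the
    vectors pi(a) U_r x over r near 1, which is close to pi(a)x. *)
Lemma integrated_rep_nondegenerate : nondegenerate_rep [set: B] T.
Proof.
have [_ ndp _ _] := hp; apply: dense_span_trans ndp => _ [a [x [_ ->]]].
apply: approx_closure => e e0.
have cU : (fun r => p.1 a (p.2 r x)) r @[r --> (1%g : G)] --> p.1 a x.
  rewrite -[in X in _ --> X](rep2_1 cp x).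
  have [_ _ /(_ x) cUx] := cp.
  apply: (@continuous_comp _ _ _ (fun r => p.2 r x) (p.1 a)); first exact: cUx.
  exact: (bounded_linear_continuous (rep_blin cp a)).
have /cvgrPdistC_le/(_ _ e0) nV := cU.
have [K [phi [KV cphi phi0 Iphi]]] := bump hG lG haar nV.
set c := \int_(mu) phi in Iphi.
have cT := cc_tensor a cphi; have CT := cc_Cc hG cT.
exists (T (c^-1 *: q (fun r => phi r *: a)) x).
  by apply: lin_span_mem; exists (c^-1 *: q (fun r => phi r *: a)), x.
rewrite (linZ (opmap_blinl x bT).1) Tq// integrated_formE.
have E : form_integrand p (fun r => phi r *: a) x = fun r => phi r *: p.1 a (p.2 r x).
  apply/funext => r; rewrite /form_integrand.
  by rewrite (linZ (rep_linl cp _)).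
have ck := cc_form cp x cT; rewrite E in ck; rewrite E.
have -> : p.1 a x = c^-1 *: (c *: p.1 a x) by rewrite scalerA mulVf ?scale1r// gt_eqF.
rewrite -scalerBr normrZ ger0_norm ?invr_ge0 ?(ltW Iphi)// ler_pdivrMl// distrC.
by apply: (bochner_weighted hG haar cphi ck phi0 (ltW e0)) => r /KV.
Qed.

(** On positive functions the integrand takes values in the closed cone. *)
Lemma integrated_rep_pos : pos_rep T.
Proof.
move=> b pb x px; have [_ _ pp pU] := hp.
have clT : closed ((fun b => T b x) @^-1` (pcone : set X)).
  by apply: preimage_closed => // y _; exact: (bounded_linear_continuous (opmap_blinl x bT)).
suff : ((fun b => T b x) @^-1` (pcone : set X)) b by [].
rewrite (closure_id (_ @^-1` _)).1//; move: pb; rewrite (q_cone hq).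
apply: closureS => _ [f [cf pf] <-]; rewrite /= Tq// integrated_formE.
apply: (bochner_closed_cone hG haar (cc_form cp x (Cc_cc cf)) clX).
- by rewrite -(scale0r x); exact: pconeZ.
- exact: pconeD.
- exact: pconeZ.
- move=> r; apply: pp => //; have [_ [S [_ _ _ pUr _]]] := pU r; exact: pUr.
Qed.

Lemma integrated_rep_pos_nondeg_bounded : pos_nondeg_bounded_rep B X T.
Proof.
split; [exact: integrated_rep_bounded|exact: integrated_rep_nondegenerate|exact:
  integrated_rep_pos].
Qed.

Lemma integrated_rep_iA a b x : p.1 a (T b x) = T (iA q a b) x.
Proof.
move: b; apply: dense_eq.
- exact: (bounded_linear_continuous (comp_blin (rep_blin cp a) (opmap_blinl x bT))).
- exact: (bounded_linear_continuous (comp_blin (opmap_blinl x bT) (iA_blin hG haar ubR hq a))).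
move=> f cf; rewrite /= (iA_q hG haar ubR hq)// !Tq//; last exact: left_mul_Cc.
by rewrite (form_left_mul hG haar cp _ _ (Cc_cc cf)).
Qed.

Lemma integrated_rep_iG r b x : p.2 r (T b x) = T (iG alpha q r b) x.
Proof.
move: b; apply: dense_eq.
- exact: (bounded_linear_continuous (comp_blin (rep_blin2 cp r) (opmap_blinl x bT))).
- exact: (bounded_linear_continuous (comp_blin (opmap_blinl x bT)
  (iG_blin hG haar dyn ubR hq r))).
move=> f cf; rewrite /= (iG_q hG haar dyn ubR hq)// !Tq//; last exact: translation_Cc.
by rewrite (form_translation hG haar cp _ _ (Cc_cc cf)).
Qed.

Variables (M : R).
Hypotheses (M0 : 0 <= M) (ali : @pos_left_approx R B M).

(** Extensions to centralizers are determined by their action on the T(b)x,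
    where the action of iA and iG is that of pi and U. *)
Lemma disintegrated_integrated_rep : disintegrated alpha q T = p.
Proof.
have ndT := integrated_rep_nondegenerate; have brT := integrated_rep_bounded.
have eT := centralizer_extP M0 ali brT ndT.
rewrite /disintegrated [RHS]surjective_pairing; congr pair; apply/funext => s.
  apply: (cent_ext_unique brT ndT eT (iA_centralizer hG lG haar dyn ubR hq s)).
    exact: (rep_blin cp).
  by move=> b x; exact: integrated_rep_iA.
apply: (cent_ext_unique brT ndT eT (iG_centralizer hG lG haar dyn ubR hq s)).
  exact: (rep_blin2 cp).
by move=> b x; exact: integrated_rep_iG.
Qed.

End integration.

Section disintegration.
Variables (M : R).
Hypotheses (M0 : 0 <= M) (ali : @pos_left_approx R B M).
Variable T : B -> X -> X.
Hypothesis hT : pos_nondeg_bounded_rep B X T.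
Hypothesis approxA : forall f (e : R), Cc f -> 0 < e ->
  exists a, `|q (left_mul_op a f) - q f| <= e.
Let bT : bounded_alg_rep T. Proof. by case: hT. Qed.
Let ndT : nondegenerate_rep [set: B] T. Proof. by case: hT. Qed.
Let eT := centralizer_extP M0 ali bT ndT.
Let S := centralizer_ext T.
Let p := disintegrated alpha q T.
Let cA a := iA_centralizer hG lG haar dyn ubR hq a.
Let cG r := iG_centralizer hG lG haar dyn ubR hq r.

Let bopT : bounded_opmap T.
Proof. by have [[bl ll _] bd] := bT; split. Qed.

Let Sblin (L : B -> B) : left_centralizer L -> bounded_linear (S L).
Proof. by have [[+ _ _] _] := eT; exact. Qed.

Let SM (L N : B -> B) x : left_centralizer L -> left_centralizer N ->
  S (L \o N) x = S L (S N x).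
Proof. by have [[_ _ +] _] := eT; exact. Qed.

Let SD c (L N : B -> B) x : left_centralizer L -> left_centralizer N ->
  S (fun b => c *: L b + N b) x = c *: S L x + S N x.
Proof. by have [[_ + _] _] := eT; exact. Qed.

Let p1E a : p.1 a = S (iA q a). Proof. by []. Qed.
Let p2E r : p.2 r = S (iG alpha q r). Proof. by []. Qed.

Let p1T a b x : p.1 a (T b x) = T (iA q a b) x.
Proof. exact: (cent_ext_rep _ _ eT (cA a)). Qed.
Let p2T r b x : p.2 r (T b x) = T (iG alpha q r b) x.
Proof. exact: (cent_ext_rep _ _ eT (cG r)). Qed.

Lemma disint_algebra_rep : bounded_alg_rep p.1.
Proof.
have [C [C0 HC]] := iAP hG haar ubR hq; have [D [D0 HD]] := cent_ext_bound M0 ali bT ndT.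
split; first split.
- by move=> a; exact: (Sblin (cA a)).
- by move=> x c a a'; rewrite !p1E (iA_comb hG lG haar dyn ubR hq) SD.
- by move=> a a' x; rewrite !p1E (iA_mul hG haar ubR hq) SM.
exists (D * C) => a x; rewrite p1E -(mulrA D).
apply: (HD S (iA q a) (C * `|a|) x eT (cA a)); first by rewrite mulr_ge0.
by have [_ + _] := HC a; exact.
Qed.

Lemma disint_group_mul r s x : p.2 (r * s)%g x = p.2 r (p.2 s x).
Proof.
by rewrite !p2E (iG_mul hG haar dyn ubR hq) SM.
Qed.

Lemma disint_group_1 x : p.2 1%g x = x.
Proof.
rewrite p2E; have -> // : S (iG alpha q 1%g) = id.
apply: (cent_ext_unique bT ndT eT (cG _)).
  by split => //; exists 1 => y; rewrite mul1r.
by move=> b y; rewrite (iG_1 hG haar dyn ubR hq).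
Qed.

Lemma disint_groupK r : cancel (p.2 r) (p.2 r^-1%g).
Proof. by move=> x; rewrite -disint_group_mul mulVg disint_group_1. Qed.

Lemma disint_groupVK r : cancel (p.2 r^-1%g) (p.2 r).
Proof. by move=> x; rewrite -disint_group_mul mulgV disint_group_1. Qed.

Lemma disint_covariant : covariant_rep alpha p.
Proof.
split; first by have [] := disint_algebra_rep.
- split; last exact: disint_group_mul.
  move=> r; split; first exact: (Sblin (cG r)).
  exists (p.2 r^-1%g); split; [exact: (Sblin (cG _))|exact: disint_groupK|exact: disint_groupVK].
- move=> s a x; rewrite p1E (iA_covariant hG haar dyn ubR hq) SM//; last exact: comp_centralizer.
  by rewrite SM.
Qed.

Lemma iG_continuous b : continuous (fun r => iG alpha q r b).
Proof.
move=> r0; have [nu [nu0 nuK H]] := iGP hG haar dyn ubR hq.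
have [C [nC cC _]] := compact_nbhs lG r0.
have [N HN] := nuK _ cC.
have clD : closed [set b | iG alpha q r b @[r --> r0] --> iG alpha q r0 b].
  apply: (@strong_continuity_closed _ _ _ _ _ `|N|) => //.
    by move=> r; have [[]] := H r.
  apply: filterS nC => r Cr x; have [_ Hr _] := H r.
  apply: (le_trans (Hr x)); rewrite ler_wpM2r//.
  by rewrite (le_trans (HN _ Cr))// ler_norm.
suff : [set b | iG alpha q r b @[r --> r0] --> iG alpha q r0 b] b by [].
rewrite (closure_id [set _ | _]).1//; apply: closureS (q_dense hq (b := b)) => _ [f cf <-] /=.
under eq_fun do rewrite (iG_q hG haar dyn ubR hq _ cf).
rewrite (iG_q hG haar dyn ubR hq _ cf).
exact: (q_translation_continuous hG lG haar dyn ubR hq cf).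
Qed.

Lemma disint_group_bound (r0 : G) : exists N : R, 0 <=
  N /\ \forall r \near r0, forall x, `|p.2 r x| <= N * `|x|.
Proof.
have [nu [nu0 nuK H]] := iGP hG haar dyn ubR hq.
have [C [nC cC _]] := compact_nbhs lG r0.
have [N HN] := nuK _ cC; have [D [D0 HD]] := cent_ext_bound M0 ali bT ndT.
exists (D * `|N|); split; first exact: mulr_ge0.
apply: filterS nC => r Cr x.
apply: (HD S (iG alpha q r) `|N| x eT (cG r) (normr_ge0 N)) => b; have [_ Hr _] := H r;
  apply: (le_trans (Hr b)); rewrite ler_wpM2r//.
by rewrite (le_trans (HN _ Cr))// ler_norm.
Qed.

(** On the vectors T(b)x the group acts through the strongly continuous
    operators iG r of B; these vectors span a dense subspace and the action is
    locally bounded. *)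
Lemma disint_group_continuous x : continuous (fun r => p.2 r x).
Proof.
move=> r0; have [N [N0 HN]] := disint_group_bound r0.
have lU r : linear (p.2 r) by have [] := Sblin (cG r).
have clD := strong_continuity_closed lU N0 HN.
suff : [set x | p.2 r x @[r --> r0] --> p.2 r0 x] x by [].
rewrite (closure_id [set _ | _]).1//.
have : closure (lin_span [set y | exists a x, [set: B] a /\ y = T a x]) x.
  by rewrite [X in X x]ndT.
apply: closureS => _ [n [c [w [Hw ->]]]].
suff : p.2 r (\sum_(i < n) c i *: w i) @[r --> r0] --> p.2 r0 (\sum_(i < n) c i *: w i) by [].
elim: n c w Hw => [|n IH] c w Hw.
  rewrite big_ord0 (lin0 (lU r0)).
  rewrite (_ : (fun r => p.2 r 0) = fun=> 0); first exact: cvg_cst.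
  by apply/funext => r; exact: (lin0 (lU r)).
rewrite big_ord_recl (lU r0).
set v := \sum_(i < n) _.
rewrite (_ : (fun r => p.2 r _) = fun r => c ord0 *: p.2 r (w ord0) + p.2 r v); last first.
  by apply/funext => r; exact: lU.
apply: cvgD; last by apply: (IH (fun i => c (lift ord0 i)) (fun i => w (lift ord0 i))).
apply: cvgZr; have [b [y [_ ->]]] := Hw ord0.
rewrite p2T (_ : (fun r => p.2 r _) = fun r => T (iG alpha q r b) y); last first.
  by apply/funext => r; exact: p2T.
apply: (@continuous_comp _ _ _ (fun r => iG alpha q r b) (fun b => T b y)).
  exact: iG_continuous.
exact: (bounded_linear_continuous (opmap_blinl y bopT)).
Qed.

Lemma disint_continuous_covariant : continuous_covariant_rep alpha p.
Proof.
split; [exact: disint_covariant|exact: disint_algebra_rep|exact: disint_group_continuous].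
Qed.

Let cp := disint_continuous_covariant.

Lemma disint_form_blin f : Cc f -> bounded_linear (integrated_form mu p f).
Proof.
move=> cf; have ccf := Cc_cc cf; split; first exact: (form_linear hG haar cp ccf).
have [_ [C HC]] := disint_algebra_rep.
have [e [e0 fe]] := cc_bounded ccf; have [cK _ _] := ccf.
have [nu [nu0 nuK H]] := iGP hG haar dyn ubR hq.
have [N HN] := nuK _ cK; have [D [D0 HD]] := cent_ext_bound M0 ali bT ndT.
set k := fine (mu (closure [set s | f s != 0])).
exists (`|C| * e * (D * `|N|) * k) => x; rewrite integrated_formE.
have -> : `|C| * e * (D * `|N|) * k * `|x| = `|C| * e * (D * `|N| * `|x|) * k by ring.
apply: (bochner_norm hG haar (cc_form cp x ccf)) => r Kr.
apply: (@le_trans _ _ (`|C| * `|f r| * `|p.2 r x|)).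
  by apply: (le_trans (HC _ _)); rewrite -!mulrA ler_wpM2r ?mulr_ge0// ler_norm.
apply: ler_pM; rewrite ?mulr_ge0//; first by rewrite ler_wpM2l.
apply: (HD S (iG alpha q r) `|N| x eT (cG r) (normr_ge0 N)) => b.
have [_ Hr _] := H r; apply: (le_trans (Hr b)); rewrite ler_wpM2r//.
by rewrite (le_trans (HN _ Kr))// ler_norm.
Qed.

(** Both sides are bounded operators, so they are compared on T(q g)x. There the
    integrand pi(f r) U_r T(q g)x equals T(iA (f r) (iG r (q g)))x, and T(.)x
    applied to the integral formula for q f q g gives T(q f) T(q g)x. *)
Lemma disint_form f : Cc f -> integrated_form mu p f = T (q f).
Proof.
move=> cf; apply/funext; apply: (span_eq bT ndT (disint_form_blin cf)).
  by have [] := bopT.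
move=> b x; move: b; apply: dense_eq.
- exact: (bounded_linear_continuous (comp_blin (disint_form_blin cf) (opmap_blinl x bopT))).
- have [bl _ _] := bopT.
  exact: (bounded_linear_continuous (comp_blin (bl (q f)) (opmap_blinl x bopT))).
move=> g cg; rewrite integrated_formE.
have [[_ _ TM] _] := bT; rewrite -TM.
rewrite (q_convolution hG lG haar dyn ubR hq (Cc_cc cf) (Cc_cc cg)).
rewrite (bochner_linear hG haar (opmap_blinl x bopT)
  (cc_q_kernel hG lG haar dyn ubR hq (Cc_cc cf) (Cc_cc cg))).
congr bochner; apply/funext => r; rewrite /form_integrand p2T p1T /=.
rewrite (iG_q hG haar dyn ubR hq)// (iA_q hG haar ubR hq)//.
exact: translation_Cc.
Qed.

Lemma disint_class_continuous : class_continuous mu alpha Rc p.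
Proof.
split; first exact: cp.
have [_ _ [C HC]] := bopT; exists C => f x cf.
by rewrite disint_form// -(q_sigma hG hq (Cc_cc cf)).
Qed.

Lemma disint_integrated_rep : integrated_rep mu q p = T.
Proof. by apply: induced_rep_unique => // f cf; rewrite disint_form. Qed.

(** T(b)x is approximated by T(q f)x and the latter by T(q (a f))x = pi(a) T(q
    f)x, with a from the approximate identity of A. *)
Lemma disint_nondegenerate : nondegenerate_rep [set: A] p.1.
Proof.
apply: dense_span_trans ndT => _ [b [x [_ ->]]]; apply: approx_closure => e e0.
have [_ _ [C HC]] := bopT.
set d := e / (2 * (`|C| * `|x| + 1)).
have C1 : 0 < `|C| * `|x| + 1 by rewrite ltr_wpDl// mulr_ge0.
have d0 : 0 < d by rewrite divr_gt0// mulr_gt0.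
have [_ [f cf <-] bf] := closure_approx (q_dense hq (b := b)) d0.
have [a Ha] := approxA cf d0.
exists (p.1 a (T (q f) x)); first by apply: lin_span_mem; exists a, (T (q f) x).
rewrite p1T (iA_q hG haar ubR hq)// -(linB (opmap_blinl x bopT).1).
apply: (le_trans (HC _ _)).
apply: (@le_trans _ _ ((`|C| * `|x| + 1) * `|b - q (left_mul_op a f)|)).
  rewrite mulrAC ler_wpM2r//; apply: (@le_trans _ _ (`|C| * `|x|)); last by rewrite lerDl.
  by rewrite ler_wpM2r// ler_norm.
rewrite mulrC -ler_pdivlMr//.
have -> : e / (`|C| * `|x| + 1) = d + d by rewrite /d; field; rewrite gt_eqF.
rewrite -(subrKA (q f)); apply: (le_trans (ler_normD _ _)); rewrite lerD//.
  exact: ltW.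
by rewrite distrC.
Qed.

Lemma disint_pos_nondeg_class_continuous : pos_nondeg_class_continuous mu alpha Rc X p.
Proof.
split; [exact: disint_class_continuous|exact: disint_nondegenerate| |].
- move=> a pa; apply: (cent_ext_pos M0 ali clX hT eT (cA a)).
  exact: (iA_pos hG haar ubR hq).
- move=> r; split; first exact: (Sblin (cG r)).
  exists (p.2 r^-1%g); split; [exact: (Sblin (cG _))|exact: disint_groupK|exact:
    disint_groupVK| |];
    apply: (cent_ext_pos M0 ali clX hT eT (cG _)); exact: (iG_pos hG haar dyn ubR hq).
Qed.

End disintegration.
End correspondence.

(** * The correspondence *)

Theorem theorem3p13 (R : realType) (G : topologicalGroupType)
    (mu : {measure set (borelType G) -> \bar R})
    (A : preorderedBanachAlgType R) (alpha : G -> A -> A)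
    (Rc : rep_class R G A)
    (B : preorderedBanachAlgType R) (q : (G -> A) -> B) :
  hausdorff_space G ->
  locally_compact [set: G] ->
  left_haar mu ->
  dynamical_system alpha ->
  has_pos_bounded_approx_left_id A ->
  uniformly_bounded_class alpha Rc ->
  (forall X p, Rc X p -> nondegenerate_rep [set: A] p.1) ->
  is_crossed_product mu alpha Rc q ->
  forall X : preorderedBanachType R, closed (pcone : set X) ->
  [/\ set_bij (pos_nondeg_class_continuous mu alpha Rc X)
              (pos_nondeg_bounded_rep B X)
              (fun p => integrated_rep mu q p),
      (forall p, pos_nondeg_class_continuous mu alpha Rc X p ->
         let T := integrated_rep mu q p in
         [/\ pos_nondeg_bounded_rep B X T,
             is_centralizer_ext T (centralizer_ext T),
             pos_nondeg_bounded_centralizer_rep (centralizer_ext T)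
           & disintegrated alpha q T = p])
    & (forall T, pos_nondeg_bounded_rep B X T ->
         let p := disintegrated alpha q T in
         [/\ is_centralizer_ext T (centralizer_ext T),
             pos_nondeg_bounded_centralizer_rep (centralizer_ext T),
             pos_nondeg_class_continuous mu alpha Rc X p
           & integrated_rep mu q p = T])].
Proof.
move=> hG lG haar dyn [I [le [u [I0 [le_refl le_trans le_dir] uid [MA uM] upos]]]] ubR _ hq X clX.
have [M [M0 ali]] := crossed_left_approx hG lG haar dyn ubR hq le_refl le_trans le_dir I0 uid uM upos.
have approxA f (e : R) : Cc f -> 0 < e -> exists a, `|q (left_mul_op a f) - q f| <= e.
  move=> cf e0; have [i0 Hi0] := q_left_mul_approx hG haar ubR hq le_trans le_dir I0 uid uM cf e0.
  by exists (u i0); exact: Hi0.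
have part1 p : pos_nondeg_class_continuous mu alpha Rc X p ->
    let T := integrated_rep mu q p in
    [/\ pos_nondeg_bounded_rep B X T, is_centralizer_ext T (centralizer_ext T),
      pos_nondeg_bounded_centralizer_rep (centralizer_ext T) & disintegrated alpha q T = p].
  move=> hp T; have hT : pos_nondeg_bounded_rep B X T.
    exact: (integrated_rep_pos_nondeg_bounded hG lG haar dyn ubR hq clX hp).
  split => //; first by case: hT => bT ndT _; exact: (centralizer_extP M0 ali bT ndT).
    exact: (centralizer_ext_pos_nondeg_bounded M0 ali clX hT).
  exact: (disintegrated_integrated_rep hG lG haar dyn ubR hq hp M0 ali).
have part2 T : pos_nondeg_bounded_rep B X T ->
    let p := disintegrated alpha q T in
    [/\ is_centralizer_ext T (centralizer_ext T), pos_nondeg_bounded_centralizer_rep (centralizer_ext T),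
      pos_nondeg_class_continuous mu alpha Rc X p & integrated_rep mu q p = T].
  move=> hT p; split.
  - by case: hT => bT ndT _; exact: (centralizer_extP M0 ali bT ndT).
  - exact: (centralizer_ext_pos_nondeg_bounded M0 ali clX hT).
  - exact: (disint_pos_nondeg_class_continuous hG lG haar dyn ubR hq clX M0 ali hT approxA).
  - exact: (disint_integrated_rep hG lG haar dyn ubR hq M0 ali hT).
split; [split|exact: part1|exact: part2].
- by move=> p /part1[].
- move=> p p' /set_mem/part1[_ _ _ Hp] /set_mem/part1[_ _ _ Hp'] TT.
  exact: etrans (esym Hp) (etrans (congr1 (disintegrated alpha q) TT) Hp').
- by move=> T /part2[_ _ hp <-]; exists (disintegrated alpha q T).
Qed.
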